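(* The space $(J_n)_2$ of all quadrics in the ideal $J_n$ is a $G$-module of dimension $$\dim\bigl((J_n)_2\bigr)=3^{n-2}\binom n2+4\sum_{m=3}^{n}3^{n-m}\binom nm\binom m2+\sum_{k=2}^{\lfloor n/2\rfloor}2k\cdot3^{n-2k}\binom n{2k}.$$ The following four classes of quadrics and their images under $S_n$ are the highest weight vectors for the distinct irreducible representations occurring in the $G$-module $(J_n)_2$ (that is, each is a highest weight vector, and $(J_n)_2$ is the direct sum of the irreducible $G$-submodules they generate, one summand for each such quadric up to sign): (i) $p_{12}\,p-p_1p_2+a_{12}^2$; (ii) for $3\le m\le n$, $m$ odd: $$\sum_{L\subseteq[m]\setminus\{1,2\}}(-1)^{|L|}p_L\,a_{12|L^c}+\sum_{j=3}^m\ \sum_{K\subseteq[m]\setminus\{1,2,j\}}(-1)^{|K|}a_{1j|K}\,a_{2j|K^c};$$ (iii) for $4\le m\le n$, $m$ even: $$\sum_{j=3}^m\ \sum_{K\subseteq[m]\setminus\{1,2,j\}}(-1)^{|K|}a_{1j|K}\,a_{2j|K^c};$$ (iv) for $3<m\le n$, $m$ even: $$\sum_{(L,L')}(-1)^{|L|}p_Lp_{L'}+2\sum_{j=2}^m\ \sum_{(K,K')}(-1)^{|K|}a_{1j|K}\,a_{1j|K'},$$ where $(L,L')$ ranges over the partitions of $[m]$ into two parts and $(K,K')$ ranges over the partitions of $[m]\setminus\{1,j\}$ into two parts. Here $L^c=[m]\setminus(\{1,2\}\cup L)$ and $K^c=[m]\setminus(\{1,2,j\}\cup K)$.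
   Context: $[n]=\{1,\dots,n\}$. $\mathcal{P}=\{p_I: I\subseteq[n]\}$ and $\mathcal{A}=\{a_{ij|K}: i,j\in[n]\text{ distinct},\,K\subseteq[n]\setminus\{i,j\}\}$ are sets of unknowns with $a_{ij|K}=a_{ji|K}$; $p=p_\emptyset$ and $a_{ij}=a_{ij|\emptyset}$. Let $\Sigma=(\sigma_{ij})$ be a symmetric $n\times n$-matrix of unknowns. Consider the homomorphism $\mathbb{R}[\mathcal{P}\cup\mathcal{A}]\to\mathbb{R}[\Sigma]$ sending $p_I$ to the principal minor of $\Sigma$ with index set $I$ (so $p_\emptyset\mapsto 1$) and $a_{ij|K}$ to the minor with rows $i$ followed by $K$ and columns $j$ followed by $K$ (elements of $K$ in increasing order). $J_n$ is the ideal generated by all homogeneous polynomials (standard grading) in the kernel of this map. $(J_n)_2$ is its degree-two part, a real vector space. Partitions into two parts are unordered, and a part may be empty. The symmetric group $S_n$ acts by permuting indices in the unknowns. The group $G={\rm SL}_2(\mathbb{R})^n$ acts on the vector space $W$ with basis $\mathcal{P}\cup\mathcal{A}$ as follows. Let $V_k\simeq\mathbb{R}^2$ be the defining representation of the $k$-th factor, with weight basis $e_k$ (weight $+1$) and $f_k$ (weight $-1$). Then $W=\bigotimes_{k=1}^nV_k\oplus\bigoplus_{i<j}\bigotimes_{k\in[n]\setminus\{i,j\}}V_k$. Here $p_L$ is identified with the tensor having factor $f_k$ for $k\in L$ and $e_k$ for $k\notin L$. For fixed $i,j$, $a_{ij|K}$ is identified with the tensor over $k\notin\{i,j\}$ having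 factor $f_k$ for $k\in K$ and $e_k$ for $k\notin K$. This corresponds to the action of ${\rm SL}_2(\mathbb{R})^n$ on $n\times2n$ matrices $({\rm Id}_n\ \Sigma)$ whose $k$-th factor replaces columns $k$ and $n+k$ by linear combinations of these two columns. The $k$-th lowering operator $\ell_k$ of the Lie algebra sends $p_L\mapsto p_{L\cup\{k\}}$ if $k\notin L$ (else $0$) and $a_{ij|L}\mapsto a_{ij|L\cup\{k\}}$ if $k\notin L\cup\{i,j\}$ (else $0$). The $k$-th raising operator $r_k$ sends $p_L\mapsto p_{L\setminus\{k\}}$ and $a_{ij|L}\mapsto a_{ij|L\setminus\{k\}}$ if $k\in L$ (else $0$). These extend to ${\rm Sym}_2(W)$, the space of all quadrics in $\mathbb{R}[\mathcal{P}\cup\mathcal{A}]$, by the Leibniz rule. The ideal $J_n$ is $G$-invariant. A highest weight vector is a nonzero weight vector annihilated by all raising operators. *)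

(* Defs.v *)
From mathcomp Require Import all_boot all_order all_algebra all_fingroup.
From mathcomp Require Import reals mpoly.

Set Implicit Arguments.
Unset Strict Implicit.
Unset Printing Implicit Defensive.

Import Order.TTheory GRing.Theory Num.Theory.
Local Open Scope ring_scope.

(* The index set [n] = {1, ..., n} is 'I_n, so that all indices are shifted
   by one: the paper's index k is the ordinal of value k - 1. *)

(* A representative (i, j, K) with i < j of each unknown a_{ij|K} = a_{ji|K}. *)
Notation aidx n :=
  {x : 'I_n * 'I_n * {set 'I_n} |
    [&& (x.1.1 < x.1.2)%N, x.1.1 \notin x.2 & x.1.2 \notin x.2]} (only parsing).

Notation unk n := ({set 'I_n} + aidx n)%type (only parsing).

(* dhomog has its vectType structure for a number of variables of the form
   m.+1 only, hence the predecessor here and the casts below. *)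
Definition unk_pred (n : nat) : nat := #|{: unk n}|.-1.

Lemma unk_predK n : (unk_pred n).+1 = #|{: unk n}|.
Proof. by apply/prednK/card_gt0P; exists (inl set0). Qed.

Definition unk_rank n (v : unk n) : 'I_(unk_pred n).+1 :=
  cast_ord (esym (unk_predK n)) (enum_rank v).

Definition unk_val n (k : 'I_(unk_pred n).+1) : unk n :=
  enum_val (cast_ord (unk_predK n) k).

Lemma unk_rankK n : cancel (@unk_rank n) (@unk_val n).
Proof. by move=> v; rewrite /unk_val /unk_rank cast_ordKV enum_rankK. Qed.

Lemma unk_valK n : cancel (@unk_val n) (@unk_rank n).
Proof. by move=> k; rewrite /unk_val /unk_rank enum_valK cast_ordK. Qed.

(* The unknowns sigma_ij with i <= j; the other ones are given by symmetry. *)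
Notation sidx n := {x : 'I_n * 'I_n | (x.1 <= x.2)%N} (only parsing).

Notation ringPA R n := {mpoly R[(unk_pred n).+1]} (only parsing).
Notation ringS R n := {mpoly R[#|{: sidx n}|]} (only parsing).
Notation quadric R n := (dhomog (unk_pred n).+1 R 2) (only parsing).

Section Gaussoids.
Context (R : realType) (n : nat).

Implicit Types (i j k : 'I_n) (K L : {set 'I_n}) (f : ringPA R n).

Definition X (v : unk n) : ringPA R n := 'X_(unk_rank v).

Definition p_ L : ringPA R n := X (inl L).

(* The value 0 is junk: it is only reached if i = j or if i or j is in K. *)
Definition a_ i j K : ringPA R n :=
  if insub (i, j, K) is Some x then X (inr x)
  else if insub (j, i, K) is Some x then X (inr x) else 0.

Definition Sigma : 'M[ringS R n]_n :=
  \matrix_(i, j)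
    (if insub (i, j) is Some x then 'X_(enum_rank (x : sidx n))
     else if insub (j, i) is Some x then 'X_(enum_rank (x : sidx n)) else 0).

Definition pminor L : ringS R n :=
  \det (mxsub (@enum_val _ (mem L)) (@enum_val _ (mem L)) Sigma).

(* enum K lists K in increasing order. *)
Definition followed_by i K (r : 'I_#|K|.+1) : 'I_n := nth i (i :: enum K) r.

Definition aminor i j K : ringS R n :=
  \det (mxsub (@followed_by i K) (@followed_by j K) Sigma).

Definition subst m (h : unk n -> {mpoly R[m]}) (f : ringPA R n) : {mpoly R[m]} :=
  f \mPo [tuple h (unk_val k) | k < (unk_pred n).+1].

Definition minor_map : ringPA R n -> ringS R n :=
  subst (fun v => match v with
                  | inl L => pminor L
                  | inr x => let: (i, j, K) := val x in aminor i j K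
                  end).

Definition ideal_gen (S : ringPA R n -> Prop) f : Prop :=
  exists (m : nat) (c g : 'I_m -> ringPA R n),
    (forall t, S (g t)) /\ f = \sum_(t < m) c t * g t.

Definition J : ringPA R n -> Prop :=
  ideal_gen (fun f => (exists d : nat, f \is d.-homog) /\ minor_map f = 0).

Definition perm_act (s : 'S_n) : ringPA R n -> ringPA R n :=
  subst (fun v => match v with
                  | inl L => p_ (s @: L)
                  | inr x => let: (i, j, K) := val x in
                             a_ (s i) (s j) (s @: K)
                  end).

(* An element (g_k)_k of SL_2(R)^n.  The basis (e_k, f_k) of V_k is indexed
   by 'I_2 in this order and g_k acts on coordinate columns. *)
Definition inSL (g : 'I_n -> 'M[R]_2) : Prop := forall k, \det (g k) = 1.

Definition ef (b : bool) : 'I_2 := if b then 1 else 0.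

Definition sl_act (g : 'I_n -> 'M[R]_2) : ringPA R n -> ringPA R n :=
  subst (fun v => match v with
    | inl L =>
        \sum_(L' : {set 'I_n})
          (\prod_k g k (ef (k \in L')) (ef (k \in L))) *: p_ L'
    | inr x => let: (i, j, K) := val x in
        \sum_(K' : {set 'I_n} | K' \subset ~: [set i; j])
          (\prod_(k | k \notin [set i; j])
              g k (ef (k \in K')) (ef (k \in K))) *: a_ i j K'
    end).

Lemma X_homog v : X v \is 1.-homog.
Proof. by rewrite /X dhomogX /= mdeg1. Qed.

Lemma a_homog i j K : a_ i j K \is 1.-homog.
Proof.
rewrite /a_; case: insubP => [x _ _|_]; first exact: X_homog.
by case: insubP => [x _ _|_]; [exact: X_homog | exact: rpred0].
Qed.

Lemma subst_homog (h : unk n -> ringPA R n) d f :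
  (forall v, h v \is 1.-homog) -> f \is d.-homog ->
  (subst h f : ringPA R n) \is d.-homog.
Proof.
move=> hh /dhomogP fd; rewrite /subst comp_mpolyE.
rewrite big_seq; apply: rpred_sum => m /fd <-; apply: rpredZ.
rewrite /= mdegE.
elim/big_ind2: _ => [|a b x y Ha Hb|t _]; first exact: dhomog1.
  exact: dhomogM.
by rewrite tnth_mktuple; have := dhomogMn (m t) (hh (unk_val t)); rewrite mul1n.
Qed.

Lemma sl_act_homog g d f : f \is d.-homog -> sl_act g f \is d.-homog.
Proof.
apply: subst_homog => -[L|x].
  by apply: rpred_sum => L' _; apply/rpredZ/X_homog.
case: (val x) => -[i j] K.
by apply: rpred_sum => K' _; apply/rpredZ/a_homog.
Qed.

Definition sl_quad (g : 'I_n -> 'M[R]_2) (q : quadric R n) : quadric R n :=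
  DHomog (sl_act_homog g (dhomog_is_dhomog q)).

Definition submodule (V : {vspace quadric R n}) : Prop :=
  forall g, inSL g -> forall q, q \in V -> sl_quad g q \in V.

Definition irreducible_module (V : {vspace quadric R n}) : Prop :=
  [/\ submodule V, V <> 0%VS
    & forall U : {vspace quadric R n}, submodule U -> (U <= V)%VS ->
        U = 0%VS \/ U = V].

Definition generated_by (q : quadric R n) (V : {vspace quadric R n}) : Prop :=
  [/\ submodule V, q \in V
    & forall U : {vspace quadric R n}, submodule U -> q \in U -> (V <= U)%VS].

(* The derivation with given values on the unknowns: extension of a linear
   endomorphism of W by the Leibniz rule. *)
Definition leibniz (D : unk n -> ringPA R n) f : ringPA R n :=
  \sum_v D v * mderiv (unk_rank v) f.

Definition raising k : ringPA R n -> ringPA R n :=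
  leibniz (fun v => match v with
    | inl L => if k \in L then p_ (L :\ k) else 0
    | inr x => let: (i, j, L) := val x in
               if k \in L then a_ i j (L :\ k) else 0
    end).

Definition torus (t : 'I_n -> R) (k : 'I_n) : 'M[R]_2 :=
  \matrix_(b, c) (if b != c then 0 else if b == 0 then t k else (t k)^-1).

Definition weight_vector f : Prop :=
  f <> 0 /\
  exists lam : 'I_n -> int, forall t : 'I_n -> R, (forall k, t k != 0) ->
    sl_act (torus t) f = (\prod_k t k ^ lam k) *: f.

Definition highest_weight_vector f : Prop :=
  weight_vector f /\ forall k, raising k f = 0.

(* The subset [m] of [n]. *)
Definition seg (m : nat) : {set 'I_n} := [set k : 'I_n | (k < m)%N].

(* The ordered pairs (L, S :\: L) subject to this condition represent each
   unordered partition of S into two possibly empty parts once; comparing the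
   ranks selects one of the two orderings.  In class (iv) the sets S have even
   cardinality, so the summands do not depend on this selection. *)
Definition part_rep (S L : {set 'I_n}) : bool :=
  (L \subset S) && (enum_rank L <= enum_rank (S :\: L))%N.

Definition quad1 (i1 i2 : 'I_n) : ringPA R n :=
  p_ [set i1; i2] * p_ set0 - p_ [set i1] * p_ [set i2]
  + a_ i1 i2 set0 ^+ 2.

Definition quad3 (m : nat) (i1 i2 : 'I_n) : ringPA R n :=
  \sum_(j < n | (2 <= j < m)%N)
    \sum_(K : {set 'I_n} | K \subset seg m :\: [set i1; i2; j])
      (-1) ^+ #|K| * a_ i1 j K * a_ i2 j (seg m :\: ([set i1; i2; j] :|: K)).

Definition quad2 (m : nat) (i1 i2 : 'I_n) : ringPA R n :=
  \sum_(L : {set 'I_n} | L \subset seg m :\: [set i1; i2])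
      (-1) ^+ #|L| * p_ L * a_ i1 i2 (seg m :\: ([set i1; i2] :|: L))
  + quad3 m i1 i2.

Definition quad4 (m : nat) (i1 : 'I_n) : ringPA R n :=
  \sum_(L : {set 'I_n} | part_rep (seg m) L)
      (-1) ^+ #|L| * p_ L * p_ (seg m :\: L)
  + 2%:R * \sum_(j < n | (1 <= j < m)%N)
      \sum_(K : {set 'I_n} | part_rep (seg m :\: [set i1; j]) K)
        (-1) ^+ #|K| * a_ i1 j K * a_ i1 j (seg m :\: [set i1; j] :\: K).

(* i1 and i2 are the paper's indices 1 and 2. *)
Inductive base_quadric : ringPA R n -> Prop :=
| Class1 i1 i2 of i1 = 0%N :> nat & i2 = 1%N :> nat :
    base_quadric (quad1 i1 i2)
| Class2 m i1 i2 of i1 = 0%N :> nat & i2 = 1%N :> nat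
    & (3 <= m <= n)%N & odd m :
    base_quadric (quad2 m i1 i2)
| Class3 m i1 i2 of i1 = 0%N :> nat & i2 = 1%N :> nat
    & (4 <= m <= n)%N & ~~ odd m :
    base_quadric (quad3 m i1 i2)
| Class4 m i1 of i1 = 0%N :> nat & (3 < m <= n)%N & ~~ odd m :
    base_quadric (quad4 m i1).

Definition listed_quadric f : Prop :=
  exists (s : 'S_n) (f0 : ringPA R n), base_quadric f0 /\ f = perm_act s f0.

End Gaussoids.

(* Main.v *)
From HB Require Import structures.
Require Import Defs.
From mathcomp Require Import all_boot all_order all_algebra all_fingroup.
From mathcomp Require Import reals mpoly ring lra zify.

Set Implicit Arguments.
Unset Strict Implicit.
Unset Printing Implicit Defensive.

Import Order.TTheory GRing.Theory Num.Theory.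
Local Open Scope ring_scope.

(* The highest weight vectors of (J_n)_2 are found by linear algebra.  A quadric
   that is highest of weight lam is determined by its coefficients beta_D on
   the products of an unknown with lower left index set D by another one: with
   Z = {lam = 0} and O = {lam = 1}, it is a combination of the alternating sums
   TT D (D + O) (Z \ D).  If it vanishes on minors, it may be evaluated at real
   symmetric matrices; an isolated edge {a, b} of the matrix reduces the
   relation to Z \ {a, b}, and after such reductions paths on at most four
   vertices determine beta.  The kernel is trivial for |O| = 4, a line
   (classes (ii) and (iii)) for |O| = 2 and the space of all
   beta_{ij} = u_i + u_j (classes (i) and (iv)) for O empty and |Z| even.
   Conversely these quadrics vanish on minors because of the identity
   2 N(-x)^-T X N(x) = det N(x) N(-x)^-T - det N(-x) N(x), N(x) = S adj(1 + XS),
   where X is the diagonal matrix of the variables.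
   Since sl_2^n acts on quadrics with weights at most 2, a stable subspace is
   generated by the highest weight vectors it contains, and vectors obtained by
   lowering highest weight vectors are free as soon as highest weight vectors of
   equal weight are. *)

(** * Highest weight vectors for a power of sl_2 *)

(** Two gaps have to be bridged. The statement is about the group, the computations are about its
    Lie algebra: the square of a raising or lowering operator kills every unknown, so a unipotent
    element acts on a quadric by a polynomial of degree two in its parameter, and finitely many
    parameters recover the operator without any limit. Moreover the map to minors does not
    intertwine lowering with a derivation: acting on the matrix (Id S) destroys the left block, and
    restoring it introduces a determinant as a factor. Infinitesimally, lowering at [k] becomes the
    derivation sending S i j to - S i k S k j, plus the correction S k k for each factor of a
    monomial. On quadrics the correction is the uniform multiplication by 2 S k k, so the kernel is
    stable in degree two. Complete reducibility enters through explicit polynomials in [r] and [l],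
    the operators [hw_part]. They form a family dual to the lowered vectors, and generation,
    freeness and irreducibility all follow from this duality. *)

Section HighestWeightSl2.
Context (F : numFieldType) (Q : vectType F) (r l : 'End(Q)).

Definition hw_string (m : nat) (q : Q) : Prop :=
  [/\ r q = 0, iter m.+1 l q = 0
    & forall b, r (iter b.+1 l q) = (b.+1 * (m - b))%:R *: iter b l q].

(* The projection onto the trivial and two-dimensional isotypic parts of an
   sl_2-module whose irreducible constituents have dimension at most 3. *)
Definition small_part : 'End(Q) :=
  \1%VF - 4%:R^-1 *: ((r \o (r \o (l \o l)))%VF + (l \o (r \o (r \o l)))%VF
                      + (l \o (l \o (r \o r)))%VF).

(* On such a module, [hw_part m a] maps the vector [l^a v], where v is a
   highest weight vector of weight m, to v, and kills the vectors [l^b w] for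
   any other weight or exponent. *)
Definition hw_part (m a : nat) : 'End(Q) :=
  match m, a with
  | 0, 0 => small_part - (r \o (l \o small_part))%VF
            - (l \o (r \o small_part))%VF
  | 1, 0 => (r \o (l \o small_part))%VF
  | 1, 1 => (r \o small_part)%VF
  | 2, 0 => 4%:R^-1 *: (r \o (r \o (l \o l)))%VF
  | 2, 1 => 4%:R^-1 *: (r \o (r \o l))%VF
  | 2, 2 => 4%:R^-1 *: (r \o r)%VF
  | _, _ => 0
  end.

Arguments hw_part : simpl never.

Let lfun_simpE :=
  (add_lfunE, opp_lfunE, scale_lfunE, id_lfunE, comp_lfunE, zero_lfunE).

Lemma small_partE q : small_part q =
  q - 4%:R^-1 *: (r (r (l (l q))) + l (r (r (l q))) + l (l (r (r q)))).
Proof. by rewrite /small_part !lfun_simpE. Qed.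

Lemma hw_partE m a q : hw_part m a q =
  match m, a with
  | 0, 0 => small_part q - r (l (small_part q)) - l (r (small_part q))
  | 1, 0 => r (l (small_part q))
  | 1, 1 => r (small_part q)
  | 2, 0 => 4%:R^-1 *: r (r (l (l q)))
  | 2, 1 => 4%:R^-1 *: r (r (l q))
  | 2, 2 => 4%:R^-1 *: r (r q)
  | _, _ => 0
  end.
Proof.
by case: m => [|[|[|m]]]; case: a => [|[|[|a]]]; rewrite /hw_part ?lfun_simpE.
Qed.

(** A formal cancellation: the three terms with [m = 2] add up to what [small_part] subtracts from
    the identity, and the terms with [m = 0] and [m = 1] add up to [small_part q]. *)
Lemma hw_part_sum q :
  q = \sum_(m < 3) \sum_(a < 3 | (a <= m)%N) iter a l (hw_part m a q).
Proof.
rewrite 3!big_ord_recr big_ord0 /=.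
do 3!rewrite [\sum_(a < 3 | _) _]big_mkcond 3!big_ord_recr big_ord0 /=.
rewrite !hw_partE !add0r !addr0 !linearZ /= -!scalerDr.
have /(congr1 (fun x => x + 4%:R^-1 *: (r (r (l (l q))) + l (r (r (l q)))
   + l (l (r (r q)))))) := small_partE q.
rewrite subrK => {1}<-; congr (_ + _).
by rewrite -[_ - l _]addrA -opprD subrK.
Qed.

(** On [iter b l q] with [m = 2] exactly one of the three words in [small_part] is nonzero, the one
    that first lowers down to the end of the string, and it acts as 2 * 2 = 4; this is the origin of
    the factor 1/4. On strings with [m < 2] all three words vanish. *)
Lemma small_part_iter m q b : (m <= 2)%N -> (b <= m)%N -> hw_string m q ->
  small_part (iter b l q) = if m == 2 then 0 else iter b l q.
Proof.
move=> m2 bm [r0 lm rl].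
have rl0 : r (l q) = m%:R *: q by rewrite [LHS](rl 0) mul1n subn0.
have rl1 : r (l (l q)) = (2 * (m - 1))%:R *: l q by exact: (rl 1).
have e4 : 2 * 2 / 4 = 1 :> F by rewrite -natrM divff // pnatr_eq0.
have e4' : 4^-1 * 2 * 2 = 1 :> F by rewrite -mulrA mulrC.
case: m m2 bm lm rl rl0 rl1 => [|[|[|m]]] // _ bm lm _ /= rl0 rl1;
case: b bm => [|[|[|b]]] // _; rewrite small_partE /= in lm *;
rewrite ?(mulr0, mul0r, mul1n, subnn, muln0, muln1, subn0, subn1, lm, r0, rl0, rl1, linear0, linearZ, scale0r, scaler0, addr0, add0r, subr0) //=;
rewrite ?(mulr0, mul0r, mul1n, subnn, muln0, muln1, subn0, subn1, lm, r0, rl0, rl1, linear0, linearZ, scale0r, scaler0, addr0, add0r, subr0) //=;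
rewrite ?scalerA /= ?(mulr0, mul0r, scale0r, scaler0, e4, e4', scale1r, addr0) ?subrr //.
Qed.

Lemma hw_part_iter m q b mu a : (m <= 2)%N -> (b <= m)%N ->
  (mu <= 2)%N -> (a <= mu)%N -> hw_string m q ->
  hw_part mu a (iter b l q) = if (mu == m) && (a == b) then q else 0.
Proof.
move=> m2 bm mu2 amu hq; have spE := small_part_iter m2 _ hq.
have sp0 := spE 0 isT; have sp1 := spE 1; have sp2 := spE 2.
case: hq => r0 lm rl.
have rl0 : r (l q) = m%:R *: q by rewrite [LHS](rl 0) mul1n subn0.
have rl1 : r (l (l q)) = (2 * (m - 1))%:R *: l q by exact: (rl 1).
have e4 : 2 * 2 / 4 = 1 :> F by rewrite -natrM divff // pnatr_eq0.
have e4' : 4^-1 * 2 * 2 = 1 :> F by rewrite -mulrA mulrC.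
case: m m2 bm lm rl rl0 rl1 spE sp0 sp1 sp2 => [|[|[|m]]] // _ bm lm _ /= rl0 rl1 _ sp0 sp1 sp2;
case: b bm => [|[|[|b]]] // _;
case: mu mu2 amu => [|[|[|mu]]] // _; case: a => [|[|[|a]]] // _;
rewrite ?hw_partE /= ?(sp0, sp1, sp2) // in lm *;
rewrite ?(mulr0, mul0r, mul1n, subnn, muln0, muln1, subn0, subn1, lm, r0, rl0, rl1, linear0, linearZ, scale0r, scaler0, addr0, add0r, subr0, scale1r) //=;
rewrite ?(mulr0, mul0r, mul1n, subnn, muln0, muln1, subn0, subn1, lm, r0, rl0, rl1, linear0, linearZ, scale0r, scaler0, addr0, add0r, subr0, scale1r) //=;
rewrite ?scalerA /= ?(mulr0, mul0r, scale0r, scaler0, e4, e4', scale1r, addr0) ?subrr //.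
Qed.

Section Commutation.
Variable T : 'End(Q).
Hypotheses (Tr : forall q, T (r q) = r (T q)) (Tl : forall q, T (l q) = l (T q)).

Lemma iter_comm b q : T (iter b l q) = iter b l (T q).
Proof. by elim: b => //= b IH; rewrite Tl IH. Qed.

Lemma hw_part_comm m a q : T (hw_part m a q) = hw_part m a (T q).
Proof.
have sp p : T (small_part p) = small_part (T p).
  by rewrite !small_partE !(linearB, linearZ, linearD) /= !(Tr, Tl).
rewrite !hw_partE.
by case: m => [|[|[|m]]]; case: a => [|[|[|a]]];
   rewrite ?(linearB, linear0, linearZ) /= ?(Tr, Tl, sp).
Qed.

Lemma hw_string_comm m q : hw_string m q -> hw_string m (T q).
Proof.
case=> r0 lm rl; split=> [||b]; first by rewrite -Tr r0 linear0.
  by rewrite -iter_comm lm linear0.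
by rewrite -!iter_comm -Tr rl linearZ.
Qed.

End Commutation.

Lemma iter_linear0 b : iter b l 0 = 0.
Proof. by elim: b => //= b ->; rewrite linear0. Qed.

End HighestWeightSl2.

Lemma free_codom (F : fieldType) (Q : vectType F) (T : finType) (f : T -> Q) :
  (forall c : T -> F, \sum_x c x *: f x = 0 -> forall x, c x = 0) ->
  free (codom f).
Proof.
move=> fP; have sz : size (codom f) == #|T| by rewrite size_codom.
rewrite -[codom f]/(tval (Tuple sz)); apply/freeP => k /= k0 i.
pose c x := k (enum_rank x).
suff : c (enum_val i) = 0 by rewrite /c enum_valK.
apply: fP; rewrite -[RHS]k0 (reindex (@enum_val T predT)) /=; last first.
  by exists enum_rank => x _; rewrite ?enum_valK ?enum_rankK.
apply: eq_bigr => j _; rewrite /c enum_valK; congr (_ *: _).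
by rewrite (nth_map (enum_val j)) -?cardE // [in LHS](enum_val_nth (enum_val j)).
Qed.

Section HighestWeightSl2Power.
Context (F : numFieldType) (Q : vectType F) (I : finType) (r l : I -> 'End(Q)).

Notation weight := {ffun I -> 'I_3}.
Implicit Types (q v : Q) (lam mu a b : weight) (k j : I).

Hypothesis rr_comm : forall j k, j != k -> forall q, r j (r k q) = r k (r j q).
Hypothesis ll_comm : forall j k, j != k -> forall q, l j (l k q) = l k (l j q).
Hypothesis rl_comm : forall j k, j != k -> forall q, r j (l k q) = l k (r j q).
(** The form in which complete reducibility, with constituents of dimension at most 3, is used for
    each index [k]. For quadrics it is verified on products of two unknowns. *)
Hypothesis hw_part_string : forall k (m a : nat) q, (a <= m)%N -> (m <= 2)%N ->
  hw_string (r k) (l k) m (hw_part (r k) (l k) m a q).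

Definition highest lam q : Prop :=
  forall k, hw_string (r k) (l k) (lam k) q.

Lemma leq_weight lam k : (lam k <= 2)%N.
Proof. by rewrite -ltnS ltn_ord. Qed.

Lemma hw_part_r_comm j k m (a : nat) q : j != k ->
  r k (hw_part (r j) (l j) m a q) = hw_part (r j) (l j) m a (r k q).
Proof.
move=> jk; apply: (@hw_part_comm _ _ (r j) (l j) (r k)) => {}q.
  by rewrite rr_comm // eq_sym.
by rewrite rl_comm // eq_sym.
Qed.

Lemma hw_part_l_comm j k m (a : nat) q : j != k ->
  l k (hw_part (r j) (l j) m a q) = hw_part (r j) (l j) m a (l k q).
Proof.
move=> jk; apply: (@hw_part_comm _ _ (r j) (l j) (l k)) => {}q.
  by rewrite rl_comm.
by rewrite ll_comm // eq_sym.
Qed.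

(* One index at a time, every vector is a combination of lowered vectors that
   are highest for this index. *)
Lemma highest_generate (P : Q -> Prop) (V : {vspace Q}) :
  (forall c u v, P u -> P v -> P (c *: u + v)) ->
  (forall k q, P q -> P (r k q)) -> (forall k q, P q -> P (l k q)) ->
  (forall k q, q \in V -> l k q \in V) ->
  (forall lam q, P q -> highest lam q -> q \in V) ->
  forall q, P q -> q \in V.
Proof.
move=> Plin Pr Pl Vl PV.
have P0 q : P q -> P 0 by move=> Pq; have := Plin (-1) _ _ Pq Pq; rewrite scaleN1r addNr.
have PZ c q : P q -> P (c *: q) by move=> Pq; have := Plin c _ _ Pq (P0 _ Pq); rewrite addr0.
have PD u v : P u -> P v -> P (u + v) by move=> Pu; have := Plin 1 _ v Pu; rewrite scale1r.
have PB u v : P u -> P v -> P (u - v) by move=> Pu Pv; rewrite -scaleN1r; apply/PD/PZ.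
have Psp k q : P q -> P (small_part (r k) (l k) q).
  move=> Pq; rewrite small_partE; apply/(PB _ _ Pq); apply/PZ; apply/PD; [apply/PD|].
  - by do 2!apply/Pr; do 2!apply/Pl.
  - by apply/Pl; do 2!apply/Pr; apply/Pl.
  - by do 2!apply/Pl; do 2!apply/Pr.
have Phw k m (a : nat) q : P q -> P (hw_part (r k) (l k) m a q).
  move=> Pq; rewrite hw_partE; case: m => [|[|[|m]]]; case: a => [|[|[|a]]];
  do ?[exact: P0 Pq|apply/PZ|apply/Pr|apply/Pl|apply/Psp] => //.
  by apply/PB; [apply/PB|]; do ?[apply/Pr|apply/Pl|apply/Psp].
have Viter k (a : nat) q : q \in V -> iter a (l k) q \in V.
  by move=> Vq; elim: a => //= a; apply: Vl.
(* Induction on the list [s] of the indices not yet treated: outside [s] the vector is already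
   highest of weight [lam]. At the start [s] contains all indices, so the weight 0 chosen there is a
   dummy. *)
suff H (s : seq I) q (lam : weight) : P q ->
    (forall k, k \notin s -> hw_string (r k) (l k) (lam k) q) -> q \in V.
  move=> q Pq; apply: (H (enum I) q ([ffun=> ord0] : weight) Pq) => k.
  by rewrite mem_enum inE.
elim: s q lam => [|k s IH] q lam Pq hq; first by apply: (PV lam) => // k; apply: hq.
rewrite (hw_part_sum (r k) (l k) q).
apply: rpred_sum => m _; apply: rpred_sum => a am; apply: Viter.
pose lam' := [ffun j => if j == k then m else lam j].
apply: (IH _ lam'); first exact: Phw.
move=> j js; rewrite /lam' ffunE; case: eqVneq => [->|jk].
  by apply: hw_part_string => //; rewrite -ltnS.
have jks : j \notin k :: s by rewrite inE negb_or jk.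
apply: hw_string_comm (hq j jks) => p.
  by rewrite hw_part_r_comm // eq_sym.
by rewrite hw_part_l_comm // eq_sym.
Qed.

Definition lower_on (s : seq I) b q := foldr (fun k x => iter (b k) (l k) x) q s.

Lemma eq_lower_on s b b' q : {in s, b =1 b'} -> lower_on s b q = lower_on s b' q.
Proof.
elim: s => //= k s IH E; rewrite IH => [|j js]; last by rewrite E // inE js orbT.
by rewrite E // mem_head.
Qed.

Lemma lower_on_rem s b q k : uniq s -> k \in s ->
  lower_on s b q = iter (b k) (l k) (lower_on (rem k s) b q).
Proof.
elim: s => //= j s IH /andP[js us]; rewrite inE.
case: eqVneq => [-> //|kj] /= ks; rewrite IH //.
elim: (nat_of_ord (b j)) => //= c ->.
by rewrite (@iter_comm _ _ (l k) (l j)) // => p; rewrite ll_comm // eq_sym.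
Qed.

Lemma lower_on_string s b q k m : k \notin s ->
  hw_string (r k) (l k) m q -> hw_string (r k) (l k) m (lower_on s b q).
Proof.
elim: s => //= j s IH; rewrite inE negb_or => /andP[kj ks] hq.
elim: (nat_of_ord (b j)) => [|c hc]; first exact: IH.
rewrite iterS; apply: (@hw_string_comm _ _ _ _ (l j)) hc => p; first by rewrite rl_comm.
by rewrite ll_comm // eq_sym.
Qed.

Definition lower b q := lower_on (enum I) b q.

(** The exponents range over 0, 1, 2 only, since no string is longer than three. *)
Definition lie_span q : {vspace Q} := <<codom (fun b => lower b q)>>%VS.

Definition lie_stable (V : {vspace Q}) : Prop :=
  forall k q, q \in V -> r k q \in V /\ l k q \in V.

Lemma memv_lower b q : lower b q \in lie_span q.
Proof. exact/memv_span/codom_f. Qed.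

Lemma lie_span_stable lam q : highest lam q -> lie_stable (lie_span q).
Proof.
move=> hq k.
suff H (T : 'End(Q)) : (forall b, T (lower b q) \in lie_span q) ->
    forall v, v \in lie_span q -> T v \in lie_span q.
  move=> v vq; split; apply: (H _ _ v vq) => b; rewrite /lower;
  rewrite (lower_on_rem b q (enum_uniq I) (mem_enum I k)).
    set q' := lower_on _ _ _.
    have hq' : hw_string (r k) (l k) (lam k) q'.
      by apply: lower_on_string (hq k); rewrite mem_rem_uniqF ?enum_uniq.
    case Eb: (nat_of_ord (b k)) => [|c] /=; first by case: hq' => -> _ _; rewrite mem0v.
    case: hq' => _ _ ->; apply: rpredZ.
    have c3 : (c < 3)%N by rewrite (leq_trans _ (ltn_ord (b k))) // Eb ltnS leqnSn.
    pose b' : weight := [ffun j => if j == k then Ordinal c3 else b j].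
    suff -> : iter c (l k) q' = lower b' q by apply: memv_lower.
    rewrite /lower (lower_on_rem _ _ (enum_uniq I) (mem_enum I k)) ffunE eqxx /=.
    congr iter; apply: eq_lower_on => j js; rewrite ffunE ifN //.
    by apply: contraTneq js => ->; rewrite mem_rem_uniqF ?enum_uniq.
  set q' := lower_on _ _ _; rewrite -iterS.
  have hq' : hw_string (r k) (l k) (lam k) q'.
    by apply: lower_on_string (hq k); rewrite mem_rem_uniqF ?enum_uniq.
  (* The raised exponent may leave the range of ['I_3]; it then exceeds [lam k], and the vector is
     0. *)
  have [c3|c3] := ltnP (b k).+1 3.
    pose b' : weight := [ffun j => if j == k then Ordinal c3 else b j].
    suff -> : iter (b k).+1 (l k) q' = lower b' q by apply: memv_lower.
    rewrite /lower (lower_on_rem _ _ (enum_uniq I) (mem_enum I k)) ffunE eqxx /=.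
    congr (l k (iter _ _ _)); apply: eq_lower_on => j js; rewrite ffunE ifN //.
    by apply: contraTneq js => ->; rewrite mem_rem_uniqF ?enum_uniq.
  case: hq' => _ l0 _.
  have /subnK <- : ((lam k).+1 <= (b k).+1)%N by rewrite (leq_trans _ c3) // ltnS leq_weight.
  by rewrite iterD l0 iter_linear0 mem0v.
move=> HT v /(memv_img T) Tv; apply: subvP Tv; rewrite limg_span.
by apply/span_subvP => _ /mapP[_ /codomP[b ->] ->].
Qed.

Lemma lie_span_sub q (V : {vspace Q}) :
  lie_stable V -> q \in V -> (lie_span q <= V)%VS.
Proof.
move=> Vs Vq; apply/span_subvP => _ /codomP[b ->]; rewrite /lower.
elim: (enum I) => //= k s IH; elim: (nat_of_ord (b k)) => //= c.
by move/(Vs k) => [].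
Qed.

Lemma mem_lie_span q : q \in lie_span q.
Proof.
have E : lower [ffun=> ord0] q = q.
  by rewrite /lower; elim: (enum I) => //= k s ->; rewrite ffunE.
by rewrite -{1}E memv_lower.
Qed.

Definition extract mu a : 'End(Q) :=
  foldr (fun k T => (hw_part (r k) (l k) (mu k) (a k) \o T)%VF) \1%VF (enum I).

Definition dominated a lam := [forall k, a k <= lam k]%N.

(** Operators at distinct indices commute, so the claim reduces to [hw_part_iter] at one index at a
    time. The outcome is a duality: [extract mu a] detects one lowered vector and annihilates those
    of any other weight or exponent. *)
Lemma extract_lower lam q mu a b : highest lam q ->
  dominated a mu -> dominated b lam ->
  extract mu a (lower b q) = if (mu == lam) && (a == b) then q else 0.
Proof.
move=> hq /forallP am /forallP bl.
have -> : (mu == lam) && (a == b)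
    = all (fun k => (mu k == lam k :> nat) && (a k == b k :> nat)) (enum I).
  apply/andP/allP => [[/eqP-> /eqP->] k _|H]; first by rewrite !eqxx.
  by split; apply/eqP/ffunP => k; apply/val_inj/eqP;
     have /andP[] := H k (mem_enum I k).
rewrite /extract /lower; elim: (enum I) (enum_uniq I) => [|k s IH] /=.
  by rewrite id_lfunE.
case/andP=> ks us; rewrite comp_lfunE.
set T := foldr _ _ _ in IH *.
have -> : T (iter (b k) (l k) (lower_on s b q)) = iter (b k) (l k) (T (lower_on s b q)).
  apply: (@iter_comm _ _ (l k) T) => p; rewrite {IH}/T.
  elim: s ks {us} => [|j s IH] /=; first by rewrite !id_lfunE.
  rewrite inE negb_or => /andP[kj ks]; rewrite !comp_lfunE IH //.
  by rewrite hw_part_l_comm // eq_sym.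
rewrite IH //; case: ifP => _; last by rewrite andbF iter_linear0 linear0.
rewrite andbT; apply: hw_part_iter (hq k) => //; exact: leq_weight.
Qed.

Lemma lower_undominated lam q b : highest lam q -> ~~ dominated b lam ->
  lower b q = 0.
Proof.
move=> hq; rewrite negb_forall => /existsP[k]; rewrite -ltnNge => kb.
rewrite /lower (lower_on_rem _ _ (enum_uniq I) (mem_enum I k)).
have [_ l0 _] : hw_string (r k) (l k) (lam k) (lower_on (rem k (enum I)) b q).
  by apply: lower_on_string (hq k); rewrite mem_rem_uniqF ?enum_uniq.
by rewrite -(subnK kb) iterD l0 iter_linear0.
Qed.

(** Discards generators that vanish; the number of the remaining ones is the dimension of the
    irreducible module of highest weight [lam]. *)
Lemma lie_span_dominated lam q : highest lam q ->
  lie_span q = <<codom (fun b : {b | dominated b lam} => lower (val b) q)>>%VS.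
Proof.
move=> hq; apply/eqP; rewrite eqEsubv; apply/andP; split; apply/span_subvP => v.
  case/codomP=> b ->; have [bl|bl] := boolP (dominated b lam).
    exact/memv_span/(codom_f (fun b : {b | dominated b lam} => lower (val b) q) (Sub b bl)).
  by rewrite (lower_undominated hq bl) mem0v.
by case/codomP=> b ->; apply: memv_lower.
Qed.

(* A nonzero stable subspace contains a highest weight vector, which
   [extract] identifies as a multiple of q. *)
Lemma lie_span_irreducible lam q (V : {vspace Q}) : highest lam q ->
  lie_stable V -> (V <= lie_span q)%VS -> V = 0%VS \/ V = lie_span q.
Proof.
move=> hq Vs Vq; have [->|V0] := eqVneq V 0%VS; [by left | right].
apply/eqP; rewrite eqEsubv Vq lie_span_sub //=.
have [v0 v0V v0n] : exists2 v, v \in V & v != 0.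
  by exists (vpick V); rewrite ?memv_pick // vpick0.
have [//|qV] := boolP (q \in V).
(* Generation by highest weight vectors is applied to V with target space 0: if [q] is not in V, all
   highest weight vectors of V will turn out to be 0. *)
suff : v0 \in 0%VS by rewrite memv0 (negPf v0n).
apply: (@highest_generate (fun v => v \in V)) v0V.
- by move=> c u v uV vV; rewrite rpredD ?rpredZ.
- by move=> k p /(Vs k) [].
- by move=> k p /(Vs k) [].
- by move=> k p; rewrite !memv0 => /eqP->; rewrite linear0.
move=> mu v vV hv; rewrite memv0; apply: contraNT qV => vn0.
(* With exponents 0, [extract mu z] fixes [v] and sends every generator of [lie_span q] to [q] or to
   0, so [v] is a multiple of [q]. *)
pose z : weight := [ffun=> ord0].
have zP w : dominated z w by apply/forallP => k; rewrite ffunE.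
have ev : extract mu z v = v.
  have := extract_lower hv (zP mu) (zP mu); rewrite !eqxx /=.
  suff -> : lower z v = v by [].
  by rewrite /lower; elim: (enum I) => //= k s ->; rewrite ffunE.
suff : v \in <[q]>%VS.
  case/vlineP=> c vE; rewrite vE scaler_eq0 negb_or in vn0; case/andP: vn0 => c0 _.
  by rewrite -[q](scalerK c0) -vE rpredZ.
have := subvP Vq v vV; rewrite (lie_span_dominated hq) -{2}ev.
move=> /(memv_img (extract mu z)); apply: subvP; rewrite limg_span.
apply/span_subvP => _ /mapP[_ /codomP[b ->] ->].
rewrite (extract_lower hq (zP _) (valP b)); case: ifP => _; last exact: mem0v.
exact: memv_line.
Qed.

Lemma card_dominated lam :
  #|{: {b : weight | dominated b lam}}| = (\prod_k (lam k).+1)%N.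
Proof.
have -> : #|{: {b : weight | dominated b lam}}|
    = #|(family (fun k => [pred x : 'I_3 | x <= lam k]%N) : pred weight)|.
  rewrite card_sig; apply: eq_card => b; apply/forallP/familyP => H k;
  by have := H k; rewrite ?inE.
rewrite (card_family (fun k => [pred x : 'I_3 | x <= lam k]%N)) foldrE big_map big_enum /=.
apply: eq_bigr => k _; rewrite -sum1_card.
by case: (lam k) => [[|[|[|m]]] //= _]; rewrite big_mkcond !big_ord_recr big_ord0.
Qed.

Section Sum.
Context (J : finType) (lam : J -> weight) (q : J -> Q).
Hypothesis hq : forall t, highest (lam t) (q t).
Hypothesis free_q : forall lam0 (c : J -> F),
  \sum_(t | lam t == lam0) c t *: q t = 0 -> forall t, lam t = lam0 -> c t = 0.

Let lowered (x : {x : J * weight | dominated x.2 (lam x.1)}) : Q :=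
  lower (val x).2 (q (val x).1).

(** Applying [extract (lam t) b] to a linear relation leaves a relation between the highest weight
    vectors of weight [lam t], whose coefficients are those belonging to the exponent [b]. *)
Lemma lowered_free : free (codom lowered).
Proof.
apply: free_codom => c c0 x0.
pose d p := oapp c 0 (insub p).
have dE x : d (val x) = c x by rewrite /d valK.
have {}c0 : \sum_(t : J) \sum_(b : weight | dominated b (lam t))
    d (t, b) *: lower b (q t) = 0.
  rewrite -[RHS]c0 (pair_big_dep xpredT (fun t b => dominated b (lam t))) /=.
  rewrite (reindex_omap (val : {x : J * weight | dominated x.2 (lam x.1)} -> _) insub) /=; last first.
    by move=> p Pp; rewrite insubT.
  apply: eq_big => [x|x _]; first by rewrite valK (valP x) eqxx.
  by rewrite -surjective_pairing dE.
case x0E : (val x0) (valP x0) => [t b] /= bt; rewrite -dE x0E.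
apply: (free_q (lam0 := lam t) (c := fun t' => d (t', b))) => //.
have := congr1 (extract (lam t) b) c0; rewrite linear0 linear_sum => E.
rewrite -{}[RHS]E big_mkcond; apply: eq_bigr => t' _; rewrite linear_sum.
rewrite (eq_bigr (fun b' => if (lam t == lam t') && (b == b')
    then d (t', b') *: q t' else 0)); last first.
  move=> b' b't'; rewrite linearZ /= (extract_lower (hq t') bt b't').
  by case: ifP => _; rewrite ?scaler0.
rewrite -big_mkcondr /= eq_sym; case: eqP => [ltt'|_]; last first.
  by rewrite big1 // => b' /andP[].
by rewrite (big_pred1 b) // => b' /=; rewrite eq_sym; case: eqP => [->|];
   rewrite ?andbF // -ltt' bt.
Qed.

Lemma highest_neq0 t : q t != 0.
Proof.
apply/eqP => q0; suff /eqP : (t == t)%:R = 0 :> F by rewrite eqxx oner_eq0.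
apply: (free_q (lam0 := lam t) (c := fun t' => (t' == t)%:R)) => //.
by rewrite big1 // => t' _; case: eqP => [->|_]; rewrite ?q0 ?scaler0 ?scale0r.
Qed.

Lemma lowered_sub : (<<codom lowered>> <= \sum_t lie_span (q t))%VS.
Proof.
apply/span_subvP => _ /codomP[[[t b] bt] ->]; rewrite /lowered /=.
exact: subvP (sumv_sup t isT (subvv _)) _ (memv_lower _ _).
Qed.

Lemma dim_lie_span_leq t : (\dim (lie_span (q t)) <= \prod_k (lam t k).+1)%N.
Proof.
rewrite (lie_span_dominated (hq t)) -card_dominated.
by apply: leq_trans (dim_span _) _; rewrite size_codom.
Qed.

Lemma dim_sum_lie_span_geq :
  (\sum_t \prod_k (lam t k).+1 <= \dim (\sum_t lie_span (q t)))%N.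
Proof.
rewrite (leq_trans _ (dimvS lowered_sub)) //.
have /eqP -> := lowered_free; rewrite size_codom card_sig -sum1_card /=.
rewrite -(pair_big_dep xpredT (fun t b => dominated b (lam t)) (fun _ _ => 1%N)) /=.
by rewrite leq_sum // => t _; rewrite -card_dominated card_sig sum1_card.
Qed.

(** By counting: the dimensions of the summands add up to at most the number of lowered vectors, and
    these are free in the sum. *)
Lemma directv_sum_lie_span : directv (\sum_t lie_span (q t)).
Proof.
rewrite directvEgeq /=; apply: leq_trans dim_sum_lie_span_geq.
by apply: leq_sum => t _; apply: dim_lie_span_leq.
Qed.

(** Passes from vectors of equal weight to all of them, since they are nonzero vectors of the
    summands of a direct sum. *)
Lemma highest_free (c : J -> F) : \sum_t c t *: q t = 0 -> forall t, c t = 0.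
Proof.
move=> c0 t; have := directv_sum_lie_span => /directv_sumP/(_ t isT).
move/eqP/eqP => dv; apply/eqP; have : c t *: q t == 0.
  rewrite -memv0 -dv memv_cap memvZ ?mem_lie_span //=.
  move: c0; rewrite (bigD1 t) //= => /eqP; rewrite addr_eq0 => /eqP ->.
  rewrite memvN; apply: memv_sumr => t' _; exact/memvZ/mem_lie_span.
by rewrite scaler_eq0 (negPf (highest_neq0 t)) orbF.
Qed.

Lemma dim_sum_lie_span :
  (\dim (\sum_t lie_span (q t)) = \sum_t \prod_k (lam t k).+1)%N.
Proof.
apply/eqP; rewrite eqn_leq dim_sum_lie_span_geq andbT.
rewrite (leq_trans (dimv_leq_sum _ _ _)) //.
by apply: leq_sum => t _; apply: dim_lie_span_leq.
Qed.

End Sum.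

End HighestWeightSl2Power.

(** Laplace expansion along a unit row removes the row and the column of the same index. Once [f] is
    onto, it permutes rows and columns alike and the two signs cancel, so the order in which [f]
    lists the indices does not matter. *)
Lemma det_mxsub_unit_rows (A : comNzRingType) n m (f : 'I_m -> 'I_n) (B : 'M[A]_n) :
  injective f ->
  (forall r, r \notin codom f -> forall c, B r c = (r == c)%:R) ->
  \det (mxsub f f B) = \det B.
Proof.
elim: n m f B => [|n IH] m f B f_inj Bf.
  case: m f f_inj Bf => [|m] f f_inj Bf; first by rewrite !det_mx00.
  by case: (f ord0).
have [/existsP[r rf]|] := boolP [exists r, r \notin codom f]; last first.
  rewrite negb_exists => /forallP fs.
  have fsurj r : r \in codom f by have := fs r; rewrite negbK.
  have mn : m = n.+1.
    rewrite -[LHS](card_ord m) -(card_codom f_inj) -[RHS](card_ord n.+1).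
    by apply: eq_card => r; rewrite fsurj.
  move: f f_inj {Bf fs fsurj}; rewrite {}mn => f f_inj.
  have -> : mxsub f f B = row_perm (perm f_inj) (col_perm (perm f_inj) B).
    by apply/matrixP => i j; rewrite !mxE !permE.
  rewrite row_permE col_permE !det_mulmx !det_perm odd_permV mulrCA.
  by rewrite -signr_addb addbb mulr1.
rewrite (expand_det_row B r) (bigD1 r) //= big1 ?addr0; last first.
  by move=> c cr; rewrite Bf // eq_sym (negPf cr) mul0r.
rewrite Bf // eqxx mul1r /cofactor -signr_odd oddD addbb expr0 mul1r.
have f'P i : exists j, f i = lift r j.
  by case: (unliftP r (f i)) => [j ->|fi]; [exists j | rewrite -fi codom_f in rf].
have [f' f'E] := fin_all_exists f'P.
rewrite -(IH m f').
- by congr (\det _); apply/matrixP => i j; rewrite !mxE !f'E.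
- by move=> i j ij; apply: f_inj; rewrite !f'E ij.
move=> i fi c; rewrite !mxE Bf ?(inj_eq lift_inj) //.
by apply: contra fi => /codomP[j]; rewrite f'E => /lift_inj ->; rewrite codom_f.
Qed.

(** * Relations between minors of a symmetric matrix *)

Section RowMinors.
Context (A : comNzRingType) (n : nat).
Implicit Types (S C : 'M[A]_n) (T K : {set 'I_n}) (i j k r : 'I_n).

Definition set_row C r (v : 'I_n -> A) : 'M[A]_n :=
  \matrix_(i, j) (if i == r then v j else C i j).

Lemma det_set_row C r v :
  \det (set_row C r v) = \sum_c v c * cofactor C r c.
Proof.
rewrite (expand_det_row _ r); apply: eq_bigr => c _; rewrite mxE eqxx.
congr (_ * (_ * \det _)); apply/matrixP => i j.
by rewrite !mxE eq_sym (negPf (neq_lift _ _)).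
Qed.

(** Cramer's rule: the numbers [\det (set_row C r v)] are the entries of [v] times the adjugate of
    [C], and the adjugate times [C] is scalar. *)
Lemma det_set_row_sum C (v : 'I_n -> A) k :
  \sum_r \det (set_row C r v) * C r k = v k * \det C.
Proof.
have := congr1 (fun M : 'rV_n => M 0 k)
  (mulmxA (\row_c v c) (\adj C) C).
rewrite mul_adj_mx mul_mx_scalar !mxE mulrC => ->.
apply: eq_bigr => r _; congr (_ * _); rewrite det_set_row mxE.
by apply: eq_bigr => c _; rewrite !mxE.
Qed.

Lemma det_eq_rows C r1 r2 : r1 != r2 -> (forall c, C r1 c = C r2 c) -> \det C = 0.
Proof. by move=> r12 E; apply: (determinant_alternate r12 E). Qed.

(* The rows in T are rows of S, the other ones are unit vectors, so that the
   determinant is the minor with rows s @: T and columns T. *)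
Definition row_minor S (s : 'I_n -> 'I_n) T : 'M[A]_n :=
  \matrix_(r, c) (if r \in T then S (s r) c else (r == c)%:R).

Lemma det_row_minor S s T m (f : 'I_m -> 'I_n) :
  injective f -> codom f =i T ->
  \det (row_minor S s T) = \det (mxsub (s \o f) f S).
Proof.
move=> f_inj fT; rewrite -(det_mxsub_unit_rows f_inj) => [|r]; last first.
  by rewrite fT => rT c; rewrite mxE (negPf rT).
by congr (\det _); apply/matrixP => i j; rewrite !mxE -fT codom_f.
Qed.

Definition pm S K := \det (row_minor S id K).
(** Row [j] of the matrix carries row [i] of S. Row and column lists thus correspond position by
    position, and no sign depends on how [K] is ordered. *)
Definition am S i j K := \det (row_minor S [eta id with j |-> i] (j |: K)).

Lemma pm_mxsub S K :
  pm S K = \det (mxsub (@enum_val _ (mem K)) (@enum_val _ (mem K)) S).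
Proof.
rewrite /pm (@det_row_minor _ _ _ _ (@enum_val _ (mem K))) //; first exact: enum_val_inj.
move=> r; apply/codomP/idP => [[x ->]|rK]; first exact: enum_valP.
by exists (enum_rank_in rK r); rewrite enum_rankK_in.
Qed.

Definition followed i K (r : 'I_#|K|.+1) : 'I_n := nth i (i :: enum K) r.

Lemma followed_inj j K : j \notin K -> injective (@followed j K).
Proof.
move=> jK x y /eqP; rewrite nth_uniq ?inE /= -?cardE ?ltn_ord //.
  by move/eqP/val_inj.
by rewrite mem_enum jK enum_uniq.
Qed.

Lemma am_mxsub S i j K : j \notin K ->
  am S i j K = \det (mxsub (@followed i K) (@followed j K) S).
Proof.
move=> jK; rewrite /am (@det_row_minor _ _ _ _ (@followed j K)); first last.
- move=> r; rewrite !inE; apply/codomP/idP => [[[[|x] xP] ->]|].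
  + by rewrite /followed /= eqxx.
  + by rewrite /followed /= -[_ \in K]mem_enum mem_nth ?orbT // -cardE.
  case: (eqVneq r j) => [-> _|_ /=]; first by exists ord0.
  rewrite -mem_enum => rK; have := rK; rewrite -index_mem -cardE => iK.
  by exists (lift ord0 (Ordinal iK)); rewrite /followed /= nth_index.
- exact: followed_inj.
congr (\det _); apply/matrixP => x y; rewrite !mxE /=; congr (S _ _).
rewrite /followed; case: x => [[|x] xP] /=; first by rewrite eqxx.
have xK : (x < size (enum K))%N by rewrite -cardE.
rewrite ifN; first exact: set_nth_default.
by apply: contraNneq jK => <-; rewrite -mem_enum mem_nth.
Qed.

Lemma am_sym S i j K : S^T = S -> i \notin K -> j \notin K ->
  am S i j K = am S j i K.
Proof.
move=> sS iK jK; rewrite !am_mxsub // -det_tr.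
by congr (\det _); apply/matrixP => x y; rewrite !mxE -[in LHS]sS mxE.
Qed.

(** Lets diagonal entries of the resolvent produce principal minors. *)
Lemma am_diag S i K : am S i i K = pm S (i |: K).
Proof.
congr (\det _); apply/matrixP => r c; rewrite !mxE /=.
by case: eqP => // ->.
Qed.

Section Derivation.
Variable D : A -> A.
Hypotheses (DD : forall x y, D (x + y) = D x + D y)
  (DM : forall x y, D (x * y) = D x * y + x * D y).

Lemma derivation0 : D 0 = 0.
Proof. by have := DD 0 0; rewrite addr0 -[X in X = _]addr0 => /addrI. Qed.

Lemma derivation1 : D 1 = 0.
Proof. by have := DM 1 1; rewrite !mulr1 mul1r -[X in X = _]addr0 => /addrI. Qed.

Lemma derivationN x : D (- x) = - D x.
Proof. by apply/eqP; rewrite -addr_eq0 -DD addNr derivation0. Qed.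

Lemma derivation_sum (I : Type) (s : seq I) (P : pred I) (F : I -> A) :
  D (\sum_(i <- s | P i) F i) = \sum_(i <- s | P i) D (F i).
Proof. by elim/big_rec2: _ => [|i x y _ <-]; rewrite ?derivation0 ?DD. Qed.

Lemma derivation_prod (I : finType) (F : I -> A) :
  D (\prod_i F i) = \sum_r \prod_i (if i == r then D (F i) else F i).
Proof.
have H s : uniq s -> D (\prod_(i <- s) F i)
    = \sum_(r <- s) \prod_(i <- s) (if i == r then D (F i) else F i).
  elim: s => [|j s IH] /=; first by rewrite !big_nil derivation1.
  case/andP=> js us; rewrite !big_cons DM IH // eqxx mulr_sumr; congr (_ * _ + _).
    by apply: eq_big_seq => i is_; rewrite ifN //; apply: contraNneq js => <-.
  apply: eq_big_seq => r rs; rewrite big_cons ifN //.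
  by apply: contraNneq js => ->.
exact: H (index_enum_uniq I).
Qed.

Lemma derivation_det C :
  D (\det C) = \sum_r \det (set_row C r (fun c => D (C r c))).
Proof.
rewrite /determinant derivation_sum exchange_big /=; apply: eq_bigr => s _.
rewrite -mulr_sumr !mulr_sign.
have <- : D (\prod_i C i (s i)) =
   \sum_r \prod_i set_row C r (fun c => D (C r c)) i (s i).
  rewrite derivation_prod; apply: eq_bigr => r _; apply: eq_bigr => i _.
  by rewrite mxE; case: eqP => // ->.
by case: (odd_perm s); rewrite ?derivationN.
Qed.

Lemma derivation_row_minor S s T :
  D (\det (row_minor S s T)) =
  \sum_(r in T) \det (set_row (row_minor S s T) r (fun c => D (S (s r) c))).
Proof.
rewrite derivation_det [RHS]big_mkcond; apply: eq_bigr => r _; case: ifP => rT.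
  by congr (\det _); apply/matrixP => a b; rewrite !mxE rT.
rewrite det_set_row big1 // => c _; rewrite mxE rT.
by case: eqP => _; rewrite ?derivation1 ?derivation0 mul0r.
Qed.

Section Raising.
Variables (S : 'M[A]_n) (k : 'I_n).
Hypothesis DS : forall i j, D (S i j) = ((i == k) && (j == k))%:R.

Lemma derivation_raising s T : D (\det (row_minor S s T)) =
  \sum_(r in T | s r == k) \det (set_row (row_minor S s T) r (fun c => (k == c)%:R)).
Proof.
rewrite derivation_row_minor [RHS]big_mkcondr; apply: eq_bigr => r rT.
case: eqP => srk.
  by congr (\det _); apply/matrixP => a b; rewrite !mxE DS srk eqxx /= [b == k]eq_sym.
rewrite det_set_row big1 // => c _.
by rewrite DS; case: eqP => // _; rewrite mul0r.
Qed.

(** Differentiating row [k] turns it into a unit row, which is how an index outside the set is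
    represented. *)
Lemma raising_pm K : D (pm S K) = if k \in K then pm S (K :\ k) else 0.
Proof.
rewrite /pm derivation_raising; case: ifP => kK; last first.
  by rewrite big1 // => r /andP[rK /eqP rk]; rewrite -rk rK in kK.
rewrite (big_pred1 k) => [|r]; last by rewrite /=; case: eqP => [->|]; rewrite ?kK ?andbF.
congr (\det _); apply/matrixP => a b; rewrite !mxE !inE.
by case: eqP => [->|].
Qed.

Lemma raising_am i j K : i != j -> i \notin K -> j \notin K ->
  D (am S i j K) = if k \in K then am S i j (K :\ k) else 0.
Proof.
move=> ij iK jK; rewrite /am derivation_raising; case: ifP => kK.
  have kj : k != j by apply: contraNneq jK => <-.
  have ik : i != k by apply: contraNneq iK => ->.
  rewrite (big_pred1 k) => [|r /=]; last first.
    rewrite !inE; case: (eqVneq r j) => [->|rj] /=.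
      by rewrite (negPf ik) eq_sym (negPf kj).
    by case: eqP => [->|]; rewrite ?kK ?andbF.
  congr (\det _); apply/matrixP => a b; rewrite !mxE !inE.
  case: (eqVneq a k) => [->|ak] //=; by rewrite (negPf kj).
rewrite big1 // => r /andP[]; rewrite /= !inE.
case: (eqVneq r j) => [-> _ /eqP ik|rj /= rK /eqP rk]; last by rewrite -rk rK in kK.
(* Here [i = k]: the row at [j] becomes the unit vector at [i], which is also the row at [i] because
   [i] is not in [K]. *)
apply: (det_eq_rows ij) => c; rewrite !mxE eqxx (negPf ij) !inE (negPf ij) (negPf iK) /=.
by rewrite ik.
Qed.

End Raising.

Section Lowering.
Variables (S : 'M[A]_n) (k : 'I_n).
Hypothesis DS : forall i j, D (S i j) = - (S i k * S k j).

(** Differentiating row r of T gives minus its entry in column [k] times the determinant with that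
    row replaced by [S k]. By [det_set_row_sum] the sum of such terms over all rows is [S k k] times
    the determinant; what remains are the rows outside T, which are unit rows, and only the one of
    index [k] has an entry in column [k]. *)
Lemma derivation_lowering s T :
  D (\det (row_minor S s T)) + S k k * \det (row_minor S s T) =
  if k \in T then 0 else \det (set_row (row_minor S s T) k (S k)).
Proof.
rewrite derivation_row_minor -(det_set_row_sum _ (S k)) [X in _ + X](bigID (fun r => r \in T)) /= addrA.
rewrite -big_split /= big1 ?add0r => [|r rT]; last first.
  rewrite !det_set_row mxE rT mulr_suml -big_split big1 //= => c _.
  by rewrite DS mulNr -mulrA [X in _ + X]mulrC addNr.
case: ifP => kT; first by rewrite big1 // => r rT; rewrite mxE (negPf rT); case: eqP => [rk|];
   rewrite ?mulr0 // rk kT in rT *.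
rewrite (bigD1 k) ?kT //= mxE kT eqxx mulr1 big1 ?addr0 // => r /andP[rT rk].
by rewrite mxE (negPf rT) (negPf rk) mulr0.
Qed.

Lemma lowering_pm K :
  D (pm S K) + S k k * pm S K = if k \in K then 0 else pm S (k |: K).
Proof.
rewrite /pm derivation_lowering; case: ifP => // kK.
congr (\det _); apply/matrixP => a b; rewrite !mxE !inE.
by case: eqP => [->|].
Qed.

Lemma lowering_am i j K : i != j ->
  D (am S i j K) + S k k * am S i j K =
  if k \in [set i; j] :|: K then 0 else am S i j (k |: K).
Proof.
move=> ij; rewrite /am derivation_lowering !inE.
case: (eqVneq k j) => [->|kj] /=; first by rewrite orbT.
case: (boolP (k \in K)) => [kK|kK]; first by rewrite !orbT.
rewrite !orbF; case: (eqVneq k i) => [->|ki].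
  apply: (det_eq_rows ij) => c; rewrite !mxE eqxx !inE eqxx eq_sym (negPf ij) /=.
  by rewrite eqxx.
congr (\det _); apply/matrixP => a b; rewrite !mxE !inE /=.
case: (eqVneq a k) => [->|ak] /=; first by rewrite (negPf kj) ?orbT.
by [].
Qed.

End Lowering.

End Derivation.
End RowMinors.

(** * Alternating sums over subsets and the resolvent identity *)

Section AlternatingSum.
Context (A : comNzRingType) (T : finType).
Implicit Types (f g : {set T} -> A) (M K : {set T}).

Definition alt_sum f g M := \sum_(K : {set T} | K \subset M) (-1) ^+ #|K| * f K * g (M :\: K).

Lemma eq_alt_sum f f' g g' M :
  (forall K, K \subset M -> f K = f' K) -> (forall K, K \subset M -> g K = g' K) ->
  alt_sum f g M = alt_sum f' g' M.
Proof.
by move=> ff' gg'; apply: eq_bigr => K KM; rewrite ff' // gg' // subsetDl.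
Qed.

Lemma alt_sumC f g M : alt_sum f g M = (-1) ^+ #|M| * alt_sum g f M.
Proof.
rewrite /alt_sum mulr_sumr (reindex_onto (fun K => M :\: K) (fun K => M :\: K)) /=.
  rewrite (eq_bigl (fun K : {set T} => K \subset M)) => [|K]; last first.
    rewrite subsetDl /=; apply/eqP/idP => [<-|]; first exact: subsetDl.
    by rewrite setDDr setDv set0U => /setIidPr.
  apply: eq_bigr => K KM; rewrite setDDr setDv set0U (setIidPr KM).
  rewrite (cardsD M K) (setIidPr KM) -mulrA [f _ * _]mulrC !mulrA -exprD.
  congr (_ * _ * _); rewrite -signr_odd -[RHS]signr_odd; congr (_ ^+ (nat_of_bool _)).
  by rewrite oddB ?subset_leq_card // oddD.
by move=> K KM; rewrite setDDr setDv set0U; apply/setIidPr.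
Qed.

(* Splits the sum according to the position of one element of M. *)
Lemma alt_sum_split f g M k : k \in M ->
  alt_sum f g M = alt_sum f (fun K => g (k |: K)) (M :\ k)
    - alt_sum (fun K => f (k |: K)) g (M :\ k).
Proof.
move=> kM; rewrite {1}/alt_sum (bigID (fun K : {set T} => k \in K)) /= addrC.
congr (_ + _).
  apply: eq_big => [K|K /andP[KM kK]]; first by rewrite subsetD1.
  congr (_ * g _); apply/setP => x; rewrite !inE; case: eqVneq => [->|//].
  by rewrite kM kK.
rewrite -sumrN (reindex_onto (fun K => k |: K) (fun K => K :\ k)) /=; last first.
  by move=> K /andP[_]; apply: setD1K.
apply: eq_big => [K|K /andP[/andP[KM _] /eqP kK]].
  rewrite subsetD1 subUset sub1set kM setU11 /= andbT; congr (_ && _).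
  apply/eqP/idP => [<-|kK]; first by rewrite !inE eqxx.
  by rewrite setU1K.
have kK' : k \notin K by rewrite -kK !inE eqxx.
rewrite cardsU1 kK' exprS mulN1r !mulNr; congr (- (_ * g _)).
by apply/setP => x; rewrite !inE negb_or; case: (x == k); case: (x \in K).
Qed.

End AlternatingSum.

Section GeneratingFunction.
Context (A : comNzRingType) (n : nat).
Local Notation pol := {mpoly A[n]}.
Implicit Types (f g : {set 'I_n} -> A) (M K : {set 'I_n}) (S : 'M[A]_n).

Definition set_mnm K : 'X_{1..n} := [multinom nat_of_bool (i \in K) | i < n].

(* Alternating sums over subsets are coefficients of products of such
   polynomials. *)
Definition set_gen f : pol := \sum_K f K *: 'X_[set_mnm K].

Lemma set_mnm_eq K L M :
  ((set_mnm K + set_mnm L)%MM == set_mnm M) = (K \subset M) && (L == M :\: K).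
Proof.
apply/eqP/andP => [E|[KM /eqP ->]]; last first.
  apply/mnmP => i; rewrite mnmDE !mnmE !inE.
  by case: (boolP (i \in K)) => [/(subsetP KM) ->|].
have Ei i : ((i \in K) + (i \in L) = (i \in M))%N.
  by have /mnmP/(_ i) := E; rewrite mnmDE !mnmE.
split; first by apply/subsetP => i iK; have := Ei i; rewrite iK; case: (i \in M).
apply/eqP/setP => i; have := Ei i; rewrite inE.
by case: (i \in K); case: (i \in L); case: (i \in M).
Qed.

Lemma mcoeff_set_genM f g M : (set_gen f * set_gen g)@_(set_mnm M)
  = \sum_(K : {set 'I_n} | K \subset M) f K * g (M :\: K).
Proof.
rewrite /set_gen mulr_suml raddf_sum [RHS]big_mkcond; apply: eq_bigr => K _.
rewrite mulr_sumr raddf_sum /=.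
under eq_bigr => L _ do
  rewrite -scalerAl -scalerAr scalerA -mpolyXD mcoeffZ mcoeffX set_mnm_eq.
case: ifP => KM; last by rewrite big1 // => L _; rewrite mulr0.
by rewrite (bigD1 (M :\: K)) //= eqxx mulr1 big1 ?addr0 // => L /negPf ->; rewrite mulr0.
Qed.

Lemma mcoeff_XU_set (i : 'I_n) (p : pol) M :
  ('X_i * p)@_(set_mnm M) = if i \in M then p@_(set_mnm (M :\ i)) else 0.
Proof.
case: ifP => iM.
  have -> : set_mnm M = (set_mnm (M :\ i) + U_(i))%MM.
    apply/mnmP => j; rewrite mnmDE mnm1E !mnmE !inE eq_sym.
    by case: eqP => [<-|]; rewrite ?iM ?addn0.
  by rewrite mulrC addmC mcoeffMX.
rewrite mulrC mcoeffM big1 // => -[k1 k2] /= /eqP E.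
rewrite mcoeffX; case: eqP => [Ei|]; last by rewrite mulr0.
by have := congr1 (fun m : 'X_{1..n} => m i) E; rewrite mnmDE mnmE iM -Ei mnm1E eqxx addn1.
Qed.

Lemma det_row_expand (B : comNzRingType) (x : 'I_n -> B) (u v : 'I_n -> 'I_n -> B) :
  \det (\matrix_(r, c) (u r c + x r * v r c)) =
  \sum_(K : {set 'I_n}) (\prod_(r in K) x r)
    * \det (\matrix_(r, c) (if r \in K then v r c else u r c)).
Proof.
rewrite /determinant (eq_bigr (fun s : 'S_n => \sum_(K : {set 'I_n})
   (\prod_(r in K) x r) * ((-1) ^+ s *
     \prod_i (if i \in K then v i (s i) else u i (s i))))).
  rewrite exchange_big; apply: eq_bigr => K _; rewrite mulr_sumr.
  apply: eq_bigr => s _; congr (_ * (_ * _)); apply: eq_bigr => i _.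
  by rewrite !mxE.
move=> s _; under eq_bigr => i _ do rewrite mxE addrC.
rewrite bigA_distr mulr_sumr; apply: eq_big => // K _.
rewrite mulrCA; congr (_ * _); rewrite [X in _ = X * _]big_mkcond -big_split; apply: eq_bigr => i _ /=.
by case: ifP; rewrite ?mul1r.
Qed.

Section Resolvent.
Variable S : 'M[A]_n.
Hypothesis symS : S^T = S.
Let Sx : 'M[pol]_n := map_mx (@mpolyC n A) S.
Let D : 'M[pol]_n := \matrix_(r, c) ('X_r *+ (r == c)).
(** The scalar [e] is 1 or -1 in the end; it replaces the substitution of -x for x. *)
Let G (e : A) : 'M[pol]_n := 1%:M + e%:MP *: (D *m Sx).

Let GE e r c : G e r c = (r == c)%:R + (e *: 'X_r) * (S r c)%:MP.
Proof.
rewrite /G !mxE (bigD1 r) //= big1 => [|j]; last first.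
  by rewrite eq_sym => /negPf jr; rewrite mxE jr mul0r.
by rewrite !mxE eqxx addr0 mulrA mul_mpolyC.
Qed.

Let prod_scaleX e K : \prod_(r in K) (e *: 'X_r : pol) = e ^+ #|K| *: 'X_[set_mnm K].
Proof.
rewrite (eq_bigr (fun r => e%:MP * 'X_r)) => [|r _]; last by rewrite mul_mpolyC.
rewrite big_split prodr_const -rmorphXn /= mul_mpolyC; congr (_ *: _).
rewrite mpolyXE_id big_mkcond; apply: eq_bigr => r _; rewrite mnmE.
by case: (r \in K).
Qed.

Lemma det_resolvent e : \det (G e) = set_gen (fun K => e ^+ #|K| * pm S K).
Proof.
have -> : G e = \matrix_(r, c) ((r == c)%:R + (e *: 'X_r) * (S r c)%:MP).
  by apply/matrixP => r c; rewrite [RHS]mxE GE.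
rewrite det_row_expand; apply: eq_bigr => K _; rewrite prod_scaleX.
set C := \matrix_(r, c) _; suff -> : \det C = (pm S K)%:MP.
  by rewrite -scalerAl mulrC mul_mpolyC scalerA.
rewrite /pm -det_map_mx; congr (\det _).
by apply/matrixP => r c; rewrite !mxE; case: ifP => _ //=; rewrite rmorph_nat.
Qed.

Let N e := Sx *m \adj (G e).

Let nn i j K := if j \in K then 0 else am S i j K.

(** By Cramer's rule the entry is the determinant of [G e] with row [j] replaced by row [i] of S.
    The new row carries no variable, so the variable of [j] does not occur, which explains the zero
    case of [nn]; expanding the other rows yields the minors. *)
Lemma adj_resolvent e i j : N e i j = set_gen (fun K => e ^+ #|K| * nn i j K).
Proof.
have -> : N e i j = \det (set_row (G e) j (fun c => (S i c)%:MP)).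
  rewrite det_set_row mxE; apply: eq_bigr => c _.
  by rewrite !mxE.
have -> : set_row (G e) j (fun c => (S i c)%:MP) =
    \matrix_(r, c) ((if r == j then (S i c)%:MP else (r == c)%:R)
      + (e *: 'X_r) * (if r == j then 0 else (S r c)%:MP)).
  by apply/matrixP => r c; rewrite !mxE; case: eqP => _; rewrite ?mulr0 ?addr0 // -GE !mxE.
rewrite det_row_expand; apply: eq_bigr => K _; rewrite prod_scaleX /nn.
case: ifP => jK.
  rewrite mulr0 scale0r [X in _ * X](expand_det_row _ j) big1 ?mulr0 // => c _.
  by rewrite mxE jK eqxx mul0r.
set C := \matrix_(r, c) _; suff -> : \det C = (am S i j K)%:MP.
  by rewrite -scalerAl mulrC mul_mpolyC scalerA.
rewrite /am -det_map_mx; congr (\det _).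
apply/matrixP => r c; rewrite !mxE /= !inE.
by case: eqVneq => [->|_] /=; rewrite ?jK //; case: ifP => _ //=; rewrite rmorph_nat.
Qed.

(** With X = [D] this is 2 S X S = S (1 + X S) - (1 - S X) S, multiplied by the adjugate of 1 - S X
    on the left and by that of 1 + X S on the right. Since S is symmetric, 1 - S X is the transpose
    of [G (-1)]. Adjugates in place of inverses keep all entries polynomial. *)
Lemma resolvent_identity :
  ((N (-1))^T *m D *m N 1) *+ 2 = \det (G 1) *: (N (-1))^T - \det (G (-1)) *: N 1.
Proof.
have trS : Sx^T = Sx by apply/matrixP => r c; rewrite !mxE -[in RHS]symS mxE.
have trD : D^T = D.
  by apply/matrixP => r c; rewrite !mxE eq_sym; case: eqP => // ->.
rewrite /N trmx_mul trS.
set adm := (\adj (G (-1)))^T; set adp := \adj (G 1).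
have Gp : G 1 *m adp = (\det (G 1))%:M by rewrite mul_mx_adj.
have Gm : adm *m (G (-1))^T = (\det (G (-1)))%:M.
  by have := congr1 trmx (mul_mx_adj (G (-1))); rewrite trmx_mul tr_scalar_mx.
have GmE : (G (-1))^T = 1%:M - Sx *m D.
  have tr1D (e : pol) (C : 'M[pol]_n) : (1%:M + e *: C)^T = 1%:M + e *: C^T.
    by apply/matrixP => r c; rewrite !mxE eq_sym.
  by rewrite /G tr1D trmx_mul trS trD mpolyCN mpolyC1 scaleN1r.
have GpE : G 1 = 1%:M + D *m Sx by rewrite /G mpolyC1 scale1r.
have E : (Sx *m D *m Sx) *+ 2 = Sx *m G 1 - (G (-1))^T *m Sx.
  rewrite GmE GpE mulmxDr mulmxBl mulmx1 mul1mx mulmxA.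
  by rewrite opprB addrACA addrC addrA addrNK mulr2n addrC.
have -> : adm *m Sx *m D *m (Sx *m adp) *+ 2 = adm *m ((Sx *m D *m Sx) *+ 2) *m adp.
  by rewrite !mulr2n mulmxDr mulmxDl !mulmxA.
rewrite E mulmxBr mulmxBl; congr (_ - _).
  by rewrite -!mulmxA Gp mulmxA mul_mx_scalar.
by rewrite !mulmxA Gm -mulmxA mul_scalar_mx.
Qed.

Lemma resolvent_entries a b :
  (\sum_l 'X_l * (N (-1) l a * N 1 l b)) *+ 2
  = \det (G 1) * N (-1) b a - \det (G (-1)) * N 1 a b.
Proof.
have := congr1 (fun C : 'M[pol]_n => C a b) resolvent_identity.
move: (N (-1)) (N 1) (\det (G 1)) (\det (G (-1))) => Nm Np dp dm /=.
rewrite mulr2n !mxE -mulr2n => <-; congr (_ *+ 2); apply: eq_bigr => l _.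
rewrite !mxE (bigD1 l) //= big1 ?addr0 => [|j /negPf jl]; last first.
  by rewrite !mxE jl mulr0.
by rewrite !mxE eqxx mulrA [_ * 'X_l]mulrC.
Qed.

(** Compares the coefficients of the squarefree monomial of [M]; the variable of [l] in front of a
    product leaves [M :\ l] to be distributed among its two factors. *)
Lemma resolvent_coeff a b M :
  (\sum_(l in M) alt_sum (nn l a) (nn l b) (M :\ l)) *+ 2 =
  alt_sum (nn b a) (pm S) M - alt_sum (pm S) (nn a b) M.
Proof.
have genE f g L : (set_gen (fun K => (-1) ^+ #|K| * f K)
    * set_gen (fun K => 1 ^+ #|K| * g K))@_(set_mnm L) = alt_sum f g L.
  by rewrite mcoeff_set_genM; apply: eq_bigr => K _; rewrite expr1n mul1r.
move: (resolvent_entries a b) (adj_resolvent (-1)) (adj_resolvent 1).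
move: (det_resolvent 1) (det_resolvent (-1)).
move: (N (-1)) (N 1) (\det (G 1)) (\det (G (-1))) => Nm Np dp dm -> -> E NmE NpE.
have := congr1 (mcoeff (set_mnm M)) E.
rewrite mcoeffB NmE NpE [X in X@__ - _]mulrC !genE => <-.
rewrite mcoeffMn raddf_sum [X in X *+ 2]big_mkcond; congr (_ *+ 2).
by apply: eq_bigr => l _ /=; rewrite mcoeff_XU_set NmE NpE genE.
Qed.

End Resolvent.

End GeneratingFunction.

Section MinorRelations.
Context (A : comNzRingType) (n : nat) (S : 'M[A]_n).
Hypotheses (symS : S^T = S) (reg2 : forall x : A, x *+ 2 = 0 -> x = 0).
Implicit Types (M : {set 'I_n}) (i a b : 'I_n).

Let notin_sub x (K M : {set 'I_n}) : K \subset M -> x \notin M -> x \notin K.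
Proof. by move=> /subsetP KM; apply/contra/KM. Qed.

Let row_am_sym l a (M K : {set 'I_n}) : K \subset M -> a \notin M -> l \notin K ->
  (if a \in K then 0 else am S l a K) = am S a l K.
Proof.
move=> KM aM lK; have aK := notin_sub KM aM.
by rewrite (negPf aK) [LHS]am_sym.
Qed.

(** On the right of [resolvent_coeff] stand two alternating sums that differ by exchanging the
    factors. By [alt_sumC] they cancel for [#|M|] even and add up for [#|M|] odd, which is the
    difference between classes (iii) and (ii). *)
Lemma minor_relation a b M : a != b -> a \notin M -> b \notin M ->
  (if odd #|M| then alt_sum (pm S) (am S a b) M else 0)
  + \sum_(l in M) alt_sum (am S a l) (am S b l) (M :\ l) = 0.
Proof.
move=> ab aM bM; apply: reg2; rewrite mulrnDl.
rewrite (eq_bigr (fun l => alt_sum (fun K => if a \in K then 0 else am S l a K)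
    (fun K => if b \in K then 0 else am S l b K) (M :\ l))) => [|l lM]; last first.
  by apply: eq_alt_sum => K; rewrite subsetD1 => /andP[KM lK]; rewrite (row_am_sym KM).
rewrite resolvent_coeff //.
rewrite [X in _ + (X - _)](@eq_alt_sum _ _ _ (am S a b) _ (pm S) M) => [|K KM|//]; last first.
  by rewrite (row_am_sym KM) // (notin_sub KM bM).
rewrite [X in _ + (_ - X)](@eq_alt_sum _ _ (pm S) (pm S) _ (am S a b) M) => [|//|K KM]; last first.
  by rewrite (negPf (notin_sub KM bM)).
rewrite [alt_sum (am S a b) _ M]alt_sumC -signr_odd; case: (odd _); last by rewrite expr0 mul1r subrr mul0rn addr0.
by rewrite expr1 mulN1r mulr2n -opprD subrr.
Qed.

(** The diagonal case a = b = i of the same computation, with [am_diag] turning its entries into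
    principal minors. *)
Lemma principal_minor_relation i M : i \notin M -> odd #|M| ->
  alt_sum (pm S) (fun K => pm S (i |: K)) M
  + \sum_(l in M) alt_sum (am S i l) (am S i l) (M :\ l) = 0.
Proof.
move=> iM oM; apply: reg2; rewrite mulrnDl.
rewrite (eq_bigr (fun l => alt_sum (fun K => if i \in K then 0 else am S l i K)
    (fun K => if i \in K then 0 else am S l i K) (M :\ l))) => [|l lM]; last first.
  by apply: eq_alt_sum => K; rewrite subsetD1 => /andP[KM lK]; rewrite (row_am_sym KM).
rewrite resolvent_coeff //.
have E (K : {set _}) : K \subset M -> (if i \in K then 0 else am S i i K) = pm S (i |: K).
  by move=> KM; rewrite (negPf (notin_sub KM iM)) am_diag.
rewrite [X in _ + (X - _)](@eq_alt_sum _ _ _ (fun K => pm S (i |: K)) _ (pm S) M) //.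
rewrite [X in _ + (_ - X)](@eq_alt_sum _ _ (pm S) (pm S) _ (fun K => pm S (i |: K)) M) //.
by rewrite [alt_sum _ (pm S) M]alt_sumC -signr_odd oM mulN1r mulr2n -opprD subrr.
Qed.

End MinorRelations.

(** * The operators on quadrics *)

Section Unknowns.
Context (n : nat).
Implicit Types (v : unk n) (D K : {set 'I_n}) (i j k : 'I_n).

(* An unknown is determined by the set of its lower left indices (empty for
   p_K, and {i, j} for a_{ij|K}) and the set K. *)
Definition lidx v : {set 'I_n} :=
  match v with inl _ => set0 | inr x => [set (val x).1.1; (val x).1.2] end.

Definition ridx v : {set 'I_n} :=
  match v with inl L => L | inr x => (val x).2 end.

Definition is_unk D K := ((#|D| == 0%N) || (#|D| == 2%N)) && [disjoint D & K].

Lemma lidx_neq (x : aidx n) : (val x).1.1 != (val x).1.2.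
Proof. by case: x => [[[i j] K] /= /and3P[ij _ _]]; rewrite -val_eqE neq_ltn ij. Qed.

Lemma unk_inj v w : lidx v = lidx w -> ridx v = ridx w -> v = w.
Proof.
case: v w => [L|x] [L'|y] /=.
- by move=> _ ->.
- by move=> /setP/(_ (val y).1.1); rewrite !inE eqxx.
- by move=> /setP/(_ (val x).1.1); rewrite !inE eqxx.
move=> E K; congr inr; apply: val_inj.
case: x y E K => [[[i j] K] /= /and3P[ij _ _]] [[[i' j'] K'] /= /and3P[ij' _ _]] E ->.
have /set2P Ei : i \in [set i'; j'] by rewrite -E set21.
have /set2P Ej : j \in [set i'; j'] by rewrite -E set22.
move: ij; case: Ei Ej => -> [] -> //; rewrite ?ltnn //.
by rewrite ltnNge ltnW.
Qed.

Lemma is_unkP D K :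
  reflect (exists v, lidx v = D /\ ridx v = K) (is_unk D K).
Proof.
apply: (iffP idP) => [/andP[]|].
  case/orP=> [|/cards2P[i [j [ij ->]]] dK].
    by rewrite cards_eq0 => /eqP-> _; exists (inl K).
  have iK : i \notin K by apply: contraL dK => iK; apply/pred0Pn; exists i; rewrite /= !inE eqxx.
  have jK : j \notin K by apply: contraL dK => jK; apply/pred0Pn; exists j; rewrite /= !inE eqxx orbT.
  case: (ltngtP i j) => [lij|lji|/val_inj eij].
  + have h : [&& (i < j)%N, i \notin K & j \notin K] by rewrite lij iK jK.
    by exists (inr (exist _ (i, j, K) h)).
  + have h : [&& (j < i)%N, j \notin K & i \notin K] by rewrite lji iK jK.
    by exists (inr (exist _ (j, i, K) h)); rewrite /= setUC.
  + by rewrite eij eqxx in ij.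
case=> -[L|x] [<- <-] /=; rewrite /is_unk.
  by rewrite cards0 /= disjoint_sym disjoints_subset setC0 subsetT.
rewrite cards2 lidx_neq /=; case: x => [[[i j] K'] /= /and3P[_ iK jK]].
by rewrite disjoints_subset subUset !sub1set !inE iK jK.
Qed.

Lemma is_unk_lr v : is_unk (lidx v) (ridx v).
Proof. by apply/is_unkP; exists v. Qed.

Section Family.
Context (V : zmodType) (h : unk n -> V).

(** The sum has at most one term because the two index sets determine the unknown. Written as a sum,
    it commutes with additive maps and has the default value 0 on pairs that index no unknown. *)
Definition at_sets D K : V := \sum_(v | (lidx v == D) && (ridx v == K)) h v.

Lemma at_sets_unk v : at_sets (lidx v) (ridx v) = h v.
Proof.
rewrite /at_sets (big_pred1 v) // => w /=; apply/andP/eqP => [[/eqP E /eqP]|->].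
  exact: unk_inj.
by [].
Qed.

Lemma at_sets0 D K : ~~ is_unk D K -> at_sets D K = 0.
Proof.
move=> nDK; rewrite /at_sets big1 // => v /andP[/eqP E1 /eqP E2].
by case/is_unkP: nDK; exists v.
Qed.

End Family.

Lemma raddf_at_sets (V W : zmodType) (f : {additive V -> W}) h D K :
  f (at_sets h D K) = at_sets (f \o h) D K.
Proof. exact: raddf_sum. Qed.

Lemma eq_at_sets (V : zmodType) (h h' : unk n -> V) D K :
  h =1 h' -> at_sets h D K = at_sets h' D K.
Proof. by move=> hh'; apply: eq_bigr => v _. Qed.

End Unknowns.

Section Operators.
Context (R : realType) (n : nat).
Local Notation PA := (ringPA R n).
Implicit Types (v : unk n) (D K L : {set 'I_n}) (i j k : 'I_n) (f g : PA).

(* p_K if D is empty, a_{ij|K} if D = {i, j}, and 0 otherwise. *)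
Definition uvar D K : PA := at_sets (@X R n) D K.

Lemma uvar_unk v : uvar (lidx v) (ridx v) = X R v.
Proof. exact: at_sets_unk. Qed.

Lemma uvar0 D K : ~~ is_unk D K -> uvar D K = 0.
Proof. exact: at_sets0. Qed.

Lemma p_uvar L : p_ R L = uvar set0 L.
Proof. exact: esym (uvar_unk (inl L)). Qed.

Lemma a_uvar i j K : a_ R i j K = uvar [set i; j] K.
Proof.
rewrite /a_; case: insubP => [x _ xE|nij].
  by rewrite -(uvar_unk (inr x)) /= xE.
case: insubP => [x _ xE|nji].
  by rewrite -(uvar_unk (inr x)) /= xE setUC.
rewrite uvar0 //; apply/negP => /andP[]; rewrite cards_eq0 cards2.
rewrite disjoints_subset subUset !sub1set !inE => /orP[/eqP/setP/(_ i)|].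
  by rewrite !inE eqxx.
case: (ltngtP i j) nij nji => [ij|ij|/val_inj ->]; last by rewrite eqxx.
  by move=> /negP nij _ _ /andP[iK jK]; apply: nij; rewrite iK jK.
by move=> _ /negP nij _ /andP[iK jK]; apply: nij; rewrite iK jK.
Qed.

Lemma substD m (h : unk n -> {mpoly R[m]}) f g : subst h (f + g) = subst h f + subst h g.
Proof. exact: rmorphD. Qed.

Lemma substM m (h : unk n -> {mpoly R[m]}) f g : subst h (f * g) = subst h f * subst h g.
Proof. exact: rmorphM. Qed.

Lemma substZ m (h : unk n -> {mpoly R[m]}) c f : subst h (c *: f) = c *: subst h f.
Proof. exact: comp_mpolyZ. Qed.

Lemma subst_sum m (h : unk n -> {mpoly R[m]}) I (r : seq I) (P : pred I) (F : I -> PA) :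
  subst h (\sum_(i <- r | P i) F i) = \sum_(i <- r | P i) subst h (F i).
Proof. exact: rmorph_sum. Qed.

Lemma substX m (h : unk n -> {mpoly R[m]}) v : subst h (X R v) = h v.
Proof. by rewrite /subst /X comp_mpolyXU -tnth_nth tnth_mktuple unk_rankK. Qed.

Lemma subst_uvar m (h : unk n -> {mpoly R[m]}) D K :
  subst h (uvar D K) = at_sets h D K.
Proof. by rewrite /uvar /at_sets subst_sum; apply: eq_bigr => v _; rewrite substX. Qed.

Section Leibniz.
Variable d : unk n -> PA.
Lemma leibnizD f g : leibniz d (f + g) = leibniz d f + leibniz d g.
Proof. by rewrite -big_split; apply: eq_bigr => v _; rewrite mderivD mulrDr. Qed.

Lemma leibnizZ c f : leibniz d (c *: f) = c *: leibniz d f.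
Proof. by rewrite scaler_sumr; apply: eq_bigr => v _; rewrite mderivZ scalerAr. Qed.

Lemma leibniz_linear : linear (leibniz d).
Proof. by move=> c f g; rewrite leibnizD leibnizZ. Qed.

HB.instance Definition _ := GRing.isLinear.Build R PA PA _ (leibniz d) leibniz_linear.
Lemma leibnizM f g : leibniz d (f * g) = leibniz d f * g + f * leibniz d g.
Proof.
rewrite /leibniz mulr_suml mulr_sumr -big_split; apply: eq_bigr => v _ /=.
by rewrite mderivM mulrDr -mulrA [f * (_ * _)]mulrCA.
Qed.

Lemma leibnizX v : leibniz d (X R v) = d v.
Proof.
rewrite /leibniz (bigD1 v) //= big1 ?addr0 => [|w wv].
  by rewrite /X mderivX mnmE eqxx scale1r -{1}[U_(_)%MM]add0m addmK mpolyX0 mulr1.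
rewrite /X mderivX mnmE (inj_eq (can_inj (@unk_rankK n))) eq_sym (negPf wv).
by rewrite scale0r mulr0.
Qed.

End Leibniz.

Lemma raising_linear k : linear (@raising R n k).
Proof. exact: leibniz_linear. Qed.

HB.instance Definition _ k :=
  GRing.isLinear.Build R PA PA _ (@raising R n k) (raising_linear k).

Lemma raisingM k f g : raising k (f * g) = raising k f * g + f * raising k g.
Proof. exact: leibnizM. Qed.

Lemma raisingX k v : raising k (X R v) =
  if k \in ridx v then uvar (lidx v) (ridx v :\ k) else 0.
Proof.
rewrite /raising leibnizX; case: v => [L|x] /=; first by rewrite p_uvar.
by case: x => [[[i j] K] h] /=; rewrite a_uvar.
Qed.

(** An index [k] in [lidx v] requires no separate case: the sets then meet and [uvar] is 0. *)
Definition lowering k : PA -> PA :=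
  leibniz (fun v => if k \in ridx v then 0 else uvar (lidx v) (k |: ridx v)).

Lemma lowering_linear k : linear (lowering k).
Proof. exact: leibniz_linear. Qed.

HB.instance Definition _ k :=
  GRing.isLinear.Build R PA PA _ (lowering k) (lowering_linear k).

Lemma loweringM k f g : lowering k (f * g) = lowering k f * g + f * lowering k g.
Proof. exact: leibnizM. Qed.

Lemma loweringX k v : lowering k (X R v) =
  if k \in ridx v then 0 else uvar (lidx v) (k |: ridx v).
Proof. by rewrite /lowering leibnizX. Qed.

Lemma is_unkD1 D K k : k \notin D -> is_unk D (K :\ k) = is_unk D K.
Proof.
move=> kD; rewrite /is_unk; congr (_ && _).
by rewrite -!setI_eq0 setIDA (setDidPl _) // disjoint_sym disjoints1 inE (negPf kD).
Qed.

Lemma is_unkU1 D K k : is_unk D (k |: K) = (k \notin D) && is_unk D K.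
Proof.
rewrite /is_unk andbCA; congr (_ && _).
by rewrite -!setI_eq0 setIUr setU_eq0 setI_eq0 disjoint_sym disjoints1.
Qed.

Lemma raising_uvar k D K : raising k (uvar D K) =
  if (k \in K) && (k \notin D) then uvar D (K :\ k) else 0.
Proof.
have [/is_unkP[v [<- <-]]|nu] := boolP (is_unk D K).
  rewrite uvar_unk raisingX; case: ifP => //= kr; rewrite ifT //.
  by have /andP[_ /pred0P/(_ k)] := is_unk_lr v; rewrite /= kr andbT => ->.
rewrite (uvar0 nu) linear0; case: ifP => // /andP[kK kD].
by rewrite uvar0 // is_unkD1.
Qed.

Lemma lowering_uvar k D K : lowering k (uvar D K) =
  if k \in K then 0 else uvar D (k |: K).
Proof.
have [/is_unkP[v [<- <-]]|nu] := boolP (is_unk D K).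
  by rewrite uvar_unk loweringX.
rewrite (uvar0 nu) linear0; case: ifP => // _.
by rewrite uvar0 // is_unkU1 negb_and nu orbT.
Qed.

Definition sl_coeff (g : 'I_n -> 'M[R]_2) D K K' : R :=
  \prod_(k | k \notin D) g k (ef (k \in K')) (ef (k \in K)).

Lemma sl_actX (g : 'I_n -> 'M[R]_2) v : sl_act g (X R v) =
  \sum_(K : {set 'I_n} | K \subset ~: lidx v) sl_coeff g (lidx v) (ridx v) K *: uvar (lidx v) K.
Proof.
rewrite /sl_act substX; case: v => [L|x] /=.
  apply: eq_big => [K|K _]; first by rewrite setC0 subsetT.
  by rewrite p_uvar; congr (_ *: _); apply: eq_bigl => k; rewrite inE.
by case: x => [[[i j] K] h] /=; apply: eq_bigr => K' _; rewrite a_uvar.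
Qed.

Lemma sl_act_uvar (g : 'I_n -> 'M[R]_2) D K : is_unk D K -> sl_act g (uvar D K) =
  \sum_(K' : {set 'I_n} | K' \subset ~: D) sl_coeff g D K K' *: uvar D K'.
Proof. by case/is_unkP => v [<- <-]; rewrite uvar_unk sl_actX. Qed.

Lemma perm_act_uvar s D K : perm_act s (uvar D K) = uvar (s @: D) (s @: K).
Proof.
have [/is_unkP[v [<- <-]]|nu] := boolP (is_unk D K).
  rewrite uvar_unk /perm_act substX; case: v => [L|x] /=.
    by rewrite imset0 p_uvar.
  by case: x => [[[i j] K'] h] /=; rewrite a_uvar imsetU1 imset_set1.
rewrite (uvar0 nu) /perm_act /subst rmorph0 uvar0 //.
apply: contra nu; rewrite /is_unk card_imset; last exact: perm_inj.
case/andP=> -> /=; rewrite -!setI_eq0 -imsetI; last by move=> ? ? _ _; apply: perm_inj.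
by rewrite imset_eq0.
Qed.

End Operators.

Section Quadrics.
Context (R : realType) (n : nat).
Local Notation PA := (ringPA R n).
Local Notation Q := (quadric R n).
Local Notation X := (@X R n).
Implicit Types (v w : unk n) (D K L : {set 'I_n}) (i j k : 'I_n) (f : PA) (q : Q).

(** Reduces linear assertions about quadrics to products of two unknowns. *)
Lemma quad_ind (P : PA -> Prop) :
  P 0 -> (forall c f g, P f -> P g -> P (c *: f + g)) ->
  (forall v w, P (X v * X w)) -> forall f, f \is 2.-homog -> P f.
Proof.
move=> P0 PD PX f /dhomogP f2; rewrite (mpolyE f) big_seq.
elim/big_rec: _ => // m g /f2 /= m2; apply/PD.
have [i mi] : exists i : 'I_(unk_pred n).+1, (0 < m i)%N.
  apply/existsP; apply: contraPT m2 => /existsPn m0; rewrite mdegE big1 // => i _.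
  by apply/eqP; have := m0 i; rewrite lt0n negbK.
have U1 : (U_(i) <= m)%MM.
  by apply/mnm_lepP => j; rewrite mnm1E; case: eqP => // <-.
have : mdeg (m - U_(i)) == 1%N.
  by have := congr1 mdeg (submK U1); rewrite mdegD mdeg1 m2 addn1 => -[->].
case/mdeg1P=> j /eqP E.
rewrite -(submK U1) E mpolyXD.
by have := PX (unk_val j) (unk_val i); rewrite /X !unk_valK.
Qed.

(* The entry of the symmetric matrix of the quadratic form f. *)
Definition bcoef v w f : R :=
  2^-1 * (mderiv (unk_rank w) (mderiv (unk_rank v) f))@_0%MM.

Lemma bcoef_linear v w : linear_for *%R (bcoef v w).
Proof.
move=> c f g; rewrite /bcoef !mderivD !mderivZ mcoeffD mcoeffZ.
by rewrite mulrDr mulrCA.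
Qed.

HB.instance Definition _ v w :=
  GRing.isLinear.Build R PA R _ (bcoef v w) (bcoef_linear v w).

Lemma mderiv_X v w : mderiv (unk_rank v) (X w) = (v == w)%:R.
Proof.
rewrite /Defs.X mderivX mnmE (inj_eq (can_inj (@unk_rankK n))) eq_sym.
case: eqP => [->|_]; last by rewrite scale0r.
by rewrite scale1r -{1}[U_(_)%MM]add0m addmK mpolyX0.
Qed.

Lemma bcoef_sym v w f : bcoef v w f = bcoef w v f.
Proof. by rewrite /bcoef mderiv_comm. Qed.

Lemma bcoefXX v w a b :
  bcoef v w (X a * X b) = 2^-1 * ((v == a) && (w == b) + (v == b) && (w == a))%:R.
Proof.
rewrite /bcoef mderivM !mderiv_X mulr_natl [X a * _]mulr_natr mderivD !mderivMn !mderiv_X.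
rewrite addrC; case: (v == a); case: (v == b); case: (w == a); case: (w == b);
by rewrite /= ?(mulr1n, mulr0n, addr0, add0r) ?mcoeffD ?mcoeff0 ?mcoeff1 ?eqxx.
Qed.

Lemma quadE f : f \is 2.-homog ->
  f = \sum_v \sum_w bcoef v w f *: (X v * X w).
Proof.
move: f; apply: quad_ind => [|c f g Ef Eg|a b].
- by rewrite big1 // => v _; rewrite big1 // => w _; rewrite linear0 scale0r.
- rewrite {1}Ef {1}Eg scaler_sumr -big_split; apply: eq_bigr => v _ /=.
  rewrite scaler_sumr -big_split; apply: eq_bigr => w _ /=.
  by rewrite linearP scalerDl scalerA.
have E (c d : unk n) : \sum_v \sum_w (2^-1 * ((v == c) && (w == d))%:R) *: (X v * X w)
    = 2^-1 *: (X c * X d).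
  rewrite (bigD1 c) //= [X in _ + X]big1 ?addr0 => [|v /negPf vc]; last first.
    by rewrite big1 // => w _; rewrite vc mulr0 scale0r.
  rewrite (bigD1 d) //= [X in _ + X]big1 ?addr0 => [|w /negPf wd]; last first.
    by rewrite wd andbF mulr0 scale0r.
  by rewrite !eqxx mulr1.
under eq_bigr => v _ do (under eq_bigr => w _ do
  rewrite bcoefXX natrD mulrDr scalerDl; rewrite big_split).
rewrite big_split /= !E [X b * X a]mulrC -scalerDl -[LHS]scale1r; congr (_ *: _).
by field.
Qed.

Lemma mul_uvar_homog D K D' K' : uvar R D K * uvar R D' K' \is 2.-homog.
Proof.
have h D0 K0 : uvar R D0 K0 \is 1.-homog.
  by apply: rpred_sum => v _; apply: X_homog.
exact: (dhomogM (h _ _) (h _ _)).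
Qed.

Lemma raising_homog k f : f \is 2.-homog -> raising k f \is 2.-homog.
Proof.
move: f; apply: quad_ind => [|c f g Ef Eg|v w]; rewrite ?linear0 ?rpred0 //.
  by rewrite linearP rpredD ?rpredZ.
rewrite raisingM !raisingX -!uvar_unk rpredD //; case: ifP => _;
by rewrite ?mul0r ?mulr0 ?rpred0 ?mul_uvar_homog.
Qed.

Lemma lowering_homog k f : f \is 2.-homog -> lowering k f \is 2.-homog.
Proof.
move: f; apply: quad_ind => [|c f g Ef Eg|v w]; rewrite ?linear0 ?rpred0 //.
  by rewrite linearP rpredD ?rpredZ.
rewrite loweringM !loweringX -!uvar_unk rpredD //; case: ifP => _;
by rewrite ?mul0r ?mulr0 ?rpred0 ?mul_uvar_homog.
Qed.

Definition raise_quad k q : Q := DHomog (raising_homog k (dhomog_is_dhomog q)).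
Definition lower_quad k q : Q := DHomog (lowering_homog k (dhomog_is_dhomog q)).

Lemma raise_quad_linear k : linear (raise_quad k).
Proof. by move=> c p q; apply: val_inj; rewrite /= linearP. Qed.

HB.instance Definition _ k := GRing.isLinear.Build R Q Q _ (raise_quad k) (raise_quad_linear k).
Lemma lower_quad_linear k : linear (lower_quad k).
Proof. by move=> c p q; apply: val_inj; rewrite /= linearP. Qed.

HB.instance Definition _ k := GRing.isLinear.Build R Q Q _ (lower_quad k) (lower_quad_linear k).

Definition rq k : 'End(Q) := linfun (raise_quad k).
Definition lq k : 'End(Q) := linfun (lower_quad k).

Lemma val_rq k q : val (rq k q) = raising k (val q).
Proof. by rewrite lfunE. Qed.

Lemma val_lq k q : val (lq k q) = lowering k (val q).
Proof. by rewrite lfunE. Qed.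

Lemma val_iter_lq b k q : val (iter b (lq k) q) = iter b (lowering k) (val q).
Proof. by elim: b => //= b <-; rewrite val_lq. Qed.

End Quadrics.

(** * The sl_2-strings of a product of two unknowns *)

Section DerivationStrings.
Context (B : comNzRingType) (r l : B -> B).
Hypotheses (rD : forall f g, r (f + g) = r f + r g) (lD : forall f g, l (f + g) = l f + l g).
Hypotheses (rM : forall f g, r (f * g) = r f * g + f * r g)
  (lM : forall f g, l (f * g) = l f * g + f * l g).
Implicit Types (x y e f : B).

Definition string (m : nat) p :=
  [/\ r p = 0, iter m.+1 l p = 0, (0 < m)%N -> r (l p) = p *+ m
    & (1 < m)%N -> r (l (l p)) = l p *+ 2].

Definition trivial_at x := r x = 0 /\ l x = 0.

(** A weight basis of the two-dimensional representation. At a given index, every unknown is either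
    invariant or one of the two members of such a pair. *)
Definition pair_at e f := [/\ r e = 0, l e = f, r f = e & l f = 0].

Let r0 : r 0 = 0. Proof. exact: derivation0 rD. Qed.
Let l0 : l 0 = 0. Proof. exact: derivation0 lD. Qed.
Let rN f : r (- f) = - r f. Proof. exact: derivationN rD _. Qed.
Let lN f : l (- f) = - l f. Proof. exact: derivationN lD _. Qed.
Let rMn f c : r (f *+ c) = r f *+ c.
Proof. by elim: c => [|c IH]; rewrite ?r0 // !mulrS rD IH. Qed.
Let lMn f c : l (f *+ c) = l f *+ c.
Proof. by elim: c => [|c IH]; rewrite ?l0 // !mulrS lD IH. Qed.
Let opE := (mulr0, mul0r, addr0, add0r, oppr0, mul0rn, r0, l0,
            rM, lM, rD, lD, rN, lN, rMn, lMn).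

Lemma string_ee e1 f1 e2 f2 : pair_at e1 f1 -> pair_at e2 f2 ->
  string 2 (e1 * e2).
Proof.
case=> r1 l1 r1' l1' [r2 l2 r2' l2'].
by split => //=; do ?[move=> _];
  rewrite !(opE, r1, l1, r1', l1', r2, l2, r2', l2') ?mulr1n //; ring.
Qed.

Lemma string_te x e f : trivial_at x -> pair_at e f ->
  string 1 (x * e).
Proof.
case=> r1 l1 [r2 l2 r2' l2'].
by split => //=; do ?[move=> _];
  rewrite !(opE, r1, l1, r2, l2, r2', l2') ?mulr1n //; ring.
Qed.

Lemma string_tt x y : trivial_at x -> trivial_at y ->
  string 0 (x * y).
Proof.
case=> r1 l1 [r2 l2].
by split => //=; rewrite !(opE, r1, l1, r2, l2) ?mulr1n //; ring.
Qed.

(** Four times [small_part], and likewise [quad_part] is four times [hw_part]: with denominators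
    cleared, the computations are polynomial identities over any commutative ring. *)
Definition quad_small f : B := f *+ 4 - (r (r (l (l f))) + l (r (r (l f))) + l (l (r (r f)))).

Definition quad_part (m a : nat) f : B :=
  match m, a with
  | 0, 0 => quad_small f - r (l (quad_small f)) - l (r (quad_small f))
  | 1, 0 => r (l (quad_small f))
  | 1, 1 => r (quad_small f)
  | 2, 0 => r (r (l (l f)))
  | 2, 1 => r (r (l f))
  | 2, 2 => r (r f)
  | _, _ => 0
  end.

Lemma stringMn m p c : string m p -> string m (p *+ c).
Proof.
case=> h1 h2 h3 h4; have iMn b : iter b l (p *+ c) = iter b l p *+ c.
  by elim: b => //= b ->; rewrite lMn.
split=> [||m0|m1]; rewrite ?rMn ?h1 ?iMn ?h2 ?mul0rn //.
  by rewrite lMn rMn h3 // -!mulrnA mulnC.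
by rewrite !lMn rMn h4 // -!mulrnA mulnC.
Qed.

Lemma string0 m : string m 0.
Proof. by split=> [||m0|m1]; rewrite ?(r0, l0, mul0rn) //; elim: m.+1 => //= c ->. Qed.

(** The alternating tensor spans the invariants in the square of the two-dimensional
    representation. *)
Lemma string_alt e1 f1 e2 f2 : pair_at e1 f1 -> pair_at e2 f2 ->
  string 0 (e1 * f2 - f1 * e2).
Proof.
case=> r1 l1 r1' l1' [r2 l2 r2' l2'].
by split=> //=; rewrite !(opE, r1, l1, r1', l1', r2, l2, r2', l2'); ring.
Qed.

Let sm_tt x y : trivial_at x -> trivial_at y ->
  quad_small (x * y) = (x * y) *+ 4.
Proof. by move=> [r1 l1] [r2 l2]; rewrite /quad_small !(opE, r1, l1, r2, l2); ring. Qed.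

(** The first of six cases, according to whether the factors are invariant (t), of weight 1 (e) or
    of weight -1 (f). In each case every part is 0 or a multiple of the highest weight vector x y, x
    e, e1 e2 or of the alternating tensor. *)
Lemma part_tt x y : trivial_at x -> trivial_at y ->
  forall m a, (a <= m)%N -> (m <= 2)%N -> string m (quad_part m a (x * y)).
Proof.
move=> hx hy [|[|[|m]]] // [|[|[|a]]] // _ _.
- have -> : quad_part 0 0 (x * y) = (x * y) *+ 4.
    by rewrite /quad_part ?(sm_tt hx hy); case: hx hy => [r1 l1] [r2 l2]; rewrite ?(opE, r1, l1, r2, l2); ring.
  exact/stringMn/string_tt.
- have -> : quad_part 1 0 (x * y) = 0.
    by rewrite /quad_part ?(sm_tt hx hy); case: hx hy => [r1 l1] [r2 l2]; rewrite ?(opE, r1, l1, r2, l2); ring.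
  exact: string0.
- have -> : quad_part 1 1 (x * y) = 0.
    by rewrite /quad_part ?(sm_tt hx hy); case: hx hy => [r1 l1] [r2 l2]; rewrite ?(opE, r1, l1, r2, l2); ring.
  exact: string0.
- have -> : quad_part 2 0 (x * y) = 0.
    by rewrite /quad_part ?(sm_tt hx hy); case: hx hy => [r1 l1] [r2 l2]; rewrite ?(opE, r1, l1, r2, l2); ring.
  exact: string0.
- have -> : quad_part 2 1 (x * y) = 0.
    by rewrite /quad_part ?(sm_tt hx hy); case: hx hy => [r1 l1] [r2 l2]; rewrite ?(opE, r1, l1, r2, l2); ring.
  exact: string0.
- have -> : quad_part 2 2 (x * y) = 0.
    by rewrite /quad_part ?(sm_tt hx hy); case: hx hy => [r1 l1] [r2 l2]; rewrite ?(opE, r1, l1, r2, l2); ring.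
  exact: string0.
Qed.

Let sm_te x e f : trivial_at x -> pair_at e f ->
  quad_small (x * e) = (x * e) *+ 4.
Proof. by move=> [r1 l1] [r2 l2 r2' l2']; rewrite /quad_small !(opE, r1, l1, r2, l2, r2', l2'); ring. Qed.

Lemma part_te x e f : trivial_at x -> pair_at e f ->
  forall m a, (a <= m)%N -> (m <= 2)%N -> string m (quad_part m a (x * e)).
Proof.
move=> hx he [|[|[|m]]] // [|[|[|a]]] // _ _.
- have -> : quad_part 0 0 (x * e) = 0.
    by rewrite /quad_part ?(sm_te hx he); case: hx he => [r1 l1] [r2 l2 r2' l2']; rewrite ?(opE, r1, l1, r2, l2, r2', l2'); ring.
  exact: string0.
- have -> : quad_part 1 0 (x * e) = (x * e) *+ 4.
    by rewrite /quad_part ?(sm_te hx he); case: hx he => [r1 l1] [r2 l2 r2' l2']; rewrite ?(opE, r1, l1, r2, l2, r2', l2'); ring.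
  exact/stringMn/(string_te hx he).
- have -> : quad_part 1 1 (x * e) = 0.
    by rewrite /quad_part ?(sm_te hx he); case: hx he => [r1 l1] [r2 l2 r2' l2']; rewrite ?(opE, r1, l1, r2, l2, r2', l2'); ring.
  exact: string0.
- have -> : quad_part 2 0 (x * e) = 0.
    by rewrite /quad_part ?(sm_te hx he); case: hx he => [r1 l1] [r2 l2 r2' l2']; rewrite ?(opE, r1, l1, r2, l2, r2', l2'); ring.
  exact: string0.
- have -> : quad_part 2 1 (x * e) = 0.
    by rewrite /quad_part ?(sm_te hx he); case: hx he => [r1 l1] [r2 l2 r2' l2']; rewrite ?(opE, r1, l1, r2, l2, r2', l2'); ring.
  exact: string0.
- have -> : quad_part 2 2 (x * e) = 0.
    by rewrite /quad_part ?(sm_te hx he); case: hx he => [r1 l1] [r2 l2 r2' l2']; rewrite ?(opE, r1, l1, r2, l2, r2', l2'); ring.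
  exact: string0.
Qed.

Let sm_tf x e f : trivial_at x -> pair_at e f ->
  quad_small (x * f) = (x * f) *+ 4.
Proof. by move=> [r1 l1] [r2 l2 r2' l2']; rewrite /quad_small !(opE, r1, l1, r2, l2, r2', l2'); ring. Qed.

Lemma part_tf x e f : trivial_at x -> pair_at e f ->
  forall m a, (a <= m)%N -> (m <= 2)%N -> string m (quad_part m a (x * f)).
Proof.
move=> hx he [|[|[|m]]] // [|[|[|a]]] // _ _.
- have -> : quad_part 0 0 (x * f) = 0.
    by rewrite /quad_part ?(sm_tf hx he); case: hx he => [r1 l1] [r2 l2 r2' l2']; rewrite ?(opE, r1, l1, r2, l2, r2', l2'); ring.
  exact: string0.
- have -> : quad_part 1 0 (x * f) = 0.
    by rewrite /quad_part ?(sm_tf hx he); case: hx he => [r1 l1] [r2 l2 r2' l2']; rewrite ?(opE, r1, l1, r2, l2, r2', l2'); ring.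
  exact: string0.
- have -> : quad_part 1 1 (x * f) = (x * e) *+ 4.
    by rewrite /quad_part ?(sm_tf hx he); case: hx he => [r1 l1] [r2 l2 r2' l2']; rewrite ?(opE, r1, l1, r2, l2, r2', l2'); ring.
  exact/stringMn/(string_te hx he).
- have -> : quad_part 2 0 (x * f) = 0.
    by rewrite /quad_part ?(sm_tf hx he); case: hx he => [r1 l1] [r2 l2 r2' l2']; rewrite ?(opE, r1, l1, r2, l2, r2', l2'); ring.
  exact: string0.
- have -> : quad_part 2 1 (x * f) = 0.
    by rewrite /quad_part ?(sm_tf hx he); case: hx he => [r1 l1] [r2 l2 r2' l2']; rewrite ?(opE, r1, l1, r2, l2, r2', l2'); ring.
  exact: string0.
- have -> : quad_part 2 2 (x * f) = 0.
    by rewrite /quad_part ?(sm_tf hx he); case: hx he => [r1 l1] [r2 l2 r2' l2']; rewrite ?(opE, r1, l1, r2, l2, r2', l2'); ring.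
  exact: string0.
Qed.

Let sm_ee e1 f1 e2 f2 : pair_at e1 f1 -> pair_at e2 f2 ->
  quad_small (e1 * e2) = 0.
Proof. by move=> [r1 l1 r1' l1'] [r2 l2 r2' l2']; rewrite /quad_small !(opE, r1, l1, r1', l1', r2, l2, r2', l2'); ring. Qed.

Lemma part_ee e1 f1 e2 f2 : pair_at e1 f1 -> pair_at e2 f2 ->
  forall m a, (a <= m)%N -> (m <= 2)%N -> string m (quad_part m a (e1 * e2)).
Proof.
move=> he1 he2 [|[|[|m]]] // [|[|[|a]]] // _ _.
- have -> : quad_part 0 0 (e1 * e2) = 0.
    by rewrite /quad_part ?(sm_ee he1 he2); case: he1 he2 => [r1 l1 r1' l1'] [r2 l2 r2' l2']; rewrite ?(opE, r1, l1, r1', l1', r2, l2, r2', l2'); ring.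
  exact: string0.
- have -> : quad_part 1 0 (e1 * e2) = 0.
    by rewrite /quad_part ?(sm_ee he1 he2); case: he1 he2 => [r1 l1 r1' l1'] [r2 l2 r2' l2']; rewrite ?(opE, r1, l1, r1', l1', r2, l2, r2', l2'); ring.
  exact: string0.
- have -> : quad_part 1 1 (e1 * e2) = 0.
    by rewrite /quad_part ?(sm_ee he1 he2); case: he1 he2 => [r1 l1 r1' l1'] [r2 l2 r2' l2']; rewrite ?(opE, r1, l1, r1', l1', r2, l2, r2', l2'); ring.
  exact: string0.
- have -> : quad_part 2 0 (e1 * e2) = (e1 * e2) *+ 4.
    by rewrite /quad_part ?(sm_ee he1 he2); case: he1 he2 => [r1 l1 r1' l1'] [r2 l2 r2' l2']; rewrite ?(opE, r1, l1, r1', l1', r2, l2, r2', l2'); ring.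
  exact/stringMn/(string_ee he1 he2).
- have -> : quad_part 2 1 (e1 * e2) = 0.
    by rewrite /quad_part ?(sm_ee he1 he2); case: he1 he2 => [r1 l1 r1' l1'] [r2 l2 r2' l2']; rewrite ?(opE, r1, l1, r1', l1', r2, l2, r2', l2'); ring.
  exact: string0.
- have -> : quad_part 2 2 (e1 * e2) = 0.
    by rewrite /quad_part ?(sm_ee he1 he2); case: he1 he2 => [r1 l1 r1' l1'] [r2 l2 r2' l2']; rewrite ?(opE, r1, l1, r1', l1', r2, l2, r2', l2'); ring.
  exact: string0.
Qed.

(** The product e1 f2 is half its symmetric plus half its alternating part; the symmetric part has
    weight 2 and is removed, and 4 / 2 = 2. *)
Let sm_ef e1 f1 e2 f2 : pair_at e1 f1 -> pair_at e2 f2 ->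
  quad_small (e1 * f2) = (e1 * f2 - f1 * e2) *+ 2.
Proof. by move=> [r1 l1 r1' l1'] [r2 l2 r2' l2']; rewrite /quad_small !(opE, r1, l1, r1', l1', r2, l2, r2', l2'); ring. Qed.

Lemma part_ef e1 f1 e2 f2 : pair_at e1 f1 -> pair_at e2 f2 ->
  forall m a, (a <= m)%N -> (m <= 2)%N -> string m (quad_part m a (e1 * f2)).
Proof.
move=> he1 he2 [|[|[|m]]] // [|[|[|a]]] // _ _.
- have -> : quad_part 0 0 (e1 * f2) = (e1 * f2 - f1 * e2) *+ 2.
    by rewrite /quad_part ?(sm_ef he1 he2); case: he1 he2 => [r1 l1 r1' l1'] [r2 l2 r2' l2']; rewrite ?(opE, r1, l1, r1', l1', r2, l2, r2', l2'); ring.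
  exact/stringMn/string_alt.
- have -> : quad_part 1 0 (e1 * f2) = 0.
    by rewrite /quad_part ?(sm_ef he1 he2); case: he1 he2 => [r1 l1 r1' l1'] [r2 l2 r2' l2']; rewrite ?(opE, r1, l1, r1', l1', r2, l2, r2', l2'); ring.
  exact: string0.
- have -> : quad_part 1 1 (e1 * f2) = 0.
    by rewrite /quad_part ?(sm_ef he1 he2); case: he1 he2 => [r1 l1 r1' l1'] [r2 l2 r2' l2']; rewrite ?(opE, r1, l1, r1', l1', r2, l2, r2', l2'); ring.
  exact: string0.
- have -> : quad_part 2 0 (e1 * f2) = 0.
    by rewrite /quad_part ?(sm_ef he1 he2); case: he1 he2 => [r1 l1 r1' l1'] [r2 l2 r2' l2']; rewrite ?(opE, r1, l1, r1', l1', r2, l2, r2', l2'); ring.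
  exact: string0.
- have -> : quad_part 2 1 (e1 * f2) = (e1 * e2) *+ 2.
    by rewrite /quad_part ?(sm_ef he1 he2); case: he1 he2 => [r1 l1 r1' l1'] [r2 l2 r2' l2']; rewrite ?(opE, r1, l1, r1', l1', r2, l2, r2', l2'); ring.
  exact/stringMn/(string_ee he1 he2).
- have -> : quad_part 2 2 (e1 * f2) = 0.
    by rewrite /quad_part ?(sm_ef he1 he2); case: he1 he2 => [r1 l1 r1' l1'] [r2 l2 r2' l2']; rewrite ?(opE, r1, l1, r1', l1', r2, l2, r2', l2'); ring.
  exact: string0.
Qed.

Let sm_ff e1 f1 e2 f2 : pair_at e1 f1 -> pair_at e2 f2 ->
  quad_small (f1 * f2) = 0.
Proof. by move=> [r1 l1 r1' l1'] [r2 l2 r2' l2']; rewrite /quad_small !(opE, r1, l1, r1', l1', r2, l2, r2', l2'); ring. Qed.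

Lemma part_ff e1 f1 e2 f2 : pair_at e1 f1 -> pair_at e2 f2 ->
  forall m a, (a <= m)%N -> (m <= 2)%N -> string m (quad_part m a (f1 * f2)).
Proof.
move=> he1 he2 [|[|[|m]]] // [|[|[|a]]] // _ _.
- have -> : quad_part 0 0 (f1 * f2) = 0.
    by rewrite /quad_part ?(sm_ff he1 he2); case: he1 he2 => [r1 l1 r1' l1'] [r2 l2 r2' l2']; rewrite ?(opE, r1, l1, r1', l1', r2, l2, r2', l2'); ring.
  exact: string0.
- have -> : quad_part 1 0 (f1 * f2) = 0.
    by rewrite /quad_part ?(sm_ff he1 he2); case: he1 he2 => [r1 l1 r1' l1'] [r2 l2 r2' l2']; rewrite ?(opE, r1, l1, r1', l1', r2, l2, r2', l2'); ring.
  exact: string0.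
- have -> : quad_part 1 1 (f1 * f2) = 0.
    by rewrite /quad_part ?(sm_ff he1 he2); case: he1 he2 => [r1 l1 r1' l1'] [r2 l2 r2' l2']; rewrite ?(opE, r1, l1, r1', l1', r2, l2, r2', l2'); ring.
  exact: string0.
- have -> : quad_part 2 0 (f1 * f2) = 0.
    by rewrite /quad_part ?(sm_ff he1 he2); case: he1 he2 => [r1 l1 r1' l1'] [r2 l2 r2' l2']; rewrite ?(opE, r1, l1, r1', l1', r2, l2, r2', l2'); ring.
  exact: string0.
- have -> : quad_part 2 1 (f1 * f2) = 0.
    by rewrite /quad_part ?(sm_ff he1 he2); case: he1 he2 => [r1 l1 r1' l1'] [r2 l2 r2' l2']; rewrite ?(opE, r1, l1, r1', l1', r2, l2, r2', l2'); ring.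
  exact: string0.
- have -> : quad_part 2 2 (f1 * f2) = (e1 * e2) *+ 2.
    by rewrite /quad_part ?(sm_ff he1 he2); case: he1 he2 => [r1 l1 r1' l1'] [r2 l2 r2' l2']; rewrite ?(opE, r1, l1, r1', l1', r2, l2, r2', l2'); ring.
  exact/stringMn/(string_ee he1 he2).
Qed.

End DerivationStrings.

Section Strings.
Context (R : realType) (n : nat).
Local Notation PA := (ringPA R n).
Local Notation Q := (quadric R n).
Local Notation X := (@X R n).
Implicit Types (v w : unk n) (D K L : {set 'I_n}) (i j k : 'I_n) (f p x y e : PA) (q : Q).

Definition poly_string k (m : nat) p : Prop :=
  [/\ raising k p = 0, iter m.+1 (lowering k) p = 0
    & forall b, raising k (iter b.+1 (lowering k) p)
        = (b.+1 * (m - b))%:R *: iter b (lowering k) p].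

Lemma poly_stringE k m q :
  poly_string k m (val q) <-> hw_string (rq R k) (lq R k) m q.
Proof.
split=> -[h1 h2 h3]; split.
- by apply: val_inj; rewrite val_rq.
- by apply: val_inj; rewrite val_iter_lq.
- by move=> b; apply: val_inj; rewrite val_rq val_iter_lq h3 /= val_iter_lq.
- by rewrite -val_rq h1.
- by rewrite -val_iter_lq h2.
- by move=> b; rewrite -val_iter_lq -val_rq h3 /= val_iter_lq.
Qed.

Lemma iter_lowering_linear k b c f g :
  iter b (lowering k) (c *: f + g) = c *: iter b (lowering k) f + iter b (lowering k) g.
Proof. by elim: b => //= b ->; rewrite linearP. Qed.

Lemma poly_string_lin k m c f g :
  poly_string k m f -> poly_string k m g -> poly_string k m (c *: f + g).
Proof.
case=> f1 f2 f3 [g1 g2 g3]; split.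
- by rewrite linearP /= f1 g1 scaler0 addr0.
- by rewrite iter_lowering_linear f2 g2 scaler0 addr0.
- move=> b; rewrite !iter_lowering_linear linearP /= f3 g3 scalerDr !scalerA.
  by rewrite [c * _]mulrC.
Qed.

Lemma poly_string0 k m : poly_string k m 0.
Proof.
have i0 b : iter b (lowering k) 0 = 0 :> PA by elim: b => //= b ->; rewrite linear0.
by split=> [||b]; rewrite ?i0 ?linear0 ?scaler0.
Qed.

Lemma poly_stringZ k m c f : poly_string k m f -> poly_string k m (c *: f).
Proof. by move=> h; rewrite -[c *: f]addr0; apply: poly_string_lin (poly_string0 k m). Qed.

Lemma poly_stringD k m f g :
  poly_string k m f -> poly_string k m g -> poly_string k m (f + g).
Proof. by move=> h1 h2; rewrite -[f]scale1r; apply: poly_string_lin. Qed.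

Lemma poly_string_sum k m I (r : seq I) (P : pred I) (F : I -> PA) :
  (forall t, P t -> poly_string k m (F t)) ->
  poly_string k m (\sum_(t <- r | P t) F t).
Proof.
move=> h; elim/big_rec: _ => [|t f Pt]; first exact: poly_string0.
exact/poly_stringD/(h _ Pt).
Qed.

Lemma poly_string_intro k m p : (m <= 2)%N ->
  string (raising k) (lowering k) m p -> poly_string k m p.
Proof.
move=> m2 [r0 lm h1 h2]; split=> // b.
have [mb|bm] := leqP m b.
  rewrite (eqnP mb) muln0 scale0r.
  have -> : iter b.+1 (lowering k) p = 0; last by rewrite linear0.
  rewrite -(subnK (mb : (m < b.+1)%N)) iterD lm.
  by elim: (_ - _)%N => //= c ->; rewrite linear0.
case: m m2 bm h1 h2 {lm} => [|[|[|m]]] //; case: b => [|[|b]] //= _ _ h1 h2;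
by rewrite ?h1 ?h2 // scaler_nat.
Qed.

Lemma unk_at k v : trivial_at (raising k) (lowering k) (X v) \/
  exists e f, pair_at (raising k) (lowering k) e f /\ (X v = e \/ X v = f).
Proof.
have [kl|kl] := boolP (k \in lidx v).
  left; split; rewrite -uvar_unk ?raising_uvar ?lowering_uvar ?kl ?andbF //.
  by case: ifP => // _; rewrite uvar0 // is_unkU1 kl.
right; rewrite -uvar_unk; have [kr|kr] := boolP (k \in ridx v).
  exists (uvar R (lidx v) (ridx v :\ k)), (uvar R (lidx v) (ridx v)); split; last by right.
  by split; rewrite ?raising_uvar ?lowering_uvar ?kl ?kr ?inE ?eqxx //= setD1K.
exists (uvar R (lidx v) (ridx v)), (uvar R (lidx v) (k |: ridx v)); split; last by left.
by split; rewrite ?raising_uvar ?lowering_uvar ?kl ?(negPf kr) ?inE ?eqxx //= setU1K.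
Qed.

End Strings.

Section QuadricOperators.
Context (R : realType) (n : nat).
Local Notation PA := (ringPA R n).
Local Notation Q := (quadric R n).
Local Notation X := (@X R n).
Implicit Types (v w : unk n) (D K L : {set 'I_n}) (i j k : 'I_n) (f p x y e : PA) (q : Q).

Lemma quad_partE k m a q : val (hw_part (rq R k) (lq R k) m a (4%:R *: q)) =
  quad_part (raising k) (lowering k) m a (val q).
Proof.
have n4 : 4%:R != 0 :> R by rewrite pnatr_eq0.
have sp : quad_small (raising k) (lowering k) (val q)
    = 4%:R *: val (small_part (rq R k) (lq R k) q).
  rewrite small_partE /= scalerBr scalerA mulfV // scale1r scaler_nat.
  by rewrite /quad_small !(val_rq, val_lq).
rewrite linearZ /= hw_partE /quad_part sp.
case: m => [|[|[|m]]]; case: a => [|[|[|a]]] //=; rewrite ?scaler0 //.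
- by rewrite !scalerBr !linearZ /= !(val_rq, val_lq).
- by rewrite !linearZ /= !(val_rq, val_lq).
- by rewrite !linearZ /= !(val_rq, val_lq).
- by rewrite scalerA mulfV // scale1r !(val_rq, val_lq).
- by rewrite scalerA mulfV // scale1r !(val_rq, val_lq).
- by rewrite scalerA mulfV // scale1r !(val_rq, val_lq).
Qed.

(** Supplies the hypothesis [hw_part_string]. The factors of a product of unknowns generate modules
    of dimension at most 2, so the product lies in one with strings of length at most three. *)
Lemma hw_part_quad k (m a : nat) q : (a <= m)%N -> (m <= 2)%N ->
  hw_string (rq R k) (lq R k) m (hw_part (rq R k) (lq R k) m a q).
Proof.
move=> am m2.
suff H f : f \is 2.-homog -> exists2 q, val q = f
    & poly_string k m (val (hw_part (rq R k) (lq R k) m a q)).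
  have [q' /val_inj E] := H (val q) (dhomog_is_dhomog q).
  by rewrite E => /poly_stringE.
move: f; apply: quad_ind.
- by exists 0 => //; rewrite linear0; apply: poly_string0.
- move=> c f g [p <- hp] [p' <- hp']; exists (c *: p + p') => //.
  by rewrite linearP; apply: poly_string_lin.
move=> v w.
have [q' q'E] : exists q', val q' = X v * X w.
  by exists (DHomog (dhomogM (X_homog R v) (X_homog R w))).
exists q' => //.
have n4 : 4%:R != 0 :> R by rewrite pnatr_eq0.
rewrite -[q'](scalerK n4) linearZ /=; apply: poly_stringZ; rewrite quad_partE q'E.
apply: poly_string_intro => //.
have [rD lD] : (forall f g, raising k (f + g) = raising k f + raising k g)
    /\ (forall f g, lowering k (f + g) = lowering k f + lowering k g).
  by split=> f g; apply: leibnizD.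
have rM := @raisingM R n k; have lM := @loweringM R n k.
have [tv|[e1 [f1 [p1 hv]]]] := unk_at R k v; have [tw|[e2 [f2 [p2 hw]]]] := unk_at R k w.
- exact: (part_tt rD lD rM lM tv tw).
- by case: hw => ->; [apply: (part_te rD lD rM lM tv p2) | apply: (part_tf rD lD rM lM tv p2)].
- by rewrite mulrC; case: hv => ->; [apply: (part_te rD lD rM lM tw p1) | apply: (part_tf rD lD rM lM tw p1)].
case: hv => ->; case: hw => ->.
- exact: (part_ee rD lD rM lM p1 p2).
- exact: (part_ef rD lD rM lM p1 p2).
- by rewrite mulrC; apply: (part_ef rD lD rM lM p2 p1).
- exact: (part_ff rD lD rM lM p1 p2).
Qed.

(** The commutator of two derivations is a derivation, hence determined by the unknowns. *)
Lemma quad_commute (d1 d2 : Q -> Q) (D1 D2 : PA -> PA) :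
  (forall q, val (d1 q) = D1 (val q)) -> (forall q, val (d2 q) = D2 (val q)) ->
  linear D1 -> linear D2 ->
  (forall f g, D1 (f * g) = D1 f * g + f * D1 g) ->
  (forall f g, D2 (f * g) = D2 f * g + f * D2 g) ->
  (forall v, D1 (D2 (X v)) = D2 (D1 (X v))) ->
  forall q, d1 (d2 q) = d2 (d1 q).
Proof.
move=> d1E d2E L1 L2 M1 M2 E q; apply: val_inj; rewrite !(d1E, d2E).
have A0 (T : PA -> PA) : linear T -> T 0 = 0.
  by move=> L; have := L (-1) 0 0; rewrite scaler0 addr0 scaleN1r addNr.
have AD (T : PA -> PA) f g : linear T -> T (f + g) = T f + T g.
  by move=> L; have := L 1 f g; rewrite !scale1r.
move: (val q) (dhomog_is_dhomog q); apply: quad_ind => [|c f g Ef Eg|v w].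
- by rewrite !A0.
- by rewrite L2 !L1 L2 Ef Eg.
rewrite M1 M2 !AD // !M1 !M2 !E; ring.
Qed.

Lemma rq_comm j k : j != k -> forall q, rq R j (rq R k q) = rq R k (rq R j q).
Proof.
move=> jk; apply: (quad_commute (val_rq j) (val_rq k));
  do ?[exact: raising_linear|exact: raisingM].
move=> v; rewrite -uvar_unk !raising_uvar !(fun_if (raising _)) !raising_uvar !linear0 !inE.
rewrite ?(negPf jk) [k == j]eq_sym ?(negPf jk) /=.
by case: (k \in ridx v); case: (j \in ridx v); case: (k \in lidx v); case: (j \in lidx v);
   rewrite //= setDDl setUC -setDDl.
Qed.

Lemma lq_comm j k : j != k -> forall q, lq R j (lq R k q) = lq R k (lq R j q).
Proof.
move=> jk; apply: (quad_commute (val_lq j) (val_lq k));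
  do ?[exact: lowering_linear|exact: loweringM].
move=> v; rewrite -uvar_unk !lowering_uvar !(fun_if (lowering _)) !lowering_uvar !linear0 !inE.
rewrite ?(negPf jk) [k == j]eq_sym ?(negPf jk) /=.
by case: (k \in ridx v); case: (j \in ridx v); rewrite //= setUCA.
Qed.

Lemma rq_lq_comm j k : j != k -> forall q, rq R j (lq R k q) = lq R k (rq R j q).
Proof.
move=> jk; apply: (quad_commute (val_rq j) (val_lq k));
  do ?[exact: raising_linear|exact: raisingM|exact: lowering_linear|exact: loweringM].
move=> v; rewrite -uvar_unk !raising_uvar !lowering_uvar !(fun_if (raising _)).
rewrite !(fun_if (lowering _)) !raising_uvar !lowering_uvar !linear0 !inE.
rewrite (negPf jk) [k == j]eq_sym (negPf jk) /=.
case: (k \in ridx v); case: (boolP (j \in ridx v)); case: (j \in lidx v) => //= jr.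
by congr uvar; apply/setP => i; rewrite !inE; case: eqVneq => [->|//]; rewrite (negPf jk).
Qed.

End QuadricOperators.

Lemma prod_sum_subset (A : comNzRingType) (I : finType) (D : {set I}) (F G : I -> A) :
  \prod_(k | k \notin D) (F k + G k) =
  \sum_(J : {set I} | J \subset ~: D) \prod_(k | k \notin D) (if k \in J then F k else G k).
Proof.
rewrite big_mkcond (eq_bigr (fun k => (if k \notin D then F k else 0)
  + (if k \notin D then G k else 1))) => [|k _]; last by case: ifP; rewrite ?add0r.
rewrite bigA_distr [RHS]big_mkcond; apply: eq_big => // J _ /=.
case: ifP => JD; last first.
  have /subsetPn[k kJ] := negbT JD; rewrite inE negbK => kD.
  by rewrite (bigD1 k) //= kJ kD mul0r.
rewrite [RHS]big_mkcond; apply: eq_bigr => k _; case: ifP => kJ; last by [].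
by have := subsetP JD k kJ; rewrite inE => ->.
Qed.

(** * From the group to the Lie algebra *)

Section Group.
Context (R : realType) (n : nat).
Local Notation PA := (ringPA R n).
Local Notation Q := (quadric R n).
Local Notation X := (@X R n).
Local Notation grp := ('I_n -> 'M[R]_2).
Implicit Types (v w : unk n) (D K L : {set 'I_n}) (i j k : 'I_n) (f p : PA) (q : Q) (g h : grp).

Lemma sl_act_lin g c f f' : sl_act g (c *: f + f') = c *: sl_act g f + sl_act g f'.
Proof. by rewrite /sl_act substD substZ. Qed.

Lemma sl_act_sum g (I : Type) (r : seq I) (P : pred I) (F : I -> PA) :
  sl_act g (\sum_(i <- r | P i) F i) = \sum_(i <- r | P i) sl_act g (F i).
Proof. exact: subst_sum. Qed.

Lemma sl_actM g f f' : sl_act g (f * f') = sl_act g f * sl_act g f'.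
Proof. exact: substM. Qed.

Lemma eq_sl_act g h f : g =1 h -> sl_act g f = sl_act h f.
Proof.
move=> gh; rewrite /sl_act /subst; congr (_ \mPo _); apply: eq_mktuple => a.
case: (unk_val a) => [L|x].
  by apply: eq_bigr => L' _; congr (_ *: _); apply: eq_bigr => k _; rewrite gh.
case: (val x) => [[i j] K]; apply: eq_bigr => K' _; congr (_ *: _).
by apply: eq_bigr => k _; rewrite gh.
Qed.

(** Matrix multiplication at all indices outside D at once: the set K' records which of the two
    intermediate basis vectors is chosen at each index. *)
Lemma sl_coeff_mul g h D K K'' : \sum_(K' : {set 'I_n} | K' \subset ~: D)
    sl_coeff h D K K' * sl_coeff g D K' K''
  = sl_coeff (fun k => g k *m h k) D K K''.
Proof.
rewrite /sl_coeff [RHS](eq_bigr (fun k =>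
    h k 1 (ef (k \in K)) * g k (ef (k \in K'')) 1
    + h k 0 (ef (k \in K)) * g k (ef (k \in K'')) 0)) => [|k _]; last first.
  rewrite mxE !big_ord_recl big_ord0 addr0 addrC.
  rewrite (_ : lift ord0 ord0 = 1 :> 'I_2); last exact: val_inj.
  by congr (_ + _); rewrite mulrC.
rewrite prod_sum_subset; apply: eq_bigr => K' _; rewrite -big_split.
by apply: eq_bigr => k _ /=; case: (k \in K').
Qed.

Lemma sl_act_mul g h f : f \is 2.-homog ->
  sl_act (fun k => g k *m h k) f = sl_act g (sl_act h f).
Proof.
have E v : sl_act (fun k => g k *m h k) (X v) = sl_act g (sl_act h (X v)).
  rewrite !sl_actX sl_act_sum.
  under [RHS]eq_bigr => K' K'D.
    rewrite -[_ *: _]addr0 sl_act_lin /sl_act [subst _ 0]/subst rmorph0 addr0 -/(sl_act g _).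
    rewrite sl_act_uvar; last first.
      by have := is_unk_lr v; rewrite /is_unk => /andP[-> _]; rewrite disjoint_sym disjoints_subset.
    rewrite scaler_sumr; over.
  rewrite /= exchange_big /=; apply: eq_bigr => K'' _.
  rewrite -sl_coeff_mul scaler_suml; apply: eq_bigr => K' _.
  by rewrite scalerA.
move: f; apply: quad_ind => [|c f f' Ef Ef'|v w].
- by rewrite /sl_act /subst !rmorph0.
- by rewrite !sl_act_lin Ef Ef'.
by rewrite !sl_actM !E.
Qed.

Lemma sl_coeff1 D K K' : K \subset ~: D -> K' \subset ~: D ->
  \prod_(k | k \notin D) (1%:M : 'M[R]_2) (ef (k \in K')) (ef (k \in K)) = (K' == K)%:R.
Proof.
move=> KD K'D; have [->|nK] := eqVneq; first by rewrite big1 // => k _; rewrite mxE eqxx.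
have [k kK] : exists k, (k \in K') != (k \in K).
  apply/existsP; apply: contraNT nK => /existsPn E; apply/eqP/setP => k.
  by have /negPn/eqP := E k.
have kD : k \notin D.
  case kK1 : (k \in K'); first by have := subsetP K'D k kK1; rewrite inE.
  case kK2 : (k \in K); first by have := subsetP KD k kK2; rewrite inE.
  by rewrite kK1 kK2 in kK.
by rewrite (bigD1 k) //= mxE; move: kK; case: (k \in K'); case: (k \in K) => //= _; rewrite mul0r.
Qed.

Lemma sl_act1 f : f \is 2.-homog -> sl_act (fun=> 1%:M) f = f.
Proof.
have E v : sl_act (fun=> 1%:M) (X v) = X v.
  rewrite sl_actX -[RHS]uvar_unk (bigD1 (ridx v)) /=; last first.
    by have /andP[_] := is_unk_lr v; rewrite disjoint_sym disjoints_subset.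
  have vD : ridx v \subset ~: lidx v.
    by have /andP[_] := is_unk_lr v; rewrite disjoint_sym disjoints_subset.
  rewrite /sl_coeff sl_coeff1 // eqxx scale1r big1 ?addr0 // => K /andP[KD /negPf Kv].
  by rewrite sl_coeff1 // Kv scale0r.
move: f; apply: quad_ind => [|c f f' Ef Ef'|v w].
- by rewrite /sl_act /subst rmorph0.
- by rewrite sl_act_lin Ef Ef'.
by rewrite sl_actM !E.
Qed.

Definition at_index k (A : 'M[R]_2) : grp := fun j => if j == k then A else 1%:M.

Lemma sl_coeff_at k A D K K' : K \subset ~: D -> K' \subset ~: D -> k \notin D ->
  sl_coeff (at_index k A) D K K' =
  A (ef (k \in K')) (ef (k \in K)) * (K' :\ k == K :\ k)%:R.
Proof.
move=> KD K'D kD; rewrite /sl_coeff (bigD1 k) //= /at_index eqxx; congr (_ * _).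
rewrite -(@sl_coeff1 (k |: D)).
- apply: eq_big => [j|j /andP[_ /negPf jk]]; first by rewrite !inE negb_or andbC.
  by rewrite jk !inE jk.
- by apply/subsetP => j; rewrite !inE negb_or => /andP[-> /(subsetP KD)]; rewrite inE.
- by apply/subsetP => j; rewrite !inE negb_or => /andP[-> /(subsetP K'D)]; rewrite inE.
Qed.

Lemma sl_act_at k A v : sl_act (at_index k A) (X v) =
  if k \in lidx v then X v else
  if k \in ridx v then A 0 1 *: raising k (X v) + A 1 1 *: X v
  else A 0 0 *: X v + A 1 0 *: lowering k (X v).
Proof.
have vD : ridx v \subset ~: lidx v.
  by have /andP[_] := is_unk_lr v; rewrite disjoint_sym disjoints_subset.
rewrite sl_actX; case: ifPn => kl.
  rewrite -[RHS](uvar_unk R v) (bigD1 (ridx v)) //= big1 ?addr0 => [|K /andP[KD /negPf Kv]].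
    rewrite -[RHS]scale1r; congr (_ *: _).
    have := sl_coeff1 vD vD; rewrite eqxx mulr1n => <-.
    apply: eq_bigr => j jD; rewrite /at_index; case: eqP => // jk.
    by rewrite jk kl in jD.
  have -> : sl_coeff (at_index k A) (lidx v) (ridx v) K = 0; last by rewrite scale0r.
  have := sl_coeff1 vD KD; rewrite Kv mulr0n => <-; apply: eq_bigr => j jD.
  by rewrite /at_index; case: eqP => // jk; rewrite jk kl in jD.
have kD K : K \subset ~: lidx v -> k |: K \subset ~: lidx v.
  by move=> KD; rewrite subUset sub1set inE kl.
have DK K : K \subset ~: lidx v -> K :\ k \subset ~: lidx v.
  by move=> KD; apply: subset_trans KD; apply: subsetDl.
have neq K : k |: K != K :\ k.
  by apply/eqP => /setP/(_ k); rewrite !inE eqxx.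
rewrite (bigD1 (ridx v :\ k)) ?DK //= (bigD1 (k |: ridx v)) ?kD //= ?neq //=.
rewrite big1 ?addr0 => [|K /andP[/andP[KD K1] K2]]; last first.
  rewrite sl_coeff_at //; have [E|_] := eqVneq; last by rewrite mulr0 scale0r.
  case kK : (k \in K).
    by move: K2; rewrite -(setD1K kK) E; case/eqP; apply/setP => j; rewrite !inE; case: (j == k).
  by move: K1; rewrite -E; case/eqP; apply/setP => j; rewrite !inE; case: eqVneq => [->|].
rewrite !sl_coeff_at ?DK ?kD //.
have -> : (ridx v :\ k) :\ k = ridx v :\ k.
  by apply/setP => j; rewrite !inE; case: (j == k).
have -> : (k |: ridx v) :\ k = ridx v :\ k.
  by apply/setP => j; rewrite !inE; case: (j == k).
rewrite !inE !eqxx /= ?mulr1n !mulr1 raisingX loweringX; case: ifP => kr.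
  have -> : k |: ridx v = ridx v by apply/setUidPr; rewrite sub1set.
  by rewrite uvar_unk /ef kr.
have -> : ridx v :\ k = ridx v.
  by apply/setP => j; rewrite !inE; case: eqVneq => [->|]; rewrite ?kr.
by rewrite uvar_unk /ef kr.
Qed.

Definition upper (t : R) : 'M[R]_2 := \matrix_(i, j) (if i == j then 1 else if i == 0 then t else 0).
Definition lower_mx (t : R) : 'M[R]_2 := \matrix_(i, j) (if i == j then 1 else if i == 0 then 0 else t).

Lemma sl_act_upper k t v : sl_act (at_index k (upper t)) (X v) = X v + t *: raising k (X v).
Proof.
rewrite sl_act_at raisingX; case: ifPn => kl.
  have -> : (k \in ridx v) = false; last by rewrite scaler0 addr0.
  by have /andP[_ /pred0P/(_ k)] := is_unk_lr v; rewrite /= kl.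
case: ifP => kr; rewrite ?kr !mxE /= !scale1r ?scale0r ?scaler0 ?addr0 //.
by rewrite addrC.
Qed.

Lemma sl_act_lower k t v : sl_act (at_index k (lower_mx t)) (X v) = X v + t *: lowering k (X v).
Proof.
rewrite sl_act_at loweringX; case: ifPn => kl.
  by rewrite (uvar0 R (D := lidx v)) ?is_unkU1 ?kl // if_same scaler0 addr0.
by case: ifP => kr; rewrite ?kr !mxE /= !scale1r ?scale0r ?scaler0 ?addr0 ?add0r.
Qed.

(** The exponential series of [t d]: since [d] applied twice kills each unknown, its third power
    kills a product of two of them, and [d (d (f g))] is 2 [d f * d g]. *)
Let exp_quad (g : grp) (d : PA -> PA) (t : R) :
  (forall v, sl_act g (X v) = X v + t *: d (X v)) -> linear d ->
  (forall f f', d (f * f') = d f * f' + f * d f') -> (forall v, d (d (X v)) = 0) ->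
  forall f, f \is 2.-homog -> sl_act g f = f + t *: d f + (t ^+ 2 / 2) *: d (d f).
Proof.
move=> gX dL dM dd; have d0 : d 0 = 0.
  by have := dL (-1) 0 0; rewrite scaler0 addr0 scaleN1r addNr.
have dD f f' : d (f + f') = d f + d f' by have := dL 1 f f'; rewrite !scale1r.
apply: quad_ind => [|c f f' Ef Ef'|v w].
- by rewrite !d0 !scaler0 !addr0 /sl_act /subst rmorph0.
- rewrite sl_act_lin Ef Ef' !dL !scalerDr !scalerA ![c * _]mulrC.
  by rewrite -!mul_mpolyC; ring.
rewrite sl_actM !gX !dM !dD !dM !dd mul0r mulr0 add0r addr0 -mulr2n.
rewrite -scaler_nat scalerA -mulrA mulVf ?pnatr_eq0 // mulr1 expr2.
by rewrite -!mul_mpolyC mpolyCM; ring.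
Qed.

Lemma raising2 k v : raising k (raising k (X v)) = 0.
Proof.
rewrite raisingX; case: ifP => _; last by rewrite linear0.
by rewrite raising_uvar !inE eqxx.
Qed.

Lemma lowering2 k v : lowering k (lowering k (X v)) = 0.
Proof.
rewrite loweringX; case: ifP => _; first by rewrite linear0.
by rewrite lowering_uvar !inE eqxx.
Qed.

Lemma sl_quad_upper k t q : sl_quad (at_index k (upper t)) q =
  q + t *: rq R k q + (t ^+ 2 / 2) *: rq R k (rq R k q).
Proof.
apply: val_inj; rewrite /= !val_rq.
apply: exp_quad (dhomog_is_dhomog q); [exact: sl_act_upper|exact: raising_linear| |exact: raising2].
exact: raisingM.
Qed.

Lemma sl_quad_lower k t q : sl_quad (at_index k (lower_mx t)) q =
  q + t *: lq R k q + (t ^+ 2 / 2) *: lq R k (lq R k q).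
Proof.
apply: val_inj; rewrite /= !val_lq.
apply: exp_quad (dhomog_is_dhomog q); [exact: sl_act_lower|exact: lowering_linear| |exact: lowering2].
exact: loweringM.
Qed.

Lemma det_mx2 (A : 'M[R]_2) : \det A = A 0 0 * A 1 1 - A 0 1 * A 1 0.
Proof.
rewrite (expand_det_row _ 0) !big_ord_recl big_ord0 addr0 /cofactor !det_mx11 !mxE /=.
rewrite expr0 expr1 mul1r mulN1r mulrN.
by congr (_ * A _ _ - A _ _ * A _ _); apply: val_inj.
Qed.

Lemma mx2P (A B : 'M[R]_2) : A 0 0 = B 0 0 -> A 0 1 = B 0 1 -> A 1 0 = B 1 0 ->
  A 1 1 = B 1 1 -> A = B.
Proof.
have o2 (i : 'I_2) : i = 0 \/ i = 1.
  by case: i => [[|[|]]] // ?; [left|right]; apply: val_inj.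
by move=> *; apply/matrixP => i j; case: (o2 i) => ->; case: (o2 j) => ->.
Qed.

Lemma mul_mx2 (A B : 'M[R]_2) (i j : 'I_2) : (A *m B) i j = A i 0 * B 0 j + A i 1 * B 1 j.
Proof. by rewrite mxE !big_ord_recl big_ord0 addr0; congr (_ + A i _ * B _ j); apply: val_inj. Qed.

Lemma inSL_at k A : \det A = 1 -> inSL (at_index k A).
Proof. by move=> A1 j; rewrite /at_index; case: eqP => // _; rewrite det1. Qed.

Lemma det_upper t : \det (upper t) = 1.
Proof. by rewrite det_mx2 !mxE /= mulr1 mulr0 subr0. Qed.

Lemma det_lower_mx t : \det (lower_mx t) = 1.
Proof. by rewrite det_mx2 !mxE /= mulr1 mul0r subr0. Qed.

(** Subtracting the actions of the unipotent elements with parameters 1 and -1 cancels the constant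
    and the quadratic term and leaves twice the operator. *)
Lemma submodule_lie (U : {vspace Q}) : submodule U -> lie_stable (@rq R n) (@lq R n) U.
Proof.
move=> Us k q qU.
have n2 : 2 != 0 :> R by rewrite pnatr_eq0.
have half (d : Q) (d2 : Q) : q + 1 *: d + (1 ^+ 2 / 2) *: d2 \in U ->
    q + (-1) *: d + ((-1) ^+ 2 / 2) *: d2 \in U -> d \in U.
  rewrite sqrrN => h1 h2; have := rpredB h1 h2.
  rewrite scale1r scaleN1r opprD addrACA subrr addr0 opprD opprK addrACA subrr add0r.
  by rewrite -mulr2n -scaler_nat => /(memvZ 2^-1); rewrite scalerA mulVf // scale1r.
split; [apply: (half _ (rq R k (rq R k q)))|apply: (half _ (lq R k (lq R k q)))].
- by rewrite -sl_quad_upper; apply: Us qU; apply/inSL_at/det_upper.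
- by rewrite -sl_quad_upper; apply: Us qU; apply/inSL_at/det_upper.
- by rewrite -sl_quad_lower; apply: Us qU; apply/inSL_at/det_lower_mx.
- by rewrite -sl_quad_lower; apply: Us qU; apply/inSL_at/det_lower_mx.
Qed.

Lemma sl_quad_mul g h q : sl_quad (fun k => g k *m h k) q = sl_quad g (sl_quad h q).
Proof. by apply: val_inj; apply: sl_act_mul; apply: dhomog_is_dhomog. Qed.

Lemma eq_sl_quad g h q : g =1 h -> sl_quad g q = sl_quad h q.
Proof. by move=> gh; apply: val_inj; apply: eq_sl_act. Qed.

(** The outer parameters are forced by the two diagonal entries, the middle one by the lower left
    entry; the upper right entry then agrees because the determinant is 1. *)
Lemma sl2_factor (A : 'M[R]_2) : \det A = 1 -> A 1 0 != 0 ->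
  A = upper ((A 0 0 - 1) / A 1 0) *m (lower_mx (A 1 0) *m upper ((A 1 1 - 1) / A 1 0)).
Proof.
rewrite det_mx2 => dA c0.
have bE : A 0 1 = (A 0 0 * A 1 1 - 1) / A 1 0.
  by apply: (mulIf c0); rewrite mulfVK // -dA; ring.
apply: mx2P; rewrite !mul_mx2 !mxE /= ?bE; field => //.
Qed.

Lemma lie_submodule (U : {vspace Q}) : lie_stable (@rq R n) (@lq R n) U -> submodule U.
Proof.
move=> Us.
have Uup k t q : q \in U -> sl_quad (at_index k (upper t)) q \in U.
  move=> qU; have [rU _] := Us k q qU; have [rrU _] := Us k _ rU.
  by rewrite sl_quad_upper !rpredD ?rpredZ.
have Ulo k t q : q \in U -> sl_quad (at_index k (lower_mx t)) q \in U.
  move=> qU; have [_ rU] := Us k q qU; have [_ rrU] := Us k _ rU.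
  by rewrite sl_quad_lower !rpredD ?rpredZ.
have atM k A B q : sl_quad (at_index k (A *m B)) q = sl_quad (at_index k A) (sl_quad (at_index k B) q).
  rewrite -sl_quad_mul; apply: eq_sl_quad => j; rewrite /at_index; case: eqP => // _.
  by rewrite mulmx1.
have Uat0 k A q : \det A = 1 -> A 1 0 != 0 -> q \in U -> sl_quad (at_index k A) q \in U.
  by move=> dA c0 qU; rewrite (sl2_factor dA c0) !atM; apply/Uup/Ulo/Uup.
have Uat k A q : \det A = 1 -> q \in U -> sl_quad (at_index k A) q \in U.
  move=> dA qU; have [c0|c0] := eqVneq (A 1 0) 0; last exact: Uat0.
  (* If the lower left entry is 0, the lower right one is not, and it becomes the lower left entry
     of [A *m lower_mx 1]. *)
  have -> : A = (A *m lower_mx 1) *m lower_mx (-1).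
    rewrite -mulmxA -[LHS]mulmx1; congr (_ *m _); apply: mx2P;
    by rewrite !mul_mx2 !mxE /=; ring.
  rewrite atM; apply: Uat0; last exact: Ulo.
    by rewrite det_mulmx dA det_lower_mx mulr1.
  rewrite mul_mx2 !mxE /= c0 mul0r add0r mulr1.
  apply/eqP => d0; move: dA; rewrite det_mx2 c0 d0 !mulr0 subr0 => /eqP.
  by rewrite eq_sym oner_eq0.
move=> g gSL q qU.
pose gs (s : seq 'I_n) : grp := fun j => if j \in s then g j else 1%:M.
have -> : sl_quad g q = sl_quad (gs (enum 'I_n)) q.
  by apply: eq_sl_quad => j; rewrite /gs mem_enum.
elim: (enum 'I_n) (enum_uniq 'I_n) => [_|k s IH /= /andP[ks us]].
  have -> : sl_quad (gs [::]) q = q; last by [].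
  by apply: val_inj; rewrite /= -[RHS]sl_act1 // dhomog_is_dhomog.
have -> : sl_quad (gs (k :: s)) q = sl_quad (at_index k (g k)) (sl_quad (gs s) q).
  rewrite -sl_quad_mul; apply: eq_sl_quad => j; rewrite /gs /at_index inE.
  by case: eqVneq => [->|_] /=; rewrite ?(negPf ks) ?mulmx1 ?mul1mx.
by apply/Uat/IH.
Qed.

End Group.

(** * The quadrics of the four classes *)

Section MinorsAt.
Context (n : nat).
Implicit Types (A : comNzRingType) (D K M : {set 'I_n}) (i j k a b l : 'I_n).

(* The minor of S that corresponds to [uvar D K]. *)
Definition mins A (S : 'M[A]_n) D K : A :=
  at_sets (fun v : unk n => match v with
                  | inl L => pm S L
                  | inr x => am S (val x).1.1 (val x).1.2 (val x).2
                  end) D K.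

Lemma mins_p A (S : 'M[A]_n) K : mins S set0 K = pm S K.
Proof. exact: (at_sets_unk _ (inl K : unk n)). Qed.

Lemma is_unk2 i j K : i != j -> is_unk [set i; j] K = (i \notin K) && (j \notin K).
Proof.
move=> ij; rewrite /is_unk cards2 ij /= disjoints_subset subUset !sub1set.
by rewrite !inE.
Qed.

Lemma mins_a A (S : 'M[A]_n) i j K : S^T = S -> i != j -> i \notin K -> j \notin K ->
  mins S [set i; j] K = am S i j K.
Proof.
move=> symS ij iK jK.
have /is_unkP[v [vD vK]] : is_unk [set i; j] K by rewrite is_unk2 // iK jK.
rewrite -{1}vD -{1}vK /mins at_sets_unk; case: v vD vK => [L /setP/(_ i)|x].
  by rewrite !inE eqxx.
have := lidx_neq x; case: x => [[[i' j'] K'] /= h] ij' E ->.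
have /set2P Ei : i' \in [set i; j] by rewrite -E set21.
have /set2P Ej : j' \in [set i; j] by rewrite -E set22.
move: ij'; case: Ei Ej => -> [] ->; rewrite ?eqxx // => _.
by rewrite am_sym.
Qed.

Lemma mins_eq0 A (S : 'M[A]_n) D K : ~~ is_unk D K -> mins S D K = 0.
Proof. exact: at_sets0. Qed.

Lemma mins_morph A (B : comNzRingType) (phi : {rmorphism A -> B}) (S : 'M[A]_n) D K :
  phi (mins S D K) = mins (map_mx phi S) D K.
Proof.
have rowE s T : map_mx phi (row_minor S s T) = row_minor (map_mx phi S) s T.
  by apply/matrixP => r c; rewrite !mxE; case: ifP => _ //; rewrite rmorph_nat.
rewrite /mins raddf_at_sets; apply: eq_at_sets => -[L|x] /=.
  by rewrite /pm -det_map_mx rowE.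
by rewrite /am -det_map_mx rowE.
Qed.

Lemma is_unkE D K : is_unk D K ->
  D = set0 \/ exists i j, [/\ i != j, D = [set i; j], i \notin K & j \notin K].
Proof.
move=> uDK; have /andP[/orP[D0|/cards2P[i [j [ij E]]]] _] := uDK.
  by left; apply/eqP; rewrite -cards_eq0.
by right; exists i, j; rewrite E is_unk2 // in uDK; case/andP: uDK.
Qed.

Section Derivations.
Variables (A : comNzRingType) (S : 'M[A]_n) (d : A -> A) (k : 'I_n).
Hypotheses (symS : S^T = S) (dD : forall x y, d (x + y) = d x + d y)
  (dM : forall x y, d (x * y) = d x * y + x * d y).

Lemma raising_mins : (forall i j, d (S i j) = ((i == k) && (j == k))%:R) ->
  forall D K, d (mins S D K) =
    if (k \in K) && (k \notin D) then mins S D (K :\ k) else 0.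
Proof.
move=> dS D K; have [uDK|nu] := boolP (is_unk D K); last first.
  rewrite mins_eq0 // (derivation0 dD); case: ifP => // /andP[_ kD].
  by rewrite mins_eq0 // is_unkD1.
case: (is_unkE uDK) => [->|[i [j [ij -> iK jK]]]].
  by rewrite !mins_p inE andbT; apply: raising_pm.
rewrite mins_a // (raising_am dD dM dS) // !inE negb_or.
case: ifP => kK //=; rewrite ?mins_a ?inE ?(negPf iK) ?(negPf jK) ?andbF //.
by rewrite !ifT //; apply/andP; split; apply: contraTneq kK => ->.
Qed.

Lemma lowering_mins : (forall i j, d (S i j) = - (S i k * S k j)) ->
  forall D K, d (mins S D K) + S k k * mins S D K =
    if k \in K then 0 else mins S D (k |: K).
Proof.
move=> dS D K; have [uDK|nu] := boolP (is_unk D K); last first.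
  rewrite mins_eq0 // (derivation0 dD) mulr0 addr0; case: ifP => // kK.
  by rewrite mins_eq0 // is_unkU1 (negPf nu) andbF.
case: (is_unkE uDK) => [->|[i [j [ij -> iK jK]]]].
  by rewrite !mins_p; apply: lowering_pm.
rewrite mins_a // (lowering_am dD dM dS) // !inE.
have [kK|kK] := boolP (k \in K); first by rewrite orbT.
rewrite orbF; have [kij|] := boolP ((k == i) || (k == j)).
  by rewrite mins_eq0 // is_unkU1 !inE kij.
rewrite negb_or => /andP[ki kj].
have nK x : k != x -> x \notin K -> x \notin k |: K.
  by move=> kx xK; rewrite !inE negb_or xK andbT eq_sym.
by rewrite mins_a ?nK.
Qed.

End Derivations.

Section Relations.
Variables (A : comNzRingType) (S : 'M[A]_n).
Hypotheses (symS : S^T = S) (reg2 : forall x : A, x *+ 2 = 0 -> x = 0).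

Lemma mins_relation a b M : a != b -> a \notin M -> b \notin M ->
  (if odd #|M| then alt_sum (mins S set0) (mins S [set a; b]) M else 0)
  + \sum_(l in M) alt_sum (mins S [set a; l]) (mins S [set b; l]) (M :\ l) = 0.
Proof.
move=> ab aM bM; have sub (x : 'I_n) (K L : {set 'I_n}) : K \subset L -> x \notin L -> x \notin K.
  by move=> /subsetP KL; apply/contra/KL.
rewrite -[RHS](minor_relation symS reg2 ab aM bM); congr (_ + _).
  case: ifP => // _; apply: eq_alt_sum => K KM; rewrite ?mins_p //.
  by rewrite mins_a // (sub _ _ _ KM).
have neq x l : x \notin M -> l \in M -> x != l by move=> xM lM; apply: contraNneq xM => ->.
apply: eq_bigr => l lM; apply: eq_alt_sum => K; rewrite subsetD1 => /andP[KM lK];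
by rewrite mins_a // ?neq // (sub _ _ _ KM).
Qed.

Lemma mins_principal_relation i M : i \notin M -> odd #|M| ->
  alt_sum (mins S set0) (fun K => mins S set0 (i |: K)) M
  + \sum_(l in M) alt_sum (mins S [set i; l]) (mins S [set i; l]) (M :\ l) = 0.
Proof.
move=> iM oM; rewrite -[RHS](principal_minor_relation symS reg2 iM oM); congr (_ + _).
  by apply: eq_alt_sum => K KM; rewrite ?mins_p.
have sub (x : 'I_n) (K L : {set 'I_n}) : K \subset L -> x \notin L -> x \notin K.
  by move=> /subsetP KL; apply/contra/KL.
apply: eq_bigr => l lM; apply: eq_alt_sum => K; rewrite subsetD1 => /andP[KM lK];
by rewrite mins_a // ?(sub _ _ _ KM) //; apply: contraNneq iM => ->.
Qed.

End Relations.

End MinorsAt.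

(** This identity and the next one show that an operator which is a derivation shifted by [s] on
    unknowns is the derivation shifted by [2 s] on quadrics. *)
Lemma shift_lin (A : comNzRingType) (c x y dx dy s : A) :
  c * (dx + s * x *+ 2) + (dy + s * y *+ 2) = c * dx + dy + s * (c * x + y) *+ 2.
Proof. by ring. Qed.

Lemma shift_mul (A : comNzRingType) (x y dx dy s : A) :
  (dx + s * x) * y + x * (dy + s * y) = dx * y + x * dy + s * (x * y) *+ 2.
Proof. by ring. Qed.

Section MinorMap.
Context (R : realType) (n : nat).
Local Notation PA := (ringPA R n).
Local Notation PS := (ringS R n).
Local Notation X := (@X R n).
Local Notation Sg := (Sigma R n).
Implicit Types (v w : unk n) (D K L M : {set 'I_n}) (i j k a b : 'I_n) (f : PA) (h : PS).

Lemma Sigma_le i j (ij : (i <= j)%N) :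
  Sg i j = 'X_(enum_rank (exist _ (i, j) ij : sidx n)).
Proof.
rewrite mxE; case: insubP => [x _ xE|]; last by rewrite ij.
by have -> : x = exist _ (i, j) ij by apply: val_inj.
Qed.

Lemma Sigma_sym : Sg^T = Sg.
Proof.
apply/matrixP => i j; rewrite mxE.
wlog ij : i j / (i < j)%N.
  by move=> H; case: (ltngtP i j) => [/H //|/H //|/val_inj -> //].
rewrite (Sigma_le (ltnW ij)) mxE; case: insubP => [x /=|_]; first by rewrite leqNgt ij.
case: insubP => [x _ xE|/=]; last by rewrite ltnW.
by have -> : x = exist _ (i, j) (ltnW ij) by apply: val_inj.
Qed.

Lemma Sigma_ind (P : 'I_n -> 'I_n -> PS -> Prop) :
  (forall i j (ij : (i <= j)%N), P i j 'X_(enum_rank (exist _ (i, j) ij : sidx n))) ->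
  (forall i j h, P i j h -> P j i h) -> forall i j, P i j (Sg i j).
Proof.
move=> PX Psym i j; case: (leqP i j) => [ij|/ltnW ji].
  by rewrite (Sigma_le ij).
by rewrite -Sigma_sym mxE (Sigma_le ji); apply/Psym/PX.
Qed.

Section SDerivation.
Variable c : sidx n -> PS.
Definition sderiv h : PS := \sum_x c x * mderiv (enum_rank x) h.
Lemma sderivD h h' : sderiv (h + h') = sderiv h + sderiv h'.
Proof. by rewrite -big_split; apply: eq_bigr => x _; rewrite mderivD mulrDr. Qed.

Lemma sderivM h h' : sderiv (h * h') = sderiv h * h' + h * sderiv h'.
Proof.
rewrite /sderiv mulr_suml mulr_sumr -big_split; apply: eq_bigr => x _ /=.
by rewrite mderivM mulrDr -mulrA [h * (_ * _)]mulrCA.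
Qed.

Lemma sderivX x : sderiv 'X_(enum_rank x) = c x.
Proof.
rewrite /sderiv (bigD1 x) //= big1 ?addr0 => [|y yx].
  by rewrite mderivX mnmE eqxx scale1r -{1}[U_(_)%MM]add0m addmK mpolyX0 mulr1.
rewrite mderivX mnmE (inj_eq enum_rank_inj) eq_sym (negPf yx).
by rewrite scale0r mulr0.
Qed.

End SDerivation.

Lemma minor_map_uvar D K : minor_map (uvar R D K) = mins Sg D K.
Proof.
rewrite /minor_map subst_uvar; apply: eq_at_sets => -[L|[[[i j] K'] /= /and3P[_ iK jK]]].
  by rewrite pm_mxsub.
by rewrite am_mxsub.
Qed.

Lemma minor_map_raising k f : f \is 2.-homog -> minor_map f = 0 ->
  minor_map (raising k f) = 0.
Proof.
(* The partial derivative with respect to [Sg k k]; raising at [k] is induced by translating this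
   diagonal entry. *)
pose d := sderiv (fun x => ((val x == (k, k)) %:R)).
have dS i j : d (Sg i j) = ((i == k) && (j == k))%:R.
  apply: (Sigma_ind (P := fun i j h => d h = ((i == k) && (j == k))%:R)).
    by move=> a b ab; rewrite /d sderivX /= xpair_eqE.
  by move=> a b h ->; rewrite andbC.
have dD h h' : d (h + h') = d h + d h' by apply: sderivD.
have dM h h' : d (h * h') = d h * h' + h * d h' by apply: sderivM.
have d0 : d 0 = 0 by apply: (derivation0 dD).
have dZ (c : R) h : d (c *: h) = c *: d h.
  rewrite -!mul_mpolyC dM [d c%:MP]big1 ?mul0r ?add0r // => x _.
  by rewrite mderivC mulr0.
have dE D K : d (mins Sg D K) = if (k \in K) && (k \notin D) then mins Sg D (K :\ k) else 0.
  by apply: (raising_mins Sigma_sym dD dM dS).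
have dX v : minor_map (raising k (X v)) = d (minor_map (X v)).
  rewrite -uvar_unk raising_uvar minor_map_uvar dE.
  by case: ifP => _; rewrite ?minor_map_uvar // /minor_map /subst rmorph0.
suff H : forall f, f \is 2.-homog -> minor_map (raising k f) = d (minor_map f).
  by move=> f2 f0; rewrite H // f0 d0.
apply: quad_ind => [|c f1 f2 E1 E2|v w].
- by rewrite linear0 /minor_map /subst rmorph0 d0.
- rewrite linearP /= /minor_map !substD !substZ -!/(minor_map _) E1 E2.
  by rewrite dD dZ.
rewrite raisingM /minor_map substD !substM -!/(minor_map _) !dX.
by rewrite dM.
Qed.

(** On quadrics, lowering corresponds to the derivation [d] plus multiplication by 2 [Sg k k]. Both
    parts send 0 to 0, which is what stability of the kernel requires. *)
Lemma minor_map_lowering k f : f \is 2.-homog -> minor_map f = 0 ->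
  minor_map (lowering k f) = 0.
Proof.
pose d := sderiv (fun x => - (Sg (val x).1 k * Sg k (val x).2)).
have symE i j : Sg i j = Sg j i by rewrite -[in LHS]Sigma_sym mxE.
have dS i j : d (Sg i j) = - (Sg i k * Sg k j).
  apply: (Sigma_ind (P := fun i j h => d h = - (Sg i k * Sg k j))).
    by move=> a b ab; rewrite /d sderivX.
  by move=> a b h ->; rewrite mulrC symE [Sg a k]symE.
have dD h h' : d (h + h') = d h + d h' by apply: sderivD.
have dM h h' : d (h * h') = d h * h' + h * d h' by apply: sderivM.
have d0 : d 0 = 0 by apply: (derivation0 dD).
have dZ (c : R) h : d (c *: h) = c *: d h.
  rewrite -!mul_mpolyC dM [d c%:MP]big1 ?mul0r ?add0r // => x _.
  by rewrite mderivC mulr0.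
have dE D K : d (mins Sg D K) + Sg k k * mins Sg D K = if k \in K then 0 else mins Sg D (k |: K).
  by apply: (lowering_mins Sigma_sym dD dM dS).
have dX v : minor_map (lowering k (X v)) = d (minor_map (X v)) + Sg k k * minor_map (X v).
  rewrite -uvar_unk lowering_uvar minor_map_uvar dE.
  by case: ifP => _; rewrite ?minor_map_uvar // /minor_map /subst rmorph0.
suff H : forall f, f \is 2.-homog ->
    minor_map (lowering k f) = d (minor_map f) + Sg k k * minor_map f *+ 2.
  by move=> f2 f0; rewrite H // f0 d0 mulr0 mul0rn addr0.
apply: quad_ind => [|c f1 f2 E1 E2|v w].
- by rewrite linear0 /minor_map /subst rmorph0 d0 mulr0 mul0rn addr0.
- rewrite linearP /= /minor_map !substD !substZ -!/(minor_map _) E1 E2.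
  by rewrite dD dZ -!mul_mpolyC; apply: shift_lin.
rewrite loweringM /minor_map substD !substM -!/(minor_map _) !dX dM.
exact: shift_mul.
Qed.

End MinorMap.

(** * Weight vectors built from alternating sums *)

Section WeightVectors.
Context (R : realType) (n : nat).
Local Notation PA := (ringPA R n).
Local Notation Q := (quadric R n).
Local Notation X := (@X R n).
Implicit Types (v : unk n) (D K L M Z O : {set 'I_n}) (i j k a b l : 'I_n) (f g : PA) (q : Q).
Implicit Types (w : 'I_n -> nat).

(** The zero quadric is included, so that the condition is closed under linear combinations;
    nonvanishing is a matter of freeness later on. *)
Definition wt_vec w f : Prop :=
  [/\ f \is 2.-homog, forall k, poly_string k (w k) f
    & forall t : 'I_n -> R, (forall k, t k != 0) ->
        sl_act (torus t) f = (\prod_k t k ^+ w k) *: f].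

Lemma wt_vec_lin w c f g : wt_vec w f -> wt_vec w g -> wt_vec w (c *: f + g).
Proof.
case=> f1 f2 f3 [g1 g2 g3]; split.
- by rewrite rpredD ?rpredZ.
- by move=> k; apply: poly_string_lin.
- by move=> t t0; rewrite sl_act_lin f3 // g3 // scalerDr !scalerA mulrC.
Qed.

Lemma wt_vec0 w : wt_vec w 0.
Proof.
split=> [|k|t _]; [exact: rpred0|exact: poly_string0|].
by rewrite scaler0 /sl_act /subst rmorph0.
Qed.

Lemma wt_vecD w f g : wt_vec w f -> wt_vec w g -> wt_vec w (f + g).
Proof. by move=> hf; rewrite -[f]scale1r; apply: wt_vec_lin. Qed.

Lemma wt_vecZ w c f : wt_vec w f -> wt_vec w (c *: f).
Proof. by move=> hf; rewrite -[c *: f]addr0; apply: wt_vec_lin hf (wt_vec0 w). Qed.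

Lemma wt_vec_sum w (I : Type) (r : seq I) (P : pred I) (F : I -> PA) :
  (forall x, P x -> wt_vec w (F x)) -> wt_vec w (\sum_(x <- r | P x) F x).
Proof.
move=> h; elim/big_rec: _ => [|x f Px]; first exact: wt_vec0.
exact/wt_vecD/(h _ Px).
Qed.

Lemma eq_wt_vec w w' f : w =1 w' -> wt_vec w f -> wt_vec w' f.
Proof.
move=> ww [h1 h2 h3]; split=> // [k|t t0]; first by rewrite -ww.
by rewrite h3 //; congr (_ *: _); apply: eq_bigr => k _; rewrite ww.
Qed.

Definition TT D D' M : PA := alt_sum (uvar R D) (uvar R D') M.

Definition TT_wt D D' M k : nat :=
  if k \in M then 0 else ((k \notin D) + (k \notin D'))%N.

Lemma sign_scale c f : (-1) ^+ c * f = ((-1) ^+ c : R) *: f.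
Proof. by rewrite -signr_odd -[in RHS]signr_odd; case: (odd c); rewrite ?scaleN1r ?mulN1r ?scale1r ?mul1r. Qed.

Lemma uvar_pair k D K : k \notin D -> k \notin K ->
  pair_at (raising k) (lowering k) (uvar R D K) (uvar R D (k |: K)).
Proof.
move=> kD kK; split; rewrite ?raising_uvar ?lowering_uvar ?(negPf kK) ?kD // !inE eqxx //=.
by rewrite setU1K.
Qed.

Lemma uvar_trivial k D K : k \in D -> k \notin K ->
  trivial_at (raising k) (lowering k) (uvar R D K).
Proof.
move=> kD kK; split; rewrite ?raising_uvar ?lowering_uvar ?(negPf kK) //.
by rewrite uvar0 // is_unkU1 kD.
Qed.

Let opsD k : [/\ forall f g, raising k (f + g) = raising k f + raising k g,
   forall f g, lowering k (f + g) = lowering k f + lowering k g,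
   forall f g, raising k (f * g) = raising k f * g + f * raising k g
   & forall f g, lowering k (f * g) = lowering k f * g + f * lowering k g].
Proof. by split=> f g; [apply: leibnizD|apply: leibnizD|apply: leibnizM|apply: leibnizM]. Qed.

(** For [k] in [M], pairing the summands of K and [k |: K] gives alternating tensors, which are
    invariant. For other [k], each factor contributes weight 0 or 1 according to whether [k] is a
    lower left index. *)
Lemma TT_string k D D' M : [disjoint D & M] -> [disjoint D' & M] ->
  poly_string k (TT_wt D D' M k) (TT D D' M).
Proof.
move=> dD dD'; have [rD lD rM lM] := opsD k; rewrite /TT_wt; case: ifPn => kM.
  have kD : k \notin D by apply: contraL dD => kD; apply/pred0Pn; exists k; rewrite /= kD.
  have kD' : k \notin D' by apply: contraL dD' => kD'; apply/pred0Pn; exists k; rewrite /= kD'.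
  apply: poly_string_intro => //.
  rewrite /TT (alt_sum_split _ _ kM) -sumrB /=.
  suff [E1 E2] : raising k (\sum_(K : {set 'I_n} | K \subset M :\ k)
     ((-1) ^+ #|K| * uvar R D K * uvar R D' (k |: (M :\ k) :\: K)
       - (-1) ^+ #|K| * uvar R D (k |: K) * uvar R D' ((M :\ k) :\: K))) = 0
   /\ lowering k (\sum_(K : {set 'I_n} | K \subset M :\ k)
     ((-1) ^+ #|K| * uvar R D K * uvar R D' (k |: (M :\ k) :\: K)
       - (-1) ^+ #|K| * uvar R D (k |: K) * uvar R D' ((M :\ k) :\: K))) = 0.
    by split.
  split; rewrite linear_sum big1 //= => K; rewrite subsetD1 => /andP[KM kK].
    have kMK : k \notin (M :\ k) :\: K by rewrite !inE eqxx andbF.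
    have [r1 _ r2 _] := uvar_pair kD kK; have [r1' _ r2' _] := uvar_pair kD' kMK.
    rewrite -!mulrA !sign_scale linearB !linearZ /= !rM r1 r2 r1' r2'.
    by rewrite mul0r add0r mulr0 addr0 scalerN subrr.
  have kMK : k \notin (M :\ k) :\: K by rewrite !inE eqxx andbF.
  have [_ l1 _ l2] := uvar_pair kD kK; have [_ l1' _ l2'] := uvar_pair kD' kMK.
  rewrite -!mulrA !sign_scale linearB !linearZ /= !lM l1 l2 l1' l2'.
  by rewrite mul0r add0r mulr0 addr0 scalerN subrr.
apply: poly_string_sum => K KM; rewrite -mulrA sign_scale; apply: poly_stringZ.
have kK : k \notin K by apply: contra kM; apply: subsetP KM k.
have kMK : k \notin M :\: K by rewrite !inE (negPf kM) andbF.
apply: poly_string_intro; first by case: (k \in D); case: (k \in D').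
case: (boolP (k \in D)) => kD; case: (boolP (k \in D')) => kD' /=.
- exact: (string_tt rM lM (uvar_trivial kD kK) (uvar_trivial kD' kMK)).
- exact: (string_te rD lD rM lM (uvar_trivial kD kK) (uvar_pair kD' kMK)).
- by rewrite mulrC; exact: (string_te rD lD rM lM (uvar_trivial kD' kMK) (uvar_pair kD kK)).
- exact: (string_ee rD lD rM lM (uvar_pair kD kK) (uvar_pair kD' kMK)).
Qed.

Lemma sl_act_torus t D K : sl_act (torus t) (uvar R D K) =
  (\prod_(k | k \notin D) (if k \in K then (t k)^-1 else t k)) *: uvar R D K.
Proof.
have [uDK|nu] := boolP (is_unk D K); last first.
  by rewrite uvar0 // scaler0 /sl_act /subst rmorph0.
have KD : K \subset ~: D by have /andP[_] := uDK; rewrite disjoint_sym disjoints_subset.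
rewrite sl_act_uvar // (bigD1 K) //= big1 ?addr0 => [|K' /andP[K'D K'K]].
  congr (_ *: _); apply: eq_bigr => k _; rewrite mxE eqxx /=.
  by case: (k \in K).
have [k kK] : exists k, (k \in K') != (k \in K).
  apply/existsP; apply: contraNT K'K => /existsPn E; apply/eqP/setP => k.
  by have /negPn/eqP := E k.
have kD : k \notin D.
  case kK1 : (k \in K'); first by have := subsetP K'D k kK1; rewrite inE.
  case kK2 : (k \in K); first by have := subsetP KD k kK2; rewrite inE.
  by rewrite kK1 kK2 in kK.
rewrite /sl_coeff (bigD1 k) //= mxE.
by move: kK; case: (k \in K'); case: (k \in K) => //= _; rewrite mul0r scale0r.
Qed.

Lemma TT_wt_vec D D' M : [disjoint D & M] -> [disjoint D' & M] ->
  wt_vec (TT_wt D D' M) (TT D D' M).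
Proof.
move=> dD dD'; split; last 1 first.
- move=> t t0; rewrite /TT /alt_sum sl_act_sum scaler_sumr; apply: eq_bigr => K KM.
  rewrite -mulrA sign_scale -[sl_act _ _]addr0 /sl_act substZ addr0 -/(sl_act _ _) sl_actM.
  rewrite !sl_act_torus -scalerAl -scalerAr !scalerA; congr (_ *: _).
  rewrite -mulrA mulrC; congr (_ * _).
  rewrite big_mkcond [X in _ * X]big_mkcond -big_split; apply: eq_bigr => k _ /=.
  rewrite /TT_wt !inE; have [kM|kM] := boolP (k \in M).
    have -> : k \notin D by apply: contraL dD => kD; apply/pred0Pn; exists k; rewrite /= kD.
    have -> : k \notin D' by apply: contraL dD' => kD'; apply/pred0Pn; exists k; rewrite /= kD'.
    by case: (k \in K); rewrite /= ?mulVf ?mulfV.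
  rewrite andbF; have -> : (k \in K) = false by apply: contraNF kM; apply: subsetP KM k.
  by case: (k \notin D); case: (k \notin D'); rewrite /= ?mulr1 ?mul1r ?expr2.
- by apply: rpred_sum => K _; rewrite -mulrA sign_scale rpredZ // mul_uvar_homog.
- by move=> k; apply: TT_string.
Qed.

Definition type_wt Z O k : nat := if k \in Z then 0 else if k \in O then 1 else 2.

(* Classes (ii) and (iii), with (a, b, M) in place of (1, 2, [m] \ {1, 2}). *)
Definition G23 M a b : PA :=
  (if odd #|M| then TT set0 [set a; b] M else 0)
  + \sum_(l in M) TT [set a; l] [set b; l] (M :\ l).

(* Class (iv), and class (i) if M is a singleton, with (i, M) in place of
   (1, [m] \ {1}). *)
Definition G4 i M : PA :=
  alt_sum (uvar R set0) (fun K => uvar R set0 (i |: K)) M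
  + \sum_(l in M) TT [set i; l] [set i; l] (M :\ l).

Lemma disjoint2 a b M : a \notin M -> b \notin M -> [disjoint [set a; b] & M].
Proof. by move=> aM bM; rewrite disjoints_subset subUset !sub1set !inE aM bM. Qed.

Lemma disjoint_set0 M : [disjoint set0 & M].
Proof. by rewrite disjoint_sym disjoints_subset setC0 subsetT. Qed.

Lemma notinD1 l M : l \notin M :\ l. Proof. by rewrite !inE eqxx. Qed.

Lemma notinD a l M : a \notin M -> a \notin M :\ l. Proof. by rewrite !inE => /negPf->; rewrite andbF. Qed.

Lemma G23_wt_vec M a b : a != b -> a \notin M -> b \notin M ->
  wt_vec (type_wt M [set a; b]) (G23 M a b).
Proof.
move=> ab aM bM; apply: wt_vecD.
  case: ifP => _; last exact: wt_vec0.
  apply: eq_wt_vec (TT_wt_vec (disjoint_set0 M) (disjoint2 aM bM)) => k.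
  by rewrite /TT_wt /type_wt !inE; case: (k \in M); case: ((k == a) || (k == b)).
apply: wt_vec_sum => l lM.
apply: eq_wt_vec (TT_wt_vec (disjoint2 (notinD _ aM) (notinD1 l M))
   (disjoint2 (notinD _ bM) (notinD1 l M))) => k.
rewrite /TT_wt /type_wt !inE; have [->|kl] /= := eqVneq k l; first by rewrite !orbT lM.
rewrite !orbF; case: (boolP (k \in M)) => //= _.
by case: (eqVneq k a) => [->|_]; rewrite ?(negPf ab) //=; case: (k == b).
Qed.

(** In [G4] a partition of [i |: M] is represented by the part that avoids [i], whereas [TT] counts
    it twice, with equal signs because [i |: M] has even cardinality. *)
Lemma G4E i M : i \notin M -> odd #|M| ->
  G4 i M = 2^-1 *: TT set0 set0 (i |: M) + \sum_(l in M) TT [set i; l] [set i; l] (M :\ l).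
Proof.
move=> iM oM; congr (_ + _); rewrite /TT (alt_sum_split _ _ (setU11 i M)) setU1K //.
rewrite [X in _ - X]alt_sumC -signr_odd oM expr1 mulN1r opprK -mulr2n -scaler_nat.
by rewrite scalerA mulVf ?scale1r // pnatr_eq0.
Qed.

Lemma G4_wt_vec i M : i \notin M -> odd #|M| -> wt_vec (type_wt (i |: M) set0) (G4 i M).
Proof.
move=> iM oM; rewrite G4E //; apply: wt_vecD.
  apply/wt_vecZ; apply: eq_wt_vec (TT_wt_vec (disjoint_set0 _) (disjoint_set0 _)) => k.
  by rewrite /TT_wt /type_wt !inE.
apply: wt_vec_sum => l lM.
apply: eq_wt_vec (TT_wt_vec (disjoint2 (notinD _ iM) (notinD1 l M))
   (disjoint2 (notinD _ iM) (notinD1 l M))) => k.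
rewrite /TT_wt /type_wt !inE; have [->|kl] /= := eqVneq k l; first by rewrite lM !orbT.
by rewrite !orbF; case: (k == i); case: (k \in M).
Qed.

Lemma minor_map_alt_sum (F G : {set 'I_n} -> PA) M : minor_map (alt_sum F G M) =
  alt_sum (fun K => minor_map (F K)) (fun K => minor_map (G K)) M.
Proof.
rewrite /alt_sum /minor_map subst_sum; apply: eq_bigr => K _.
by rewrite !substM; congr (_ * _ * _); rewrite /subst rmorph_sign.
Qed.

Lemma minor_map_TT D D' M :
  minor_map (TT D D' M) = alt_sum (mins (Sigma R n) D) (mins (Sigma R n) D') M.
Proof.
by rewrite minor_map_alt_sum; apply: eq_alt_sum => K _; rewrite minor_map_uvar.
Qed.

Let reg2 (x : ringS R n) : x *+ 2 = 0 -> x = 0.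
Proof. by rewrite -scaler_nat => /eqP; rewrite scaler_eq0 pnatr_eq0 => /eqP. Qed.

Lemma minor_map_G23 M a b : a != b -> a \notin M -> b \notin M -> minor_map (G23 M a b) = 0.
Proof.
move=> ab aM bM; rewrite -[RHS](mins_relation (Sigma_sym R n) reg2 ab aM bM).
rewrite /minor_map substD subst_sum -!/(minor_map _); congr (_ + _).
  by case: ifP => _; rewrite ?minor_map_TT // /minor_map /subst rmorph0.
by apply: eq_bigr => l _; rewrite -/(minor_map _) minor_map_TT.
Qed.

Lemma minor_map_G4 i M : i \notin M -> odd #|M| -> minor_map (G4 i M) = 0.
Proof.
move=> iM oM; rewrite -[RHS](mins_principal_relation (Sigma_sym R n) reg2 iM oM).
rewrite /minor_map substD subst_sum -!/(minor_map _); congr (_ + _).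
  by rewrite minor_map_alt_sum; apply: eq_alt_sum => K _; rewrite minor_map_uvar.
by apply: eq_bigr => l _; rewrite -/(minor_map _) minor_map_TT.
Qed.

Lemma imset_permD (s : 'S_n) M K : s @: (M :\: K) = s @: M :\: s @: K.
Proof.
apply/setP => y; rewrite -(permKV s y) !inE !mem_imset ?inE //; exact: perm_inj.
Qed.

Lemma perm_act_alt_sum (s : 'S_n) (F G F' G' : {set 'I_n} -> PA) M :
  (forall K, perm_act s (F K) = F' (s @: K)) -> (forall K, perm_act s (G K) = G' (s @: K)) ->
  perm_act s (alt_sum F G M) = alt_sum F' G' (s @: M).
Proof.
move=> hF hG; have inj := @perm_inj _ s.
rewrite /alt_sum /perm_act subst_sum [RHS](reindex_onto (fun K : {set 'I_n} => s @: K) (fun K : {set 'I_n} => s^-1%g @: K)) /=.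
  apply: eq_big => [K|K _].
    rewrite -imset_comp (eq_imset (g := id)) ?imset_id ?eqxx ?andbT => [|x]; last by rewrite /= permK.
    by apply/idP/idP => [/(imsetS s)//|/subsetP h]; apply/subsetP => x xK;
       have /imsetP[y yM /inj ->] := h _ (imset_f s xK).
  rewrite !substM card_imset // -!/(perm_act s _) hF hG; congr (_ * _ * G' _).
    by rewrite /perm_act /subst rmorph_sign.
  by rewrite imset_permD.
by move=> K _; rewrite -imset_comp (eq_imset (g := id)) ?imset_id => [//|x]; rewrite /= permKV.
Qed.

Lemma perm_act_TT (s : 'S_n) D D' M : perm_act s (TT D D' M) = TT (s @: D) (s @: D') (s @: M).
Proof. by apply: perm_act_alt_sum => K; apply: perm_act_uvar. Qed.

Lemma perm_act_G23 (s : 'S_n) M a b : perm_act s (G23 M a b) = G23 (s @: M) (s a) (s b).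
Proof.
have inj := @perm_inj _ s.
rewrite /G23 /perm_act substD subst_sum -!/(perm_act s _) card_imset //; congr (_ + _).
  case: ifP => _; last by rewrite /perm_act /subst rmorph0.
  by rewrite perm_act_TT imset0 imsetU1 imset_set1.
rewrite [RHS]big_imset /=; last by move=> x y _ _; apply: inj.
apply: eq_bigr => l lM; rewrite -/(perm_act s _) perm_act_TT !imsetU1 !imset_set1.
by rewrite imset_permD imset_set1.
Qed.

Lemma perm_act_G4 (s : 'S_n) i M : perm_act s (G4 i M) = G4 (s i) (s @: M).
Proof.
have inj := @perm_inj _ s.
rewrite /G4 /perm_act substD subst_sum -!/(perm_act s _); congr (_ + _).
  apply: (perm_act_alt_sum (F' := uvar R set0) (G' := fun K => uvar R set0 (s i |: K))) => K;
  by rewrite perm_act_uvar imset0 // imsetU1.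
rewrite [RHS]big_imset /=; last by move=> x y _ _; apply: inj.
apply: eq_bigr => l lM; rewrite -/(perm_act s _) perm_act_TT !imsetU1 !imset_set1.
by rewrite imset_permD imset_set1.
Qed.

(** The reason why the listed quadrics are distinct only up to sign. *)
Lemma G23_sym M a b : G23 M b a = (if odd #|M| then 1 else -1) *: G23 M a b.
Proof.
rewrite /G23 [ [set b; a] ]setUC scalerDr; congr (_ + _).
  by case: ifP => _; rewrite ?scale1r ?scaler0.
rewrite scaler_sumr; apply: eq_bigr => l lM.
have oM : odd #|M| = ~~ odd #|M :\ l| by rewrite (cardsD1 l M) lM.
by rewrite /TT alt_sumC sign_scale -signr_odd oM; case: (odd _).
Qed.

End WeightVectors.

(** * Coefficients of highest weight quadrics *)

Section Coefficients.
Context (R : realType) (n : nat).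
Local Notation PA := (ringPA R n).
Local Notation Q := (quadric R n).
Local Notation X := (@X R n).
Local Notation TT := (TT R).
Implicit Types (v w : unk n) (D K L M Z O : {set 'I_n}) (i j k a b l : 'I_n) (f g : PA) (q : Q).

Lemma eq_unk v D K w : lidx w = D -> ridx w = K ->
  (v == w) = (lidx v == D) && (ridx v == K).
Proof.
move=> <- <-; apply/eqP/andP => [->|[/eqP E1 /eqP E2]]; first by [].
exact: unk_inj.
Qed.

Lemma bcoef_uvar v w D K D' K' : bcoef v w (uvar R D K * uvar R D' K') =
  2^-1 * ([&& lidx v == D, ridx v == K, lidx w == D' & ridx w == K']
        + [&& lidx v == D', ridx v == K', lidx w == D & ridx w == K])%:R.
Proof.
have nE x D0 K0 : ~~ is_unk D0 K0 -> (lidx x == D0) && (ridx x == K0) = false.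
  by move=> nu; apply: contraNF nu => /andP[/eqP <- /eqP <-]; apply: is_unk_lr.
have [/is_unkP[a [aD aK]]|nu] := boolP (is_unk D K); last first.
  rewrite uvar0 // mul0r linear0 andbA nE // [ [&& lidx w == D & _]]nE //=.
  by rewrite !andbF mulr0.
have [/is_unkP[b [bD bK]]|nu] := boolP (is_unk D' K'); last first.
  rewrite [uvar R D' K']uvar0 // mulr0 linear0 nE // !andbF.
  by rewrite andbA nE // mulr0.
rewrite -{1}aD -{1}aK -{1}bD -{1}bK !uvar_unk bcoefXX.
by rewrite (eq_unk v aD aK) (eq_unk w aD aK) (eq_unk v bD bK) (eq_unk w bD bK) -!andbA.
Qed.

(** As [ridx v] is empty, [v] can only be the first factor of the summand K = set0 or the second
    factor of the summand K = M, whence the two terms and the sign. *)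
Lemma bcoef_TT v w D D' M : ridx v = set0 -> bcoef v w (TT D D' M) =
  2^-1 * ([&& lidx v == D, lidx w == D' & ridx w == M]%:R
    + (-1) ^+ #|M| * [&& lidx v == D', lidx w == D & ridx w == M]%:R).
Proof.
move=> v0; rewrite /TT /alt_sum linear_sum /=.
rewrite (eq_bigr (fun K : {set 'I_n} =>
  2^-1 * ((K == set0) && [&& lidx v == D, lidx w == D' & ridx w == M])%:R
  + 2^-1 * ((-1) ^+ #|M| * ((K == M) && [&& lidx v == D', lidx w == D & ridx w == M])%:R))); last first.
  move=> K KM; rewrite -mulrA sign_scale linearZ /= bcoef_uvar v0 natrD mulrCA -mulrDr; congr (_ * _).
  rewrite mulrDr; congr (_ + _).
    rewrite [set0 == K]eq_sym; have [->|_] := eqVneq K set0; last by rewrite andbF mulr0.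
    by rewrite cards0 expr0 mul1r setD0.
  have -> : (set0 == M :\: K) = (K == M).
    by rewrite eq_sym setD_eq0 eqEsubset KM.
  have [->|_] := eqVneq K M; first by [].
  by rewrite andbF mulr0 mulr0.
rewrite big_split mulrDr /=; congr (_ + _).
  rewrite (bigD1 set0) ?sub0set //= eqxx big1 ?addr0 // => K /andP[_ /negPf ->].
  by rewrite mulr0.
rewrite (bigD1 M) //= eqxx big1 ?addr0 // => K /andP[_ /negPf ->].
by rewrite !mulr0.
Qed.

Definition unk_wt k v : int := if k \in lidx v then 0 else if k \in ridx v then -1 else 1.

Lemma raising_lowering_uvar k D K : is_unk D K ->
  raising k (lowering k (uvar R D K)) - lowering k (raising k (uvar R D K))
  = (if k \in D then 0 else if k \in K then -1 else 1) *: uvar R D K.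
Proof.
move=> uDK; rewrite lowering_uvar raising_uvar; case: (boolP (k \in D)) => kD /=.
  rewrite andbF scale0r [lowering k 0]linear0 subr0; case: ifP => _; first by rewrite linear0.
  by rewrite uvar0 ?linear0 // is_unkU1 kD.
rewrite andbT; case: ifP => kK.
  by rewrite linear0 lowering_uvar !inE eqxx /= setD1K // sub0r scaleN1r.
by rewrite raising_uvar !inE eqxx kD /= linear0 subr0 setU1K ?kK // scale1r.
Qed.

(** The commutator of raising and lowering multiplies a product of unknowns by its weight at [k].
    This reads off weights from the string relations without the torus. *)
Lemma bcoef_weight k v w f : f \is 2.-homog ->
  bcoef v w (raising k (lowering k f) - lowering k (raising k f))
  = (unk_wt k v + unk_wt k w)%:~R * bcoef v w f.
Proof.
move: f; apply: quad_ind => [|c f g Ef Eg|a b].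
- have r0 : raising k (0 : PA) = 0 by exact: linear0.
  have l0 : lowering k (0 : PA) = 0 by exact: linear0.
  by rewrite l0 r0 l0 subrr linear0 mulr0.
- have rP (c' : R) (f' g' : PA) : raising k (c' *: f' + g') = c' *: raising k f' + raising k g'.
    exact: linearP.
  have lP (c' : R) (f' g' : PA) : lowering k (c' *: f' + g') = c' *: lowering k f' + lowering k g'.
    exact: linearP.
  rewrite lP rP rP lP opprD addrACA -scalerBr !linearP /= Ef Eg mulrDr.
  by rewrite mulrCA.
have rD (f g : PA) : raising k (f + g) = raising k f + raising k g by exact: linearD.
have lD (f g : PA) : lowering k (f + g) = lowering k f + lowering k g by exact: linearD.
rewrite raisingM loweringM rD lD !(raisingM, loweringM).
have hX x : raising k (lowering k (X x)) = lowering k (raising k (X x)) + (unk_wt k x)%:~R *: X x.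
  apply/eqP; rewrite addrC -subr_eq; apply/eqP; rewrite -uvar_unk.
  rewrite raising_lowering_uvar ?is_unk_lr // /unk_wt; congr (_ *: _).
  by case: ifP => // _; case: ifP.
rewrite !hX; set f := (f in bcoef v w f).
have -> : f = (unk_wt k a + unk_wt k b)%:~R *: (X a * X b).
  by rewrite /f -!mul_mpolyC intrD mpolyCD; ring.
rewrite linearZ /= bcoefXX.
rewrite natrD !mulrDr; congr (_ + _).
  by case: (eqVneq v a) => [->|_]; case: (eqVneq w b) => [->|_]; rewrite ?mulr0.
case: (eqVneq v b) => [->|_]; case: (eqVneq w a) => [->|_]; rewrite ?mulr0 //.
by rewrite [unk_wt k a + _]addrC.
Qed.

Definition bc D K D' K' f : R :=
  \sum_(v | (lidx v == D) && (ridx v == K)) \sum_(w | (lidx w == D') && (ridx w == K'))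
    bcoef v w f.

Lemma bc_unk v w f : bc (lidx v) (ridx v) (lidx w) (ridx w) f = bcoef v w f.
Proof.
rewrite /bc (big_pred1 v) => [|x]; last by rewrite /= (eq_unk x erefl erefl).
by rewrite (big_pred1 w) => [//|x]; rewrite /= (eq_unk x erefl erefl).
Qed.

Lemma bc_eq0 D K D' K' f : ~~ (is_unk D K && is_unk D' K') -> bc D K D' K' f = 0.
Proof.
rewrite negb_and => /orP[] nu; rewrite /bc big1 // => v /andP[/eqP E1 /eqP E2].
  by case/negP: nu; rewrite -E1 -E2 is_unk_lr.
by rewrite big1 // => w /andP[/eqP E3 /eqP E4]; case/negP: nu; rewrite -E3 -E4 is_unk_lr.
Qed.

Lemma bc_lin D K D' K' c f g : bc D K D' K' (c *: f + g) = c * bc D K D' K' f + bc D K D' K' g.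
Proof.
rewrite /bc mulr_sumr -big_split; apply: eq_bigr => v _ /=.
by rewrite mulr_sumr -big_split; apply: eq_bigr => w _ /=; rewrite linearP.
Qed.

Lemma bc_uvar D K D' K' D1 K1 D2 K2 : is_unk D K -> is_unk D' K' ->
  bc D K D' K' (uvar R D1 K1 * uvar R D2 K2) =
  2^-1 * ([&& D == D1, K == K1, D' == D2 & K' == K2]
        + [&& D == D2, K == K2, D' == D1 & K' == K1])%:R.
Proof. by move=> /is_unkP[v [<- <-]] /is_unkP[w [<- <-]]; rewrite bc_unk bcoef_uvar. Qed.

Lemma bc_XX D K D' K' (a b : unk n) : bc D K D' K' (X a * X b) =
  2^-1 * ([&& D == lidx a, K == ridx a, D' == lidx b & K' == ridx b]
        + [&& D == lidx b, K == ridx b, D' == lidx a & K' == ridx a])%:R.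
Proof.
have [/andP[u1 u2]|nu] := boolP (is_unk D K && is_unk D' K').
  by rewrite -!uvar_unk bc_uvar.
rewrite bc_eq0 // -[LHS](mulr0 2^-1) -(mulr0n 1); congr (_ * _%:R).
apply/esym/eqP; rewrite addn_eq0 !eqb0; apply/andP; split; apply: contra nu.
  by case/and4P => /eqP-> /eqP-> /eqP-> /eqP->; rewrite !is_unk_lr.
by case/and4P => /eqP-> /eqP-> /eqP-> /eqP->; rewrite !is_unk_lr.
Qed.

Lemma bc_raising k D K D' K' f : is_unk D K -> is_unk D' K' -> f \is 2.-homog ->
  bc D K D' K' (raising k f) =
  (if k \in K then 0 else bc D (k |: K) D' K' f)
  + (if k \in K' then 0 else bc D K D' (k |: K') f).
Proof.
move=> u1 u2; move: f; apply: quad_ind => [|c f g Ef Eg|a b].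
- have z D1 K1 D2 K2 : bc D1 K1 D2 K2 0 = 0.
    by rewrite /bc big1 // => v _; rewrite big1 // => w _; rewrite linear0.
  by rewrite linear0 !z !if_same addr0.
- rewrite linearP /= !bc_lin Ef Eg; case: ifP => _; case: ifP => _; ring.
have bcD f g : bc D K D' K' (f + g) = bc D K D' K' f + bc D K D' K' g.
  by rewrite -[f]scale1r bc_lin mul1r scale1r.
have bc0 : bc D K D' K' (0 : PA) = 0.
  by rewrite /bc big1 // => v _; rewrite big1 // => w _; rewrite linear0.
have key (L L' : {set 'I_n}) : (k \in L') && (L == L' :\ k) = (k \notin L) && (k |: L == L').
  apply/andP/andP => [[kL' /eqP->]|[kL /eqP<-]].
    by rewrite setD1K // !inE !eqxx.
  by rewrite setU11 setU1K.
rewrite raisingM !raisingX bcD !bc_XX.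
have E1 : bc D K D' K' ((if k \in ridx a then uvar R (lidx a) (ridx a :\ k) else 0) * X b)
   = 2^-1 * ([&& D == lidx a, (k \notin K) && (k |: K == ridx a), D' == lidx b & K' == ridx b]
        + [&& D == lidx b, K == ridx b, D' == lidx a & (k \notin K') && (k |: K' == ridx a)])%:R.
  rewrite -!key; case: ifP => ka; last by rewrite mul0r bc0 !andbF mulr0.
  by rewrite -uvar_unk bc_uvar.
have E2 : bc D K D' K' (X a * (if k \in ridx b then uvar R (lidx b) (ridx b :\ k) else 0))
   = 2^-1 * ([&& D == lidx a, K == ridx a, D' == lidx b & (k \notin K') && (k |: K' == ridx b)]
        + [&& D == lidx b, (k \notin K) && (k |: K == ridx b), D' == lidx a & K' == ridx a])%:R.
  rewrite -!key; case: ifP => kb; last by rewrite mulr0 bc0 !andbF mulr0.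
  by rewrite -uvar_unk bc_uvar.
rewrite E1 E2; case: (boolP (k \in K)) => kK; case: (boolP (k \in K')) => kK' /=;
by rewrite ?andbF /= ?addr0 ?add0r ?mulr0 ?natrD; ring.
Qed.

Lemma bc_weight k D K D' K' f : f \is 2.-homog ->
  bc D K D' K' (raising k (lowering k f) - lowering k (raising k f))
  = ((if k \in D then 0 else if k \in K then -1 else 1)
     + (if k \in D' then 0 else if k \in K' then -1 else 1) : int)%:~R * bc D K D' K' f.
Proof.
move=> f2; have [/andP[/is_unkP[v [<- <-]] /is_unkP[w [<- <-]]]|nu] :=
  boolP (is_unk D K && is_unk D' K'); last by rewrite !bc_eq0 // mulr0.
by rewrite !bc_unk bcoef_weight.
Qed.

Lemma quad_bcE f : f \is 2.-homog -> f =
  \sum_D \sum_K \sum_D' \sum_K' bc D K D' K' f *: (uvar R D K * uvar R D' K').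
Proof.
move=> f2; rewrite {1}(quadE f2).
have part (F : unk n -> PA) : \sum_v F v = \sum_D \sum_K \sum_(v | (lidx v == D) && (ridx v == K)) F v.
  rewrite (partition_big (@lidx n) xpredT) //=; apply: eq_bigr => D _.
  by rewrite (partition_big (@ridx n) xpredT).
rewrite part; apply: eq_bigr => D _; apply: eq_bigr => K _.
have [uDK|nu] := boolP (is_unk D K); last first.
  rewrite big1 => [|v /andP[/eqP E1 /eqP E2]]; last by case/negP: nu; rewrite -E1 -E2 is_unk_lr.
  rewrite big1 // => D' _; rewrite big1 // => K' _; by rewrite uvar0 // mul0r scaler0.
have /is_unkP[v [vD vK]] := uDK.
rewrite (big_pred1 v) => [|x]; last by rewrite /= (eq_unk x vD vK).
rewrite part; apply: eq_bigr => D' _; apply: eq_bigr => K' _.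
have [uDK'|nu] := boolP (is_unk D' K'); last first.
  rewrite big1 => [|w /andP[/eqP E1 /eqP E2]]; last by case/negP: nu; rewrite -E1 -E2 is_unk_lr.
  by rewrite [uvar R D' K']uvar0 // mulr0 scaler0.
have /is_unkP[w [wD wK]] := uDK'.
rewrite (big_pred1 w) => [|x]; last by rewrite /= (eq_unk x wD wK).
by rewrite -vD -vK -wD -wK bc_unk !uvar_unk.
Qed.

End Coefficients.

Section HighestExpansion.
Context (R : realType) (n : nat).
Local Notation PA := (ringPA R n).
Implicit Types (D K L M Z O : {set 'I_n}) (i j k a b l : 'I_n).

Definition sdiff D O : {set 'I_n} := (D :\: O) :|: (O :\: D).

Lemma in_sdiff D O k : (k \in sdiff D O) = ((k \in D) != (k \in O)).
Proof. by rewrite !inE; case: (k \in D); case: (k \in O). Qed.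

Variables (lam : 'I_n -> nat) (f : PA).
Hypotheses (lam2 : forall k, (lam k <= 2)%N) (f2 : f \is 2.-homog)
  (hf : forall k, poly_string k (lam k) f).

Let Z := [set k | lam k == 0%N].
Let O := [set k | lam k == 1%N].

(** The weights of the two factors at each index must add up to [lam k]: weight 2 excludes [k] from
    all four sets, weight 1 puts it in exactly one of D, D' and in neither K nor K', and weight 0
    puts it in both D and D' or in exactly one of K, K'. *)
Lemma highest_support D K D' K' : bc D K D' K' f != 0 ->
  [/\ D' = sdiff D O, K \subset Z :\: D, K' = (Z :\: D) :\: K & D \subset Z :|: O].
Proof.
move=> nz; have /andP[u1 u2] : is_unk D K && is_unk D' K'.
  by apply: contraNT nz => nu; rewrite bc_eq0.
(* Raising kills [f], so the commutator acts on it by the scalar of the string relation at [b = 0],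
   which is [lam k]. *)
have wt k : ((if k \in D then 0 else if k \in K then -1 else 1)
     + (if k \in D' then 0 else if k \in K' then -1 else 1) = (lam k)%:Z)%R.
  have := bc_weight k D K D' K' f2; have [r0 _ /(_ 0%N) /= ->] := hf k.
  rewrite r0 linear0 subr0 mul1n subn0 -[X in bc _ _ _ _ X]addr0 bc_lin.
  have -> : bc D K D' K' (0 : PA) = 0.
    by rewrite /bc big1 // => v _; rewrite big1 // => w _; rewrite linear0.
  by rewrite addr0 => /(mulIf nz) /eqP; rewrite pmulrn eqr_int => /eqP ->.
have dDK k : ~~ ((k \in D) && (k \in K)).
  by have /andP[_ /pred0P/(_ k)] := u1; rewrite /= => ->.
have dDK' k : ~~ ((k \in D') && (k \in K')).
  by have /andP[_ /pred0P/(_ k)] := u2; rewrite /= => ->.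
split.
- apply/setP => k; rewrite in_sdiff inE; move: (wt k) (dDK k) (dDK' k).
  by case: (k \in D); case: (k \in K); case: (k \in D'); case: (k \in K') => //=;
     case: (lam k) (lam2 k) => [|[|[|]]].
- apply/subsetP => k; rewrite !inE; move: (wt k) (dDK k) (dDK' k).
  by case: (k \in D); case: (k \in K); case: (k \in D'); case: (k \in K') => //=;
     case: (lam k) (lam2 k) => [|[|[|]]].
- apply/setP => k; rewrite !inE; move: (wt k) (dDK k) (dDK' k).
  by case: (k \in D); case: (k \in K); case: (k \in D'); case: (k \in K') => //=;
     case: (lam k) (lam2 k) => [|[|[|]]].
- apply/subsetP => k; rewrite !inE; move: (wt k) (dDK k) (dDK' k).
  by case: (k \in D); case: (k \in K); case: (k \in D'); case: (k \in K') => //=;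
     case: (lam k) (lam2 k) => [|[|[|]]].
Qed.

Lemma notin_sdiff D k : k \in Z :\: D -> k \notin sdiff D O.
Proof. by rewrite in_sdiff !inE => /andP[/negPf-> /eqP ->]. Qed.

(** A coefficient of [raising k f] = 0 receives exactly two contributions, [k] being restored in the
    first or in the second factor. Moving one element across therefore changes the sign. *)
Lemma highest_sign D K : K \subset Z :\: D ->
  bc D K (sdiff D O) ((Z :\: D) :\: K) f
  = (-1) ^+ #|K| * bc D set0 (sdiff D O) (Z :\: D) f.
Proof.
move: {2}#|K| (erefl #|K|) => m; elim: m K => [|m IH] K Km KZ.
  by rewrite (cards0_eq Km) setD0 cards0 expr0 mul1r.
have /card_gt0P[k kK] : (0 < #|K|)%N by rewrite Km.
have kZ := subsetP KZ k kK.
have Km' : #|K :\ k| = m by have := cardsD1 k K; rewrite kK Km => -[].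
have KZ' : K :\ k \subset Z :\: D by apply: subset_trans KZ; apply: subsetDl.
have := IH _ Km' KZ'; rewrite Km' Km exprS mulN1r mulNr => <-.
have sub_unk D0 K0 : ((#|D0| == 0%N) || (#|D0| == 2%N)) -> [disjoint D0 & Z :\: D] ->
    K0 \subset Z :\: D -> is_unk D0 K0.
  move=> h d s; rewrite /is_unk h /=; apply: disjointWr d; exact: s.
have [/andP[c1 c2]|nc] := boolP (((#|D| == 0%N) || (#|D| == 2%N)) &&
    ((#|sdiff D O| == 0%N) || (#|sdiff D O| == 2%N))); last first.
  rewrite !bc_eq0 ?oppr0 //; apply: contra nc; rewrite /is_unk;
  by case/andP => /andP[-> _] /andP[-> _].
have dZ : [disjoint D & Z :\: D] by rewrite disjoint_sym disjoints_subset setDE subsetIr.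
have dZ' : [disjoint sdiff D O & Z :\: D].
  rewrite disjoint_sym disjoints_subset; apply/subsetP => j /notin_sdiff.
  by rewrite !inE.
have u1 := sub_unk _ _ c1 dZ KZ'.
have u2 := sub_unk _ _ c2 dZ' (subsetDl (Z :\: D) K).
have := bc_raising k u1 u2 f2; have [-> _ _] := hf k.
have -> : bc D (K :\ k) (sdiff D O) (Z :\: D :\: K) (0 : PA) = 0.
  by rewrite /bc big1 // => v _; rewrite big1 // => w _; rewrite linear0.
rewrite !inE eqxx kK /= setD1K // => /esym/eqP; rewrite addr_eq0 => /eqP ->.
congr (- bc _ _ _ _ _); apply/setP => j; rewrite !inE.
case: (eqVneq j k) => [->|//] /=; move: kZ; by rewrite !inE => /andP[-> ->].
Qed.

Definition hw_coeff D : R := bc D set0 (sdiff D O) (Z :\: D) f.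

Lemma highest_expand : f = \sum_D hw_coeff D *: TT R D (sdiff D O) (Z :\: D).
Proof.
rewrite {1}(quad_bcE f2); apply: eq_bigr => D _.
rewrite /TT /alt_sum scaler_sumr [RHS]big_mkcond; apply: eq_bigr => K _.
rewrite (bigD1 (sdiff D O)) //= [X in _ + X]big1 ?addr0 => [|D' DD']; last first.
  rewrite big1 // => K' _; have [->|/highest_support[E _ _ _]] := eqVneq (bc D K D' K' f) 0.
    by rewrite scale0r.
  by rewrite E eqxx in DD'.
rewrite (bigD1 ((Z :\: D) :\: K)) //= [X in _ + X]big1 ?addr0 => [|K' KK']; last first.
  have [->|/highest_support[_ _ E _]] := eqVneq (bc D K (sdiff D O) K' f) 0.
    by rewrite scale0r.
  by rewrite E eqxx in KK'.
case: ifP => KZ; last first.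
  have [->|/highest_support[_ E _ _]] := eqVneq (bc D K (sdiff D O) ((Z :\: D) :\: K) f) 0.
    by rewrite scale0r.
  by rewrite E in KZ.
by rewrite highest_sign // -mulrA sign_scale scalerA [hw_coeff D * _]mulrC.
Qed.

Lemma hw_coeff_support D : hw_coeff D != 0 ->
  [/\ D \subset Z :|: O, is_unk D set0 & is_unk (sdiff D O) set0].
Proof.
move=> nz; have [_ _ _ ->] := highest_support nz; split=> //.
  by apply: contraNT nz => nu; rewrite /hw_coeff bc_eq0 // (negPf nu).
apply: contraNT nz => nu; rewrite /hw_coeff bc_eq0 // negb_and; apply/orP; right.
apply: contra nu; rewrite /is_unk => /andP[-> _] /=.
by rewrite disjoint_sym disjoints_subset sub0set.
Qed.

End HighestExpansion.

(** * Evaluation at sparse matrices *)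

Section SmallMinors.
Context (R : realType) (n : nat).
Implicit Types (D K L M T : {set 'I_n}) (i j k a b l z : 'I_n) (S : 'M[R]_n).

Lemma mins00 S : mins S set0 set0 = 1.
Proof.
rewrite mins_p /pm; have -> : row_minor S id set0 = 1%:M; last exact: det1.
by apply/matrixP => r c; rewrite !mxE inE.
Qed.

Lemma mins01 S z : mins S set0 [set z] = S z z.
Proof.
rewrite mins_p /pm (@det_row_minor _ _ _ _ _ _ (fun _ : 'I_1 => z)).
- by rewrite det_mx11 mxE.
- by move=> x y _; rewrite !ord1.
by move=> r; rewrite inE; apply/codomP/eqP => [[_ ->]|->] //; exists ord0.
Qed.

Lemma mins20 S i j : S^T = S -> i != j -> mins S [set i; j] set0 = S i j.
Proof.
move=> sS ij; rewrite mins_a ?inE // /am setU0.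
rewrite (@det_row_minor _ _ _ _ _ _ (fun _ : 'I_1 => j)).
- by rewrite det_mx11 mxE /= eqxx.
- by move=> x y _; rewrite !ord1.
by move=> r; rewrite inE; apply/codomP/eqP => [[_ ->]|->] //; exists ord0.
Qed.

Lemma mins21 S i j z : S^T = S -> i != j -> z != i -> z != j ->
  mins S [set i; j] [set z] = S i j * S z z - S i z * S z j.
Proof.
move=> sS ij zi zj.
have nz x : z != x -> x \notin [set z] by rewrite inE eq_sym.
rewrite mins_a ?nz // /am.
rewrite (@det_row_minor _ _ _ _ _ _ (fun r : 'I_2 => if r == 0 then j else z)).
- by rewrite det_mx2 !mxE /= eqxx (negPf zj).
- move=> x y; case: (x =P 0) => [->|x0]; case: (y =P 0) => [->|y0] //=.
  + by move=> E; rewrite E eqxx in zj.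
  + by move=> E; rewrite E eqxx in zj.
  move=> _; apply: val_inj; case: x x0 => [[|[|]]] //= ? x0; case: y y0 => [[|[|]]] //= ? y0;
  by [case: x0; apply: val_inj | case: y0; apply: val_inj].
move=> r; rewrite !inE; apply/codomP/orP => [[x ->]|[/eqP->|/eqP->]].
- by case: (x == 0); [left|right].
- by exists 0.
- by exists 1.
Qed.

(* S with {a, b} made an isolated edge. *)
Definition edge a b S : 'M[R]_n := \matrix_(i, j)
  (if (i \in [set a; b]) || (j \in [set a; b])
   then (((i == a) && (j == b)) || ((i == b) && (j == a)))%:R else S i j).

Lemma edge_sym a b S : S^T = S -> (edge a b S)^T = edge a b S.
Proof.
move=> sS; apply/matrixP => i j; rewrite !mxE orbC -{1}sS mxE.
by case: ifP => // _; rewrite orbC ![(j == _) && _]andbC.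
Qed.

Section Edge.
Variables (a b : 'I_n) (S E : 'M[R]_n).
Hypotheses (ab : a != b) (sS : S^T = S) (sE : E^T = E).
Hypotheses (row_a : forall c, E a c = (b == c)%:R) (row_b : forall c, E b c = (a == c)%:R).
Hypothesis (EE : forall x y, x \notin [set a; b] -> y \notin [set a; b] -> E x y = S x y).

Lemma mins_edge_out D K : [disjoint D & [set a; b]] -> [disjoint K & [set a; b]] ->
  mins E D K = mins S D K.
Proof.
move=> dD dK; have [uDK|nu] := boolP (is_unk D K); last by rewrite !mins_eq0.
have nab x (A : {set 'I_n}) : [disjoint A & [set a; b]] -> x \in A -> x \notin [set a; b].
  by move=> /pred0P/(_ x) /=; case: (x \in A) => //= -> .
case: (is_unkE uDK) => [->|[i [j [ij Dij iK jK]]]].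
  rewrite !mins_p !pm_mxsub; congr (\det _); apply/matrixP => x y; rewrite !mxE.
  rewrite EE //; exact: nab dK (enum_valP _).
have iD : i \in D by rewrite Dij set21. have jD : j \in D by rewrite Dij set22.
rewrite Dij !mins_a // !am_mxsub //; congr (\det _); apply/matrixP => x y; rewrite !mxE.
have nf k (r : 'I_#|K|.+1) : k \in D -> followed k r \notin [set a; b].
  move=> kD; rewrite /followed; case: r => [[|r] rK] /=; first exact: nab dD kD.
  by apply: nab dK _; rewrite -mem_enum mem_nth // -cardE.
by rewrite EE ?nf.
Qed.

(** Row [x] of [E] is the unit vector at [y], and so is the row at [y], which lies outside [T]. *)
Lemma row_minor_edge_half s T x y : (x = a /\ y = b \/ x = b /\ y = a) ->
  x \in T -> s x = x -> y \notin T -> \det (row_minor E s T) = 0.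
Proof.
move=> xy xT sx yT; have xny : x != y by case: xy => -[-> ->] //; rewrite eq_sym.
apply: (det_eq_rows xny) => c; rewrite !mxE xT (negPf yT) sx.
by case: xy => -[-> ->].
Qed.

(** Rows [a] and [b] of [E] are the unit vectors at [b] and [a]; exchanging them gives the unit rows
    of absent indices, at the cost of one sign. *)
Lemma row_minor_edge_full s T : a \notin T -> b \notin T -> s a = a -> s b = b ->
  \det (row_minor E s (a |: (b |: T))) = - \det (row_minor E s T).
Proof.
move=> aT bT sa sb.
have -> : row_minor E s T = row_perm (tperm a b) (row_minor E s (a |: (b |: T))).
  apply/matrixP => r c; rewrite !mxE !inE; case: tpermP => [->|->|/eqP/negPf-> /eqP/negPf-> //].
    by rewrite (negPf aT) eqxx orbT sb row_b.
  by rewrite (negPf bT) eqxx /= sa row_a.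
by rewrite row_permE det_mulmx det_perm odd_tperm ab expr1 mulN1r opprK.
Qed.

Lemma mins_edge_half D K x y : (x = a /\ y = b \/ x = b /\ y = a) ->
  [disjoint D & [set a; b]] -> x \in K -> y \notin K -> mins E D K = 0.
Proof.
move=> xy dD xK yK; have [uDK|nu] := boolP (is_unk D K); last by rewrite !mins_eq0.
have nD z : z \in D -> (z != a) && (z != b).
  by move=> zD; have /pred0P/(_ z) := dD; rewrite /= zD /= !inE => /negbT; rewrite negb_or.
case: (is_unkE uDK) => [->|[i [j [ij Dij iK jK]]]].
  by rewrite mins_p /pm; apply: row_minor_edge_half xy _ _ _.
have jD : j \in D by rewrite Dij set22.
have /andP[ja jb] := nD j jD.
have [xj yj] : x != j /\ y != j by case: xy => -[-> ->]; rewrite ![_ == j]eq_sym.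
rewrite Dij mins_a // /am; apply: row_minor_edge_half xy _ _ _; rewrite ?inE ?xK ?orbT //=.
  by rewrite (negPf xj).
by rewrite negb_or yj.
Qed.

Lemma mins_edge_full D K : [disjoint D & [set a; b]] -> [disjoint K & [set a; b]] ->
  mins E D (a |: (b |: K)) = - mins S D K.
Proof.
move=> dD dK; rewrite -mins_edge_out //.
have nD (A : {set 'I_n}) z : [disjoint A & [set a; b]] -> z \in A -> (z != a) && (z != b).
  by move=> dA zA; have /pred0P/(_ z) := dA; rewrite /= zA /= !inE => /negbT; rewrite negb_or.
have aK : a \notin K by apply/negP => /(nD _ _ dK); rewrite eqxx.
have bK : b \notin K by apply/negP => /(nD _ _ dK); rewrite eqxx andbF.
have aD : a \notin D by apply/negP => /(nD _ _ dD); rewrite eqxx.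
have bD : b \notin D by apply/negP => /(nD _ _ dD); rewrite eqxx andbF.
have [uDK|nu] := boolP (is_unk D K); last first.
  by rewrite !mins_eq0 ?oppr0 // !is_unkU1 aD bD.
case: (is_unkE uDK) => [->|[i [j [ij Dij iK jK]]]].
  by rewrite !mins_p /pm row_minor_edge_full.
have iD : i \in D by rewrite Dij set21. have jD : j \in D by rewrite Dij set22.
have /andP[ia ib] := nD _ i dD iD. have /andP[ja jb] := nD _ j dD jD.
rewrite Dij !mins_a ?inE ?negb_or ?ia ?ib ?ja ?jb //= /am.
have -> : j |: (a |: (b |: K)) = a |: (b |: (j |: K)).
  by rewrite setUCA; congr (_ |: _); rewrite setUCA.
by rewrite row_minor_edge_full //= ?inE ?negb_or 1?eq_sym ?ja ?jb //= ifN // eq_sym.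
Qed.

(** The row at [b] carries row [a] of [E], which is the unit vector at [b], as if [b] were
    absent. *)
Lemma mins_edge_at K : [disjoint K & [set a; b]] -> mins E [set a; b] K = mins S set0 K.
Proof.
move=> dK.
have [aK bK] : a \notin K /\ b \notin K.
  by split; apply/negP => xK; have /pred0P := dK; [move/(_ a)|move/(_ b)];
     rewrite /= xK !inE eqxx ?orbT.
rewrite -[RHS]mins_edge_out ?disjoint_set0 // mins_a // mins_p /am /pm.
congr (\det _); apply/matrixP => r c; rewrite !mxE /= !inE.
case: (eqVneq r b) => [->|_] //=; rewrite (negPf bK) row_a.
by [].
Qed.

(** Let x be the end of the edge in D and y the other end. If y is in K, its row is the unit vector
    at x, equal to the row of the absent index x. Otherwise the row carrying row x of [E] is the
    unit vector at y, equal to the row at y. *)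
Lemma mins_edge_cross D K : #|D :&: [set a; b]| = 1%N -> mins E D K = 0.
Proof.
move=> D1; have [uDK|nu] := boolP (is_unk D K); last by rewrite !mins_eq0.
case: (is_unkE uDK) => [D0|[i [j [ij Dij iK jK]]]].
  by move: D1; rewrite D0 set0I cards0.
have cross x y z : (x = a /\ y = b \/ x = b /\ y = a) -> x != z -> y != z -> x \notin K -> z \notin K ->
    mins E [set x; z] K = 0.
  move=> xy xz yz xK zK; rewrite mins_a // /am.
  have rx c : E x c = (y == c)%:R by case: xy => -[-> ->].
  have ry c : E y c = (x == c)%:R by case: xy => -[-> ->].
  have xny : x != y by case: xy => -[-> ->] //; rewrite eq_sym.
  have [yK|yK] := boolP (y \in K).
    apply: (det_eq_rows xny) => c; rewrite !mxE /= !inE (negPf xz) (negPf yz) (negPf xK) yK /=.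
    by rewrite ry.
  apply: (@det_eq_rows _ _ _ z y); first by rewrite eq_sym.
  move=> c; rewrite !mxE /= !inE eqxx (negPf yz) (negPf yK) /=.
  by rewrite rx.
have sw x z : [set x; z] = [set z; x] by rewrite setUC.
have ia : (i \in [set a; b]) != (j \in [set a; b]).
  apply: contra_eqN D1 => /eqP ij2; rewrite Dij setIUl.
  have s1 x : [set x] :&: [set a; b] = if x \in [set a; b] then [set x] else set0.
    case: ifP => xab; first by apply/setIidPl; rewrite sub1set.
    by apply/disjoint_setI0; rewrite disjoints1 xab.
  by rewrite !s1 ij2; case: ifP => _; rewrite ?cards2 ?ij // setU0 cards0.
rewrite Dij; move: ia; have [iab|iab] := boolP (i \in [set a; b]); have [jab|jab] := boolP (j \in [set a; b]) => // _.
  move: jab; rewrite !inE negb_or => /andP[ja jb]; move: iab => /set2P[] ei; rewrite ei in iK *.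
    by apply: (cross a b) => //; [left|rewrite eq_sym|rewrite eq_sym].
  by apply: (cross b a) => //; [right|rewrite eq_sym|rewrite eq_sym].
rewrite sw; move: iab; rewrite !inE negb_or => /andP[ja jb]; move: jab => /set2P[] ei; rewrite ei in jK *.
  by apply: (cross a b) => //; [left|rewrite eq_sym|rewrite eq_sym].
by apply: (cross b a) => //; [right|rewrite eq_sym|rewrite eq_sym].
Qed.

End Edge.

End SmallMinors.

(** * Relations between coefficients and their reduction along an edge *)

Section Relation.
Context (R : realType) (n : nat).
Implicit Types (D K L M Z O : {set 'I_n}) (i j k a b l x y z : 'I_n) (S : 'M[R]_n).
Implicit Types (beta : {set 'I_n} -> R).

Definition Tval S D D' M : R := alt_sum (mins S D) (mins S D') M.

Lemma disjoint_setP D L : reflect (forall x, x \in D -> x \notin L) [disjoint D & L].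
Proof.
apply: (iffP pred0P) => [h x xD|h x /=]; first by have /= := h x; rewrite xD /= => ->.
by apply/negbTE/negP => /andP[/h /negP].
Qed.

(** A summand survives only if [a] and [b] go to the same factor. There are two such distributions;
    each changes the sign of one minor and leaves the alternating sign as it is, which gives the
    factor -2. *)
Lemma Tval_edge a b S E D D' M : a != b -> S^T = S -> E^T = E ->
  (forall c, E a c = (b == c)%:R) -> (forall c, E b c = (a == c)%:R) ->
  (forall x y, x \notin [set a; b] -> y \notin [set a; b] -> E x y = S x y) ->
  [disjoint D & [set a; b]] -> [disjoint D' & [set a; b]] -> [disjoint M & [set a; b]] ->
  Tval E D D' (a |: (b |: M)) = - (Tval S D D' M *+ 2).
Proof.
move=> ab sS sE ra rb EE dD dD' dM.
have aM : a \notin M by apply/negP => /(disjoint_setP _ _ dM); rewrite set21.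
have bM : b \notin M by apply/negP => /(disjoint_setP _ _ dM); rewrite set22.
have dK (K : {set 'I_n}) : K \subset M -> [disjoint K & [set a; b]].
  by move=> KM; apply: disjointWl dM; exact: KM.
have aK (K : {set 'I_n}) : K \subset M -> a \notin K by move=> /subsetP KM; apply: contra aM => /KM.
have bK (K : {set 'I_n}) : K \subset M -> b \notin K by move=> /subsetP KM; apply: contra bM => /KM.
have nba : b != a by rewrite eq_sym.
rewrite /Tval (alt_sum_split _ _ (setU11 a _)) setU1K ?inE ?negb_or ?ab //.
rewrite !(alt_sum_split _ _ (setU11 b _)) setU1K //.
have z1 F : alt_sum F (fun K => mins E D' (a |: K)) M = 0.
  rewrite /alt_sum big1 // => K KM; rewrite [mins _ _ _](@mins_edge_half _ _ a b E ab sE ra rb D' _ a b) ?mulr0 //.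
  - by left.
  - exact: setU11.
  - by rewrite !inE negb_or nba andbC /= negb_and bM orbT.
have z2 F : alt_sum (fun K => mins E D (a |: K)) F M = 0.
  rewrite /alt_sum big1 // => K KM; rewrite [mins _ _ _](@mins_edge_half _ _ a b E ab sE ra rb D _ a b) ?mulr0 ?mul0r //.
  - by left.
  - exact: setU11.
  - by rewrite !inE negb_or nba bK.
rewrite z1 z2 subr0 sub0r.
have -> : alt_sum (mins E D) (fun K => mins E D' (a |: (b |: K))) M = - alt_sum (mins S D) (mins S D') M.
  rewrite /alt_sum -sumrN; apply: eq_bigr => K KM.
  rewrite (mins_edge_out sS sE EE dD (dK _ KM)).
  rewrite (mins_edge_full ab sS sE ra rb EE dD' (dK _ (subsetDl M K))).
  by rewrite mulrN.
have -> : alt_sum (fun K => mins E D (a |: (b |: K))) (mins E D') M = - alt_sum (mins S D) (mins S D') M.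
  rewrite /alt_sum -sumrN; apply: eq_bigr => K KM.
  rewrite (mins_edge_out sS sE EE dD' (dK _ (subsetDl M K))).
  rewrite (mins_edge_full ab sS sE ra rb EE dD (dK _ KM)).
  by rewrite mulrN mulNr.
by rewrite opprK mulr2n opprD.
Qed.

Lemma edgeP a b S : a != b -> S^T = S -> [/\ (edge a b S)^T = edge a b S,
  forall c, edge a b S a c = (b == c)%:R, forall c, edge a b S b c = (a == c)%:R
  & forall x y, x \notin [set a; b] -> y \notin [set a; b] -> edge a b S x y = S x y].
Proof.
move=> ab sS; split; first exact: edge_sym.
- by move=> c; rewrite mxE set21 /= eqxx (negPf ab) orbF eq_sym.
- by move=> c; rewrite mxE set22 /= eqxx eq_sym (negPf ab) /= eq_sym.
by move=> x y /negPf hx /negPf hy; rewrite mxE hx hy.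
Qed.

Definition small D := (#|D| == 0%N) || (#|D| == 2%N).

(* The properties of the coefficients of a highest weight quadric in the kernel;
   the symmetry comes from exchanging the factors of a product. *)
Definition relation Z O beta : Prop :=
  [/\ forall D, beta D != 0 -> [/\ D \subset Z :|: O, small D & small (sdiff D O)],
      forall D, beta (sdiff D O) = (-1) ^+ #|Z :\: D| * beta D
    & forall S, S^T = S -> \sum_D beta D * Tval S D (sdiff D O) (Z :\: D) = 0].

(* The coefficients after evaluating at a matrix with isolated edge {a, b}. *)
Definition reduced O a b beta D : R :=
  if [disjoint D & [set a; b]] then
    - (beta D *+ 2) + (if (D == set0) && (O == set0) then beta [set a; b] else 0)
  else 0.

Lemma sdiff0 D : sdiff D set0 = D.
Proof. by apply/setP => k; rewrite in_sdiff inE; case: (k \in D). Qed.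

Lemma sdiffC D O : sdiff D O = sdiff O D.
Proof. by apply/setP => k; rewrite !in_sdiff eq_sym. Qed.

Lemma sdiffK D O : sdiff (sdiff D O) O = D.
Proof. by apply/setP => k; rewrite !in_sdiff; case: (k \in D); case: (k \in O). Qed.

Lemma small_set2 D a b : small D -> a \in D -> b \in D -> a != b -> D = [set a; b].
Proof.
move=> /orP[|] /eqP Dc aD bD ab; first by move: aD; rewrite (cards0_eq Dc) inE.
apply/esym/eqP; rewrite eqEcard Dc cards2 ab andbT.
by rewrite subUset !sub1set aD bD.
Qed.

Section Reduction.
Variables (Z O : {set 'I_n}) (a b : 'I_n) (beta : {set 'I_n} -> R).
Hypotheses (ab : a != b) (aZ : a \in Z) (bZ : b \in Z) (ZO : [disjoint Z & O]).
Hypothesis rel : relation Z O beta.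
Let Z' := (Z :\ a) :\ b.

Let aO : a \notin O. Proof. exact: (disjoint_setP _ _ ZO). Qed.
Let bO : b \notin O. Proof. exact: (disjoint_setP _ _ ZO). Qed.

Let sd_disjoint D : [disjoint sdiff D O & [set a; b]] = [disjoint D & [set a; b]].
Proof.
rewrite -!setI_eq0; congr (_ == set0); apply/setP => x; rewrite !inE.
case: eqVneq => [->|_]; first by rewrite (negPf aO) andbF orbF.
by case: eqVneq => [->|_]; rewrite ?(negPf bO) ?andbF ?orbF.
Qed.

Let ZE D : [disjoint D & [set a; b]] -> Z :\: D = a |: (b |: (Z' :\: D)).
Proof.
move=> dD; have aD : a \notin D by apply/negP => /(disjoint_setP _ _ dD); rewrite set21.
have bD : b \notin D by apply/negP => /(disjoint_setP _ _ dD); rewrite set22.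
apply/setP => x; rewrite !inE; case: eqVneq => [->|_]; first by rewrite aD aZ.
by case: eqVneq => [->|_] //; rewrite bD bZ.
Qed.

Let aZ' D : a \notin b |: (Z' :\: D). Proof. by rewrite !inE negb_or ab !eqxx /= !andbF. Qed.
Let bZ' D : b \notin Z' :\: D. Proof. by rewrite !inE eqxx /= andbF. Qed.

Let dZ' D : [disjoint Z' :\: D & [set a; b]].
Proof.
by apply/disjoint_setP => x; rewrite !inE negb_or => /and4P[_ -> ->].
Qed.

(** Sets D disjoint from the edge acquire the factor -2, sets meeting it in one index contribute 0,
    and D = {a, b} contributes to the empty set. The last case arises only for O empty, as [sdiff
    [set a; b] O] has more than two elements otherwise. *)
Lemma reduced_relation : relation Z' O (reduced O a b beta).
Proof.
case: rel => supp symb eqn; split.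
- move=> D; rewrite /reduced; case: ifP => [dD|]; last by rewrite eqxx.
  have [/andP[/eqP -> /eqP ->] _|nDO] := boolP ((D == set0) && (O == set0)).
    by rewrite sdiff0 sub0set /small cards0.
  rewrite addr0 oppr_eq0 mulrn_eq0 /= => /supp[DZO sD sD']; split=> //.
  apply/subsetP => x xD; have := subsetP DZO x xD; have := disjoint_setP _ _ dD x xD.
  by rewrite !inE negb_or => /andP[-> ->].
- move=> D; rewrite /reduced sd_disjoint; case: ifP => dD; last by rewrite mulr0.
  rewrite symb mulrDr mulrN -mulrnAr ZE // !cardsU1 aZ' bZ' /= !add1n !exprS !mulN1r opprK.
  have -> : (sdiff D O == set0) && (O == set0) = (D == set0) && (O == set0).
    by case: (eqVneq O set0) => [->|]; rewrite ?sdiff0 ?andbF.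
  congr (_ + _); case: ifP => [/andP[/eqP D0 /eqP O0]|_]; last by rewrite mulr0.
  have := symb [set a; b]; rewrite O0 sdiff0 D0 setD0 /Z'.
  by have -> : Z :\: [set a; b] = Z :\ a :\ b by rewrite setDDl.
move=> S sS; have [sE ra rb EE] := edgeP ab sS.
rewrite -[RHS](eqn _ sE) (bigID (fun D : {set 'I_n} => [disjoint D & [set a; b]])) /=.
rewrite [X in _ + X]big1 ?addr0 => [|D /negPf nD]; last by rewrite /reduced nD mul0r.
rewrite [RHS](bigID (fun D : {set 'I_n} => [disjoint D & [set a; b]])) /=.
rewrite (eq_bigr (fun D => beta D * Tval (edge a b S) D (sdiff D O) (Z :\: D)
   + (if D == set0 then if O == set0 then beta [set a; b] * Tval S set0 set0 Z' else 0 else 0))); last first.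
  move=> D dD; rewrite /reduced dD ZE // (Tval_edge ab sS sE ra rb EE) //; last first.
    by rewrite sd_disjoint.
  rewrite mulrDl mulNr mulrnAl mulrN mulrnAr; congr (_ + _).
  case: eqVneq => [->|_]; last by rewrite mul0r.
  by case: eqVneq => [->|_] /=; rewrite ?mul0r ?sdiff0 ?setD0.
rewrite big_split /=; congr (_ + _).
rewrite (bigD1 set0) /=; last by rewrite disjoint_sym disjoints_subset setC0 subsetT.
rewrite eqxx [X in _ + X]big1 ?addr0 => [|D /andP[_ /negPf ->] //].
rewrite (bigD1 [set a; b]) /=; last first.
  by apply/negP => /disjoint_setP/(_ a); rewrite set21 => /(_ isT).
rewrite [X in _ = _ + X]big1 ?addr0 => [|D /andP[nD DE]]; last first.
  have [->|/supp[_ sD _]] := eqVneq (beta D) 0; first by rewrite mul0r.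
  rewrite /Tval /alt_sum big1 ?mulr0 // => K _.
  rewrite (mins_edge_cross ab sE ra rb) ?mulr0 ?mul0r //.
  case: (boolP (a \in D)) => aD; case: (boolP (b \in D)) => bD.
  - by rewrite (small_set2 sD aD bD ab) eqxx in DE.
  - have -> : D :&: [set a; b] = [set a]; last by rewrite cards1.
    by apply/setP => x; rewrite !inE; case: (eqVneq x a) => [->|_]; rewrite ?aD //; case: (eqVneq x b) => [->|_]; rewrite ?(negPf bD) ?andbF.
  - have -> : D :&: [set a; b] = [set b]; last by rewrite cards1.
    by apply/setP => x; rewrite !inE; case: (eqVneq x b) => [->|_]; rewrite ?bD ?orbT //; case: (eqVneq x a) => [->|_]; rewrite ?(negPf aD) ?andbF.
  case/negP: nD; apply/disjoint_setP => x xD; rewrite in_set2 negb_or.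
  by apply/andP; split; apply/eqP => E; rewrite E ?(negPf aD) ?(negPf bD) in xD.
case: eqVneq => [O0|On0].
  rewrite O0 sdiff0; have -> : Z :\: [set a; b] = Z' by rewrite /Z' setDDl.
  have dK (K : {set 'I_n}) : K \subset Z' -> [disjoint K & [set a; b]].
    by move=> KZ; apply: disjointWl (dZ' set0); rewrite setD0; exact: KZ.
  congr (_ * _); apply: eq_bigr => K KZ.
  by rewrite !(mins_edge_at ab sS sE ra EE) ?dK ?subsetDl.
have [->|/supp[_ _]] := eqVneq (beta [set a; b]) 0; first by rewrite mul0r.
have -> : sdiff [set a; b] O = a |: (b |: O).
  apply/setP => x; rewrite in_sdiff !inE; case: (eqVneq x a) => [->|_]; first by rewrite (negPf aO).
  by case: (eqVneq x b) => [->|_] /=; rewrite ?(negPf bO) //; case: (x \in O).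
rewrite /small !cardsU1 !inE negb_or ab aO bO /= !add1n eqSS eqSS cards_eq0.
by rewrite (negPf On0).
Qed.

End Reduction.

End Relation.

Lemma eq_set2 (T : finType) (x y a b : T) :
  ([set x; y] == [set a; b]) = ((x == a) && (y == b)) || ((x == b) && (y == a)).
Proof.
apply/eqP/orP => [E|[|] /andP[/eqP -> /eqP ->]] //; last exact: setUC.
have := set21 x y; have := set22 x y; rewrite E => /set2P yab /set2P xab.
have := set21 a b; have := set22 a b; rewrite -E => /set2P bxy /set2P axy.
case: yab => e1; case: xab => e2; subst; rewrite ?eqxx; [|by right|by left|].
  by case: bxy => ->; rewrite eqxx; left.
by case: axy => ->; rewrite eqxx; left.
Qed.

(** * Four indices of weight one *)

Section Claims.
Context (R : realType) (n : nat).
Implicit Types (D K L M Z O W : {set 'I_n}) (i j k a b l x y z : 'I_n) (S : 'M[R]_n).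
Implicit Types (beta : {set 'I_n} -> R).

Lemma Tval0 S D D' : Tval S D D' set0 = mins S D set0 * mins S D' set0.
Proof.
rewrite /Tval /alt_sum (big_pred1 set0) => [|K]; last by rewrite /= subset0.
by rewrite cards0 expr0 mul1r setD0.
Qed.

Lemma Tval1 S D D' z :
  Tval S D D' [set z] = mins S D set0 * mins S D' [set z] - mins S D [set z] * mins S D' set0.
Proof.
rewrite /Tval (alt_sum_split _ _ (set11 z)) setDv -!/(Tval _ _ _ _).
by rewrite /alt_sum !(big_pred1 set0) => [|K|K]; rewrite /= ?subset0 // cards0 expr0 !mul1r setD0 setU0.
Qed.

(** The adjacency matrix of a graph; a diagonal entry is 1 only if E contains the singleton. *)
Definition gmat (E : {set {set 'I_n}}) : 'M[R]_n := \matrix_(x, y) ([set x; y] \in E)%:R.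

Lemma gmat_sym E : (gmat E)^T = gmat E.
Proof. by apply/matrixP => x y; rewrite !mxE setUC. Qed.

Lemma small_cases D : small D -> D = set0 \/ exists x y, x != y /\ D = [set x; y].
Proof.
case/orP => [|/cards2P[x [y [xy ->]]]]; first by rewrite cards_eq0 => /eqP; left.
by right; exists x, y.
Qed.

Lemma sum_through (V : zmodType) i Z (F : {set 'I_n} -> V) : i \notin Z ->
  (forall D, i \in D -> F D != 0 -> exists2 l, l \in Z & D = [set i; l]) ->
  \sum_(D : {set 'I_n} | i \in D) F D = \sum_(l in Z) F [set i; l].
Proof.
move=> iZ h; rewrite -(big_imset (h := fun l => [set i; l]) F) /=; last first.
  move=> x y xZ _ /eqP; rewrite eq_set2 eqxx /= => /orP[/eqP //|/andP[/eqP E /eqP E']].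
  by rewrite -E' xZ in iZ.
rewrite big_mkcond [RHS]big_mkcond; apply: eq_bigr => D _ /=.
case: (boolP (D \in _)) => [/imsetP[l _ ->]|nD]; first by rewrite set21.
case: ifP => // iD; apply/eqP/negP => /negP/(h _ iD)[l lZ E].
by case/negP: nD; rewrite E; apply/imsetP; exists l.
Qed.

(** Removes the elements of [Z :\: W] in pairs, which explains the parity condition, with a factor
    -2 each time. The value at [set0] for O empty is excluded because it is mixed with the
    coefficients of the removed edges. *)
Lemma reduce_to Z W O beta : [disjoint Z & O] -> relation Z O beta -> W \subset Z ->
  ~~ odd #|Z :\: W| -> exists c beta', [/\ c != 0, relation W O beta'
    & forall D, [disjoint D & Z :\: W] -> (D != set0) || (O != set0) -> beta' D = c * beta D].
Proof.
have [m] := ubnP #|Z|; elim: m => // m IH in Z beta *; rewrite ltnS => Zm ZO rel WZ eW.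
have [|] := boolP (Z :\: W == set0).
  rewrite setD_eq0 => ZW; have -> : W = Z by apply/eqP; rewrite eqEsubset WZ.
  by exists 1, beta; split=> // [|D _ _]; rewrite ?oner_neq0 ?mul1r.
case/set0Pn => a aZW; have aZ : a \in Z by case/setDP: aZW.
have : (Z :\: W) :\ a != set0.
  apply: contraNneq eW => e0; have := cardsD1 a (Z :\: W); rewrite e0 cards0 aZW => ->.
  by [].
case/set0Pn => b; rewrite !inE => /and3P[ba bW bZ].
have ab : a != b by rewrite eq_sym.
have aW : a \notin W by case/setDP: aZW.
have := reduced_relation ab aZ bZ ZO rel.
have cZ : #|Z :\: W| = (#|((Z :\ a) :\ b) :\: W|).+2.
  rewrite (cardsD1 a) (cardsD1 b) aZW !inE ba bW bZ /= !add1n; congr _.+2.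
  by congr #|pred_of_set _|; apply/setP => x; rewrite !inE; case: (x == a); case: (x == b); rewrite ?andbF.
move/IH => [|||| c [beta' [c0 rel' h]]].
- apply: leq_trans Zm; rewrite [X in (_ < X)%N](cardsD1 a) aZ (cardsD1 b (Z :\ a)) !inE ba bZ /=.
  by rewrite !add1n; apply: leqnSn.
- by apply: disjointWl ZO; apply: subset_trans (subsetDl _ _) (subsetDl _ _).
- by apply/subsetP => x xW; rewrite !inE (subsetP WZ) // andbT; apply/andP; split;
     [apply: contraNneq bW => <-|apply: contraNneq aW => <-].
- by move: eW; rewrite cZ /= negbK.
exists (c * - 2%:R), beta'; split=> //; first by rewrite mulf_neq0 // oppr_eq0 pnatr_eq0.
move=> D dD D0; rewrite h //; last first.
  by apply: disjointWr dD; apply: setSD; apply: subset_trans (subsetDl _ _) (subsetDl _ _).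
have -> : reduced O a b beta D = - (beta D *+ 2).
  rewrite /reduced; have -> : [disjoint D & [set a; b]].
    by apply: disjointWr dD; rewrite subUset !sub1set aZW !inE bW bZ.
  by case: ifP D0 => [/andP[-> ->]|_ _]; rewrite ?addr0.
by rewrite -mulr_natr; ring.
Qed.

Lemma card_sdiff D O : (#|sdiff D O| + 2 * #|D :&: O| = #|D| + #|O|)%N.
Proof.
have h1 := cardsID O D; have h2 := cardsID D O.
have -> : #|sdiff D O| = (#|D :\: O| + #|O :\: D|)%N.
  rewrite cardsU; have -> : (D :\: O) :&: (O :\: D) = set0; last by rewrite cards0 subn0.
  by apply/setP => x; rewrite !inE; case: (x \in D); case: (x \in O).
by move: h2; rewrite setIC; lia.
Qed.

Lemma relation4_support D O : small D -> small (sdiff D O) -> #|O| = 4 -> D \subset O /\ #|D| = 2.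
Proof.
move=> sD sD' O4; have := card_sdiff D O; have := subset_leq_card (subsetIl D O).
have := subset_leq_card (subsetIr D O); rewrite O4.
have -> : D \subset O = (#|D :&: O| == #|D|).
  apply/idP/eqP => [/setIidPl -> //|E]; apply/setIidPl/eqP.
  by rewrite eqEcard subsetIl E /=.
by move: sD sD' => /orP[] /eqP ? /orP[] /eqP ?; lia.
Qed.

Lemma support_gt4 D O : small D -> small (sdiff D O) -> (#|O| <= 4)%N /\ ~~ odd #|O|.
Proof.
move=> sD sD'; have := card_sdiff D O; have := subset_leq_card (subsetIl D O).
have := subset_leq_card (subsetIr D O).
by move: sD sD' => /orP[] /eqP ? /orP[] /eqP ?; lia.
Qed.

Lemma mins_gmat E D : #|D| = 2 -> mins (gmat E) D set0 = (D \in E)%:R.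
Proof.
by move/eqP/cards2P => [x [y [xy ->]]]; rewrite mins20 ?gmat_sym // mxE.
Qed.

Lemma relation4_base Z O beta : [disjoint Z & O] -> relation Z O beta -> #|O| = 4 -> (#|Z| <= 1)%N ->
  forall D, beta D = 0.
Proof.
move=> ZO [supp symb eqn] O4 Z1 D0; apply/eqP/negP => /negP nz.
have [_ s1 s2] := supp _ nz; have [D0O D02] := relation4_support s1 s2 O4.
pose D1 := sdiff D0 O.
have D1E : D1 = O :\: D0.
  by apply/setP => x; rewrite in_sdiff !inE; move/subsetP/(_ x): D0O; case: (x \in D0) => [->|] //; case: (x \in O).
have D12 : #|D1| = 2.
  by have := cardsID D0 O; rewrite D1E (setIidPr D0O) O4 D02 => -[].
have D01 : D1 != D0.
  have /card_gt0P[x xD0] : (0 < #|D0|)%N by rewrite D02.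
  by apply/eqP => E; have := xD0; rewrite -E D1E inE xD0.
have D11 : sdiff D1 O = D0 by exact: sdiffK.
have ZD D : D \subset O -> Z :\: D = Z.
  by move=> DO; apply/setDidPl; apply: disjointWr ZO; exact: DO.
have D1O : D1 \subset O by rewrite D1E subsetDl.
have symD : beta D1 = (-1) ^+ #|Z| * beta D0 by rewrite /D1 symb ZD.
have two (T : {set 'I_n} -> R) : (forall D, D \subset O -> #|D| = 2 -> D != D0 -> D != D1 -> T D = 0) ->
    \sum_D beta D * T D = beta D0 * T D0 + beta D1 * T D1.
  move=> hT; rewrite (bigD1 D0) //= (bigD1 D1) //= [X in _ + (_ + X)]big1 ?addr0 //.
  move=> D /andP[n0 n1]; have [->|nzD] := eqVneq (beta D) 0; first by rewrite mul0r.
  have [_ s3 s4] := supp _ nzD; have [DO D2] := relation4_support s3 s4 O4.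
  by rewrite hT ?mulr0.
have sd2 D : D \subset O -> #|D| = 2 -> #|sdiff D O| = 2.
  by move=> DO D2; have := card_sdiff D O; rewrite (setIidPl DO) O4 D2; lia.
have [Z0|/card_gt0P[z zZ]] := posnP #|Z|.
  (* On the matching with edges D0 and D1 only the two orderings of this pair survive, with equal
     coefficients. *)
  have := eqn _ (gmat_sym [set D0; D1]); rewrite (two (fun D => Tval _ D (sdiff D O) (Z :\: D))).
    rewrite !ZD // (cards0_eq Z0) !Tval0 -/D1 D11 !mins_gmat // set21 set22 symD Z0.
    by move/eqP; rewrite expr0 !mulr1 mul1r -mulr2n mulrn_eq0 (negPf nz).
  move=> D DO D2 n0 n1; rewrite ZD // (cards0_eq Z0) Tval0 mins_gmat // !inE (negPf n0) (negPf n1).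
  by rewrite mul0r.
have ZE : Z = [set z] by apply/eqP; rewrite eq_sym eqEcard sub1set zZ cards1.
have zO : z \notin O by exact: (disjoint_setP _ _ ZO).
have /cards2P[k [l [kl D1kl]]] : #|D1| == 2 by rewrite D12.
have kD1 : k \in D1 by rewrite D1kl set21. have lD1 : l \in D1 by rewrite D1kl set22.
have zx x : x \in O -> z != x by move=> xO; apply: contraNneq zO => ->.
have zk : z != k by apply/zx/(subsetP D1O).
have zl : z != l by apply/zx/(subsetP D1O).
(* The edge D0 together with the path k - z - l: the minor of D1 = {k, l} vanishes over the empty
   set and is -1 over {z}. The signs from the symmetry and from the alternation agree, which leaves
   2 [beta D0] = 0. *)
pose E := [set D0; [set k; z]; [set z; l]].
have EO D : D \subset O -> (D \in E) = (D == D0).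
  move=> DO; rewrite !inE; have nz2 (A : {set 'I_n}) : z \in A -> D == A = false.
    by move=> zA; apply: contraNF zO => /eqP E0; apply: (subsetP DO); rewrite E0.
  by rewrite (nz2 _ (set22 k z)) (nz2 _ (set21 z l)) !orbF.
have Ez : ([set z] \in E) = false.
  have c1 (A : {set 'I_n}) : #|A| = 2 -> ([set z] == A) = false.
    by move=> A2; apply/eqP => EA; move: A2; rewrite -EA cards1.
  by rewrite !inE !c1 // cards2 ?zl // eq_sym zk.
have m0 D : D \subset O -> #|D| = 2 -> mins (gmat E) D set0 = (D == D0)%:R.
  by move=> DO D2; rewrite mins_gmat // EO.
have m1 : mins (gmat E) D1 [set z] = -1.
  rewrite D1kl mins21 ?gmat_sym // !mxE setUid Ez mulr0 sub0r.
  by rewrite !inE !eqxx !orbT mulr1.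
have := eqn _ (gmat_sym E); rewrite (two (fun D => Tval _ D (sdiff D O) (Z :\: D))).
  rewrite !ZD // ZE !Tval1 -/D1 D11 !m0 // eqxx (negPf D01) m1 symD ZE cards1.
  move=> e; have : beta D0 *+ 2 = 0 by rewrite -[RHS]oppr0 -[in RHS]e /= mulr1n mulr0n; ring.
  by move/eqP; rewrite mulrn_eq0 (negPf nz).
move=> D DO D2 n0 n1; rewrite ZD // ZE Tval1 !m0 ?sd2 //.
  rewrite (negPf n0); have -> : sdiff D O == D0 = false; last by rewrite mul0r mulr0 subr0.
  by apply/eqP => E0; case/eqP: n1; rewrite /D1 -E0 sdiffK.
by apply/subsetP => x; rewrite in_sdiff; move/subsetP/(_ x): DO; case: (x \in D) => [->|] //; case: (x \in O).
Qed.

Lemma relation4 Z O beta D : [disjoint Z & O] -> relation Z O beta -> #|O| = 4 -> beta D = 0.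
Proof.
move=> ZO rel O4; apply/eqP/negP => /negP nz; case: (rel) => supp _ _.
have [_ s1 s2] := supp _ nz; have [DO D2] := relation4_support s1 s2 O4.
have [W [WZ W1 Wo]] : exists W, [/\ W \subset Z, (#|W| <= 1)%N & ~~ odd #|Z :\: W|].
  have [oZ|eZ] := boolP (odd #|Z|); last by exists set0; rewrite sub0set cards0 setD0.
  have /card_gt0P[z zZ] : (0 < #|Z|)%N by case: (#|Z|) oZ.
  exists [set z]; rewrite sub1set zZ cards1; split=> //.
  by move: oZ; rewrite (cardsD1 z) zZ.
have [c [beta' [c0 rel' h]]] := reduce_to ZO rel WZ Wo.
have WO : [disjoint W & O] by apply: disjointWl ZO; exact: WZ.
have := relation4_base WO rel' O4 W1 D; rewrite h.
- by move/eqP; rewrite mulf_eq0 (negPf c0) (negPf nz).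
- by apply: disjointWl DO _; rewrite disjoint_sym; apply: disjointWl ZO; exact: subsetDl.
- by rewrite -card_gt0 D2.
Qed.

End Claims.

(** * Two indices of weight one *)

Section PairClaims.
Context (R : realType) (n : nat).
Implicit Types (D K L M Z O W : {set 'I_n}) (i j k a b l x y z : 'I_n) (S : 'M[R]_n).
Implicit Types (beta : {set 'I_n} -> R).

(** A two-element D inside Z is impossible, since its symmetric difference with {i, j} would have
    four elements. *)
Lemma sum_pair (V : zmodType) i j Z (F : {set 'I_n} -> V) : i != j -> i \notin Z -> j \notin Z ->
  (forall D, F D != 0 ->
    [/\ D \subset Z :|: [set i; j], small D & small (sdiff D [set i; j])]) ->
  \sum_D F D = F set0 + F [set i; j] + \sum_(l in Z) (F [set i; l] + F [set j; l]).
Proof.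
move=> ij iZ jZ h; have mem x D : x \in D -> F D != 0 -> exists2 l, D = [set x; l] & x != l /\ l \in Z :|: [set i; j].
  move=> xD /h[DZ sD _]; have [D0|[y [z [yz Dyz]]]] := small_cases sD; first by rewrite D0 inE in xD.
  have [yD zD] : y \in D /\ z \in D by rewrite Dyz set21 set22.
  move: xD; rewrite {1}Dyz => /set2P[->|->].
    by exists z => //; split=> //; apply: (subsetP DZ).
  by exists y; rewrite 1?[RHS]setUC 1?eq_sym //; split=> //; apply: (subsetP DZ).
rewrite (bigID (fun D : {set 'I_n} => i \in D)) /= (@sum_through _ _ i (j |: Z)); first 1 last.
- by rewrite !inE negb_or ij.
- move=> D iD nz; have [l -> [il]] := mem i D iD nz; rewrite !inE => lZ; exists l => //.
  by case/orP: lZ => [lZ|/orP[]/eqP e]; rewrite !inE ?lZ ?orbT ?e ?eqxx //; rewrite e eqxx in il.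
rewrite big_setU1 //= (bigD1 set0) /= ?inE //.
pose G D := if i \in D then 0 else F D.
rewrite (bigID (fun D : {set 'I_n} => j \in D)) /= [X in _ + (_ + (_ + X))]big1 ?addr0; last first.
  move=> D /andP[/andP[iD D0] jD]; apply/eqP/negP => /negP/h[DZ sD sD'].
  have := card_sdiff D [set i; j]; have -> : D :&: [set i; j] = set0.
    by apply/setP => x; rewrite !inE; apply/negP => /andP[xD /orP[]/eqP e]; rewrite -e xD in iD jD.
  rewrite cards0 cards2 ij; move: sD; rewrite /small cards_eq0 (negPf D0) /= => /eqP ->.
  by move: sD' => /orP[] /eqP ->.
rewrite [X in _ + (_ + X)](_ : _ = \sum_(D : {set 'I_n} | j \in D) G D); last first.
  rewrite big_mkcond [RHS]big_mkcond; apply: eq_bigr => D _; rewrite /G.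
  have [jD|] := boolP (j \in D); last by rewrite andbF.
  have -> : D != set0 by apply/set0Pn; exists j.
  by case: (i \in D).
rewrite (@sum_through _ _ j Z) //.
  rewrite big_split /= addrACA addrA [F set0 + _]addrC -!addrA; congr (_ + (_ + (_ + _))).
  apply: eq_bigr => l lZ; rewrite /G !inE (negPf ij) /=; case: eqVneq => // e.
  by rewrite e lZ in iZ.
move=> D jD; rewrite /G; case: (boolP (i \in D)) => [|iD nz]; first by rewrite eqxx.
have [l E [jl]] := mem j D jD nz; rewrite !inE => /orP[lZ|/orP[]/eqP e]; first by exists l.
  by rewrite E e set22 in iD.
by rewrite e eqxx in jl.
Qed.

Lemma sdiff0l O : sdiff set0 O = O.
Proof. by rewrite sdiffC sdiff0. Qed.

Lemma sdiffv O : sdiff O O = set0.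
Proof. by apply/setP => x; rewrite in_sdiff inE eqxx. Qed.

Lemma sdiff_pair i j l : i != j -> l != i -> l != j -> sdiff [set i; l] [set i; j] = [set j; l].
Proof.
move=> ij li lj; apply/setP => x; rewrite in_sdiff !inE.
case: (eqVneq x i) => [->|_] /=; first by rewrite (negPf ij) eq_sym (negPf li).
by case: (eqVneq x l) => [->|_] /=; rewrite ?(negPf lj) ?orbT ?orbF //; case: (x == j).
Qed.

Lemma sum_pair_sdiff (V : zmodType) i j Z (G : {set 'I_n} -> {set 'I_n} -> {set 'I_n} -> V) :
  i != j -> i \notin Z -> j \notin Z ->
  (forall D, G D (sdiff D [set i; j]) (Z :\: D) != 0 ->
    [/\ D \subset Z :|: [set i; j], small D & small (sdiff D [set i; j])]) ->
  \sum_D G D (sdiff D [set i; j]) (Z :\: D) =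
    G set0 [set i; j] Z + G [set i; j] set0 Z
    + \sum_(l in Z) (G [set i; l] [set j; l] (Z :\ l) + G [set j; l] [set i; l] (Z :\ l)).
Proof.
move=> ij iZ jZ h; have ji : j != i by rewrite eq_sym.
rewrite (sum_pair ij iZ jZ) // sdiff0l setD0 sdiffv; congr (_ + _ + _).
  congr (G _ _ _); apply/setDidPl/disjoint_setP => x xZ.
  by rewrite !inE; apply/negP => /orP[]/eqP e; move: xZ; rewrite e ?(negPf iZ) ?(negPf jZ).
apply: eq_bigr => l lZ.
have li : l != i by apply: contraNneq iZ => <-.
have lj : l != j by apply: contraNneq jZ => <-.
rewrite sdiff_pair // [ [set i; j] ]setUC sdiff_pair //.
have ZD x : x \notin Z -> Z :\: [set x; l] = Z :\ l.
  move=> xZ; apply/setP => y; rewrite !inE negb_or.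
  by case: (eqVneq y x) => [->|//]; rewrite (negPf xZ) !andbF.
by rewrite !ZD.
Qed.

Section Pair.
Variables (Z : {set 'I_n}) (i j : 'I_n) (beta : {set 'I_n} -> R).
Hypotheses (ij : i != j) (iZ : i \notin Z) (jZ : j \notin Z).
Hypothesis rel : relation Z [set i; j] beta.
Let O := [set i; j].

Lemma pair_eqn S : S^T = S ->
  beta set0 * Tval S set0 O Z + beta O * Tval S O set0 Z
  + \sum_(l in Z) (beta [set i; l] * Tval S [set i; l] [set j; l] (Z :\ l)
     + beta [set j; l] * Tval S [set j; l] [set i; l] (Z :\ l)) = 0.
Proof.
move=> sS; case: rel => supp _ /(_ S sS) eS; rewrite -[RHS]eS.
rewrite (sum_pair_sdiff (G := fun D D' M => beta D * Tval S D D' M) ij iZ jZ) // => D.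
by rewrite mulf_eq0 negb_or => /andP[/supp].
Qed.

Lemma pair_sym l : l \in Z -> beta [set j; l] = (-1) ^+ #|Z :\ l| * beta [set i; l].
Proof.
move=> lZ; case: rel => _ symb _.
have li : l != i by apply: contraNneq iZ => <-.
have lj : l != j by apply: contraNneq jZ => <-.
rewrite -(sdiff_pair ij) // symb; congr ((-1) ^+ #|pred_of_set _| * _).
apply/setP => y; rewrite !inE negb_or.
by case: (eqVneq y i) => [->|//]; rewrite (negPf iZ) !andbF.
Qed.

Lemma pair_sym0 : beta O = (-1) ^+ #|Z| * beta set0.
Proof. by case: rel => _ /(_ set0); rewrite sdiff0l setD0. Qed.

End Pair.

Lemma disjoint_pair i j Z : i \notin Z -> j \notin Z -> [disjoint Z & [set i; j]].
Proof. by move=> iZ jZ; rewrite disjoint_sym disjoint2. Qed.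

(** After reduction to Z empty, the single edge {i, j} leaves twice the coefficient of the product
    with p. Such products are therefore absent from class (iii). *)
Lemma pair_even0 Z i j beta : i != j -> i \notin Z -> j \notin Z -> ~~ odd #|Z| ->
  relation Z [set i; j] beta -> beta set0 = 0.
Proof.
move=> ij iZ jZ eZ rel; have O0 : [set i; j] != set0 by apply/set0Pn; exists i; rewrite set21.
have [|c [b [c0 relb h]]] := reduce_to (disjoint_pair iZ jZ) rel (sub0set Z); first by rewrite setD0.
have := pair_eqn ij _ _ relb (gmat_sym R [set [set i; j]]).
rewrite !inE => /(_ isT isT); rewrite big_set0 addr0 !Tval0 mins00.
rewrite mins20 ?gmat_sym // mxE set11 (pair_sym0 relb) cards0 h ?disjoint_set0 ?O0 ?orbT //.
move=> e; apply/eqP; have : (c * beta set0) *+ 2 = 0 by rewrite -[RHS]e /= mulr1n; ring.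
by move/eqP; rewrite mulrn_eq0 mulf_eq0 (negPf c0).
Qed.

Lemma pair_odd Z i j beta l : i != j -> i \notin Z -> j \notin Z -> odd #|Z| ->
  relation Z [set i; j] beta -> l \in Z -> beta [set i; l] = beta set0.
Proof.
move=> ij iZ jZ oZ rel lZ; have O0 : [set i; j] != set0 by apply/set0Pn; exists i; rewrite set21.
have li : l != i by apply: contraNneq iZ => <-.
have lj : l != j by apply: contraNneq jZ => <-.
have il : i != l by rewrite eq_sym. have jl : j != l by rewrite eq_sym.
have [||c [b [c0 relb h]]] := @reduce_to _ _ Z [set l] _ _ (disjoint_pair iZ jZ) rel.
- by rewrite sub1set.
- by move: oZ; rewrite (cardsD1 l) lZ.
have il1 : i \notin [set l] by rewrite inE. have jl1 : j \notin [set l] by rewrite inE.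
(* On the path i - l - j the minor of {i, j} is 0 over the empty set and -1 over {l}, so the
   equation compares [beta set0] with the coefficient of {i, l}. *)
pose E := [set [set i; l]; [set j; l]]; have sE := gmat_sym R E.
have := pair_eqn ij il1 jl1 relb sE.
rewrite big_set1 setDv !Tval0 !Tval1 mins00 mins01 (pair_sym0 relb) (pair_sym ij il1 jl1 relb) ?set11 //.
rewrite cards1 setDv cards0 !mins20 // mins21 // ![gmat _ _ _ _]mxE ![_ \in E]inE.
have ji : j != i by rewrite eq_sym.
rewrite !in_set1 !eq_set2 !eqxx (negPf li) (negPf lj) (negPf il) (negPf jl) (negPf ij) (negPf ji).
rewrite !h ?disjoint_set0 ?O0 ?orbT //; last first.
  apply/disjoint_setP => x; rewrite !inE => /orP[]/eqP ->; rewrite ?eqxx //.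
  by rewrite (negPf iZ) andbF.
move=> e; apply: (mulfI c0); apply/eqP; rewrite -subr_eq0.
have : (c * beta [set i; l] - c * beta set0) *+ 2 = 0 by rewrite -[RHS]e /= !mulr1n; ring.
by move/eqP; rewrite mulrn_eq0.
Qed.

Lemma pair_even Z i j beta l m : i != j -> i \notin Z -> j \notin Z -> ~~ odd #|Z| ->
  relation Z [set i; j] beta -> l \in Z -> m \in Z -> beta [set i; l] = beta [set i; m].
Proof.
move=> ij iZ jZ eZ rel lZ mZ; have [->//|lm] := eqVneq l m.
have O0 : [set i; j] != set0 by apply/set0Pn; exists i; rewrite set21.
have li : l != i by apply: contraNneq iZ => <-.
have lj : l != j by apply: contraNneq jZ => <-.
have mi : m != i by apply: contraNneq iZ => <-.
have mj : m != j by apply: contraNneq jZ => <-.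
have il : i != l by rewrite eq_sym. have jl : j != l by rewrite eq_sym.
have im : i != m by rewrite eq_sym. have jm : j != m by rewrite eq_sym.
have ml : m != l by rewrite eq_sym. have ji : j != i by rewrite eq_sym.
have [||c [b [c0 relb h]]] := @reduce_to _ _ Z [set l; m] _ _ (disjoint_pair iZ jZ) rel.
- by rewrite subUset !sub1set lZ.
- by move: eZ; rewrite (cardsD1 l Z) lZ (cardsD1 m (Z :\ l)) in_setD1 ml mZ setDDl /= negbK.
have iW : i \notin [set l; m] by rewrite !inE negb_or il.
have jW : j \notin [set l; m] by rewrite !inE negb_or jl.
(* On the path i - l - m - j only the terms for l and m remain, since [beta set0] vanishes in the
   even case. *)
pose E := [set [set i; l]; [set l; m]; [set m; j]]; have sE := gmat_sym R E.
have := pair_eqn ij iW jW relb sE.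
rewrite (pair_sym0 relb) h ?disjoint_set0 ?O0 ?orbT // (pair_even0 ij iZ jZ eZ rel).
rewrite !mulr0 !mul0r !add0r.
have Dl : [set l; m] :\ l = [set m] by rewrite setU1K // inE.
have Dm : [set l; m] :\ m = [set l] by rewrite setUC setU1K // inE.
rewrite big_setU1 ?inE //= big_set1 Dl Dm !(pair_sym ij iW jW relb) ?set21 ?set22 //.
rewrite Dl Dm !cards1 !Tval1 !mins20 // !mins21 // ![gmat _ _ _ _]mxE ![_ \in E]inE ![_ \in _ :|: _]inE !in_set1 !eq_set2.
have dW x : x \in [set l; m] -> [disjoint [set i; x] & Z :\: [set l; m]].
  move=> xW; apply/disjoint_setP => y /set2P[]->; rewrite in_setD ?xW // (negPf iZ) andbF.
  by [].
rewrite !h ?dW ?set21 ?set22 ?O0 ?orbT //.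
rewrite !eqxx (negPf li) (negPf lj) (negPf mi) (negPf mj) (negPf il) (negPf jl) (negPf im) (negPf jm).
rewrite (negPf lm) (negPf ml) (negPf ij) (negPf ji) /= ?mulr1n ?mulr0n => e.
apply: (mulfI c0); apply/eqP; rewrite -subr_eq0.
have : (c * beta [set i; l] - c * beta [set i; m]) *+ 2 = 0 by rewrite -[RHS]oppr0 -[in RHS]e; ring.
by move/eqP; rewrite mulrn_eq0.
Qed.

End PairClaims.

(** * No index of weight one *)

Section EmptyClaims.
Context (R : realType) (n : nat).
Implicit Types (D K L M Z O W : {set 'I_n}) (i j k a b l x y z : 'I_n) (S : 'M[R]_n).
Implicit Types (beta : {set 'I_n} -> R).

Lemma empty_support Z beta D : relation Z set0 beta -> beta D != 0 -> D \subset Z /\ small D.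
Proof. by case=> supp _ _ /supp[]; rewrite setU0. Qed.

(** Here the two factors have the same lower left indices, and exchanging them gives
    [beta D = - beta D]. *)
Lemma empty_odd Z beta D : relation Z set0 beta -> odd #|Z| -> beta D = 0.
Proof.
move=> rel oZ; apply/eqP/negP => /negP nz; have [DZ sD] := empty_support rel nz.
case: (rel) => _ /(_ D) + _; rewrite sdiff0 -signr_odd.
have -> : odd #|Z :\: D|.
  move: oZ; rewrite -(cardsID D Z) (setIidPr DZ) oddD.
  by case/orP: sD => /eqP ->.
rewrite expr1 mulN1r => /eqP; rewrite -addr_eq0 -mulr2n mulrn_eq0 /=.
by rewrite (negPf nz).
Qed.

Lemma empty_base beta : relation set0 set0 beta -> beta set0 = 0.
Proof.
move=> rel; have [_ _ /(_ 0)] := rel; rewrite trmx0 => /(_ erefl).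
rewrite (bigD1 set0) //= big1 ?addr0 => [|D D0]; last first.
  have [->|/(empty_support rel)[]] := eqVneq (beta D) 0; first by rewrite mul0r.
  by rewrite subset0 (negPf D0).
by rewrite sdiff0 setD0 Tval0 mins00 !mulr1.
Qed.

Lemma reduced0 a b beta : reduced set0 a b beta set0 = beta [set a; b] - beta set0 *+ 2 :> R.
Proof. by rewrite /reduced disjoint_set0 eqxx /= addrC. Qed.

Lemma reduced_out a b beta D : [disjoint D & [set a; b]] -> D != set0 ->
  reduced set0 a b beta D = - (beta D *+ 2).
Proof. by move=> dD /negPf D0; rewrite /reduced dD D0 addr0. Qed.

Lemma disjoint0r Z : [disjoint Z & (set0 : {set 'I_n})].
Proof. by rewrite disjoint_sym disjoint_set0. Qed.

(** Reduction along {a, b} replaces u by -2 u and the value at [set0] by u_a + u_b - 2 [beta set0],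
    so the claim for the smaller set gives the claim for Z. *)
Lemma empty_half Z beta u : relation Z set0 beta -> ~~ odd #|Z| ->
  (forall i j, i \in Z -> j \in Z -> i != j -> beta [set i; j] = u i + u j) ->
  beta set0 *+ 2 = \sum_(i in Z) u i.
Proof.
have [m] := ubnP #|Z|; elim: m => // m IH in Z beta u *; rewrite ltnS => Zm rel eZ hu.
have [Z0|/card_gt0P[a aZ]] := posnP #|Z|.
  by rewrite (cards0_eq Z0) in rel *; rewrite big_set0 empty_base ?mul0rn.
have /card_gt0P[b] : (0 < #|Z :\ a|)%N.
  by move: eZ; rewrite (cardsD1 a Z) aZ add1n /= negbK => /odd_gt0.
rewrite !inE => /andP[ba bZ]; have ab : a != b by rewrite eq_sym.
have cZ : #|Z| = (#|(Z :\ a) :\ b|).+2 by rewrite (cardsD1 a) aZ (cardsD1 b (Z :\ a)) !inE ba bZ.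
have := IH _ (reduced set0 a b beta) (fun x => - (u x *+ 2)) _ (reduced_relation ab aZ bZ (disjoint0r Z) rel).
have -> : (#|Z :\ a :\ b| < m)%N by apply: leq_trans Zm; rewrite cZ.
have -> : ~~ odd #|Z :\ a :\ b| by move: eZ; rewrite cZ /= negbK.
move=> /(_ isT isT); have step i j : i \in Z :\ a :\ b -> j \in Z :\ a :\ b -> i != j ->
    reduced set0 a b beta [set i; j] = - (u i *+ 2) + - (u j *+ 2).
  rewrite !inE => /and3P[ib ia iZ] /and3P[jb ja jZ] ij; rewrite reduced_out.
  - by rewrite hu // mulrnDl opprD.
  - by apply/disjoint_setP => x /set2P[]->; rewrite in_set2 negb_or ?ia ?ja.
  - by apply/set0Pn; exists i; rewrite set21.
move=> /(_ step); rewrite reduced0 // hu // sumrN sumrMnl => e.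
rewrite (bigD1 a) //= (bigD1 b) //=; last by rewrite bZ.
rewrite (eq_bigl (fun x => x \in Z :\ a :\ b)) => [|x]; last by rewrite !inE; case: (x == a); case: (x == b); rewrite ?andbT ?andbF.
by lra.
Qed.

Lemma empty_pair i j beta : i != j -> relation [set i; j] set0 beta -> beta [set i; j] = beta set0 *+ 2.
Proof.
move=> ij rel; have := reduced_relation ij (set21 i j) (set22 i j) (disjoint0r _) rel.
have -> : [set i; j] :\ i :\ j = set0 by rewrite setU1K ?inE // setDv.
by move/empty_base; rewrite reduced0 // => /eqP; rewrite subr_eq0 => /eqP.
Qed.

Lemma empty_quad i j k l beta : uniq [:: i; j; k; l] ->
  relation [set i; j; k; l] set0 beta -> beta [set i; j] + beta [set k; l] = beta set0 *+ 2.
Proof.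
rewrite /= !inE !negb_or => /and4P[/and3P[ij ik il] /andP[jk jl] kl _] rel.
have kI : k \in [set i; j; k; l] by rewrite !inE eqxx !orbT.
have lI : l \in [set i; j; k; l] by rewrite !inE eqxx !orbT.
have := reduced_relation kl kI lI (disjoint0r _) rel.
have -> : [set i; j; k; l] :\ k :\ l = [set i; j].
  apply/setP => x; rewrite !inE; case: (eqVneq x l) => [->|_] /=.
    by rewrite (eq_sym l i) (negPf il) (eq_sym l j) (negPf jl).
  rewrite orbF; case: (eqVneq x k) => [->|_] /=; last by rewrite orbF.
  by rewrite (eq_sym k i) (negPf ik) (eq_sym k j) (negPf jk).
move/(empty_pair ij); rewrite reduced0 // reduced_out.
- by move=> e; lra.
- by apply/disjoint_setP => x /set2P[]->; rewrite in_set2 negb_or ?ik ?jk.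
- by apply/set0Pn; exists i; rewrite set21.
Qed.

(** After reduction to the four vertices both sides become twice the reduced value at [set0], by
    [empty_quad] for two perfect matchings. That value depends on the reduction but cancels. *)
Lemma empty_exchange Z beta i j k l : relation Z set0 beta -> ~~ odd #|Z| -> uniq [:: i; j; k; l] ->
  {subset [:: i; j; k; l] <= Z} ->
  beta [set i; j] + beta [set k; l] = beta [set i; k] + beta [set j; l].
Proof.
move=> rel eZ u4 s4.
have sW : [set i; j; k; l] \subset Z.
  by apply/subsetP => x xW; apply: s4; move: xW; rewrite !inE -!orbA.
have c4 : #|[set i; j; k; l]| = 4.
  by rewrite -[RHS](card_uniqP u4); apply: eq_card => x; rewrite !inE -!orbA.
have [|c [b [c0 relb h]]] := reduce_to (disjoint0r Z) rel sW.
  by move: eZ; rewrite -(cardsID [set i; j; k; l] Z) (setIidPr sW) c4 oddD.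
have q1 := empty_quad u4 relb.
have [u4' sWE] : uniq [:: i; k; j; l] /\ [set i; j; k; l] = [set i; k; j; l].
  split; last by rewrite -!setUA [ [set j] :|: _]setUCA.
  by rewrite (perm_uniq (_ : perm_eq _ [:: i; j; k; l])) // perm_cons (perm_catC [:: k] [:: j; l]) //= perm_cons (perm_catC [:: l] [:: k]).
rewrite sWE in relb; have q2 := empty_quad u4' relb.
have dW D : D \subset [set i; j; k; l] -> [disjoint D & Z :\: [set i; j; k; l]].
  move=> DW; rewrite disjoint_sym; apply: disjointWr (DW) _.
  by apply/disjoint_setP => x /setDP[].
have hp x y : x \in [set i; j; k; l] -> y \in [set i; j; k; l] -> b [set x; y] = c * beta [set x; y].
  move=> xW yW; apply: h; first by apply: dW; rewrite subUset !sub1set xW.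
  by apply/orP; left; apply/set0Pn; exists x; rewrite set21.
move: q1; rewrite -q2 !hp ?inE ?eqxx ?orbT // -!mulrDr; exact: mulfI.
Qed.

Lemma empty_even Z beta : relation Z set0 beta -> ~~ odd #|Z| -> exists u : 'I_n -> R,
  (forall i j, i \in Z -> j \in Z -> i != j -> beta [set i; j] = u i + u j) /\
  beta set0 *+ 2 = \sum_(i in Z) u i.
Proof.
move=> rel eZ; suff [u hu] : exists u : 'I_n -> R, forall i j, i \in Z -> j \in Z -> i != j ->
    beta [set i; j] = u i + u j.
  by exists u; split; last exact: empty_half rel eZ hu.
(* The only possible pair has the value 2 [beta set0], so a constant family serves. *)
have [Z2|] := leqP #|Z| 2.
  exists (fun=> beta set0) => i j iZ jZ ij; rewrite -mulr2n; apply: empty_pair => //.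
  suff <- : Z = [set i; j] by [].
  by apply/eqP; rewrite eq_sym eqEcard cards2 ij subUset !sub1set iZ jZ.
case/card_gt2P => x [y [z [[xZ yZ zZ] [xy yz zx]]]].
have exch i j k : i \in Z -> j \in Z -> k \in Z -> uniq [:: x; i; j; k] ->
    beta [set i; j] + beta [set x; k] = beta [set i; k] + beta [set x; j].
  move=> iZ jZ kZ u4; have u4' : uniq [:: i; j; k; x].
    by rewrite -(rot_uniq 3) /rot.
  have s4 : {subset [:: i; j; k; x] <= Z} by move=> t; rewrite !inE => /or4P[] /eqP ->.
  by have := empty_exchange rel eZ u4' s4; rewrite [ [set k; x] ]setUC [ [set j; x] ]setUC.
(* The defect of additivity with respect to the base point x. The exchange identity makes [c i j]
   independent of j, hence constant by symmetry. *)
pose c i j := beta [set i; j] - beta [set x; i] - beta [set x; j].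
have cC i j : c i j = c j i by rewrite /c setUC addrAC.
have cE i j k : i \in Z -> j \in Z -> k \in Z -> i != x -> j != x -> k != x -> i != j -> i != k ->
    c i j = c i k.
  move=> iZ jZ kZ ix jx kx ij ik; have [->//|jk] := eqVneq j k.
  have u4 : uniq [:: x; i; j; k] by rewrite /= !inE !negb_or ij ik jk !(eq_sym x) ix jx kx.
  by have := exch i j k iZ jZ kZ u4; rewrite /c => e; lra.
have yx : y != x by rewrite eq_sym.
have cst i j : i \in Z -> j \in Z -> i != x -> j != x -> i != j -> c i j = c y z.
  move=> iZ jZ ix jx ij; have [e|iy] := eqVneq i y.
    by rewrite -e; apply: cE; rewrite // e.
  by rewrite (cE i j y) // cC (cE y i z) // eq_sym.
(* The choice u_i = beta_{xi} - u_x is forced by the pairs through x; for the other pairs it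
   requires the constant defect to be -2 u_x. *)
pose ux := - (c y z) / 2.
exists (fun i => if i == x then ux else beta [set x; i] - ux) => i j iZ jZ ij.
have [ix|ix] := eqVneq i x; have [jx|jx] := eqVneq j x.
- by rewrite ix jx eqxx in ij.
- by rewrite ix; ring.
- by rewrite jx setUC; ring.
have := cst i j iZ jZ ix jx ij; rewrite /ux /c => e; lra.
Qed.

End EmptyClaims.

(** * Highest weight quadrics in the kernel *)

Section Classification.
Context (R : realType) (n : nat).
Local Notation PA := (ringPA R n).
Implicit Types (D K L M Z O W : {set 'I_n}) (i j k a b l x y z : 'I_n) (S : 'M[R]_n).

Lemma bc_sym D K D' K' (f : PA) : bc D K D' K' f = bc D' K' D K f.
Proof.
by rewrite /bc exchange_big /=; apply: eq_bigr => v _; apply: eq_bigr => w _; rewrite bcoef_sym.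
Qed.

Definition eval_at (S : 'M[R]_n) : ringS R n -> R :=
  meval (fun r : 'I_#|{: sidx n}| => let x := val (enum_val r) in S x.1 x.2).

HB.instance Definition _ S := GRing.RMorphism.copy (eval_at S) (meval _).

Lemma eval_Sigma S : S^T = S -> map_mx (eval_at S) (Sigma R n) = S.
Proof.
move=> sS; have le i j (ij : (i <= j)%N) : eval_at S (Sigma R n i j) = S i j.
  by rewrite (Sigma_le _ ij) /eval_at mevalXU enum_rankK.
apply/matrixP => i j; rewrite mxE; case: (leqP i j) => [/le //|/ltnW/le].
by rewrite -{1}(Sigma_sym R n) mxE => ->; rewrite -{1}sS mxE.
Qed.

Variables (lam : 'I_n -> nat) (f : PA).
Hypotheses (lam2 : forall k, (lam k <= 2)%N) (f2 : f \is 2.-homog)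
  (hf : forall k, poly_string k (lam k) f) (kf : minor_map f = 0).

Let Z := [set k | lam k == 0%N].
Let O := [set k | lam k == 1%N].
Let beta := hw_coeff lam f.

Let ZO : [disjoint Z & O].
Proof. by apply/disjoint_setP => k; rewrite !inE => /eqP ->. Qed.

Lemma hw_coeff_relation : relation Z O beta.
Proof.
have ZD D : Z :\: sdiff D O = Z :\: D.
  apply/setP => k; rewrite !in_setD in_sdiff.
  case: (boolP (k \in Z)) => [kZ|]; rewrite ?andbF // !andbT.
  by rewrite (negPf (disjoint_setP _ _ ZO _ kZ)); case: (k \in D).
split=> [D|D|S sS].
- move/(hw_coeff_support lam2 f2 hf) => [DZO /andP[sD _] /andP[sD' _]].
  by split.
- rewrite /beta /hw_coeff sdiffK ZD bc_sym.
  have := highest_sign f2 hf (subxx (Z :\: D)); rewrite setDv; exact.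
have := congr1 (eval_at S) kf; rewrite rmorph0 => ev0; rewrite -[RHS]ev0.
rewrite [in RHS](highest_expand lam2 f2 hf) /minor_map subst_sum rmorph_sum; apply: eq_bigr => D _.
rewrite substZ -/(minor_map _) minor_map_TT -mul_mpolyC rmorphM /= /eval_at mevalC -/(eval_at S _).
congr (_ * _); rewrite /Tval /alt_sum rmorph_sum; apply: eq_bigr => K _.
by rewrite !rmorphM /= rmorph_sign !mins_morph eval_Sigma.
Qed.

Lemma TT_C D D' M : TT R D' D M = (-1) ^+ #|M| *: TT R D D' M.
Proof. by rewrite /TT alt_sumC sign_scale. Qed.

Lemma hw_pair i j : i != j -> O = [set i; j] -> exists c, f = c *: G23 R Z i j.
Proof.
move=> ij Oij; have rel := hw_coeff_relation; rewrite Oij in rel.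
have := ZO; rewrite disjoint_sym Oij => /disjoint_setP OZ.
have iZ : i \notin Z by apply: OZ; rewrite set21.
have jZ : j \notin Z by apply: OZ; rewrite set22.
have [c [hc h0]] : exists c, (forall l, l \in Z -> beta [set i; l] = c) /\
    beta set0 = if odd #|Z| then c else 0.
  have [oZ|oZ] := boolP (odd #|Z|).
    by exists (beta set0); split=> // l lZ; apply: pair_odd rel lZ.
  have b0 := pair_even0 ij iZ jZ oZ rel.
  have [Z0|/card_gt0P[m mZ]] := posnP #|Z|.
    by exists 0; split=> // l; rewrite (cards0_eq Z0) inE.
  by exists (beta [set i; m]); split=> // l lZ; apply: pair_even rel lZ mZ.
(* Each product occurs once for D and once for [sdiff D O], with equal contributions. *)
exists (c *+ 2); rewrite {1}(highest_expand lam2 f2 hf) -/Z -/O -/beta Oij.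
rewrite (sum_pair_sdiff (G := fun D D' M => beta D *: TT R D D' M) ij iZ jZ) => [|D]; last first.
  by have [->|] := eqVneq (beta D) 0; [rewrite scale0r eqxx|case: rel => + _ _ => /[apply]].
rewrite (pair_sym0 rel) h0 [TT _ [set i; j] _ _]TT_C scalerDr; congr (_ + _).
  rewrite scalerA mulrAC -expr2 sqrr_sign mul1r -scalerDl -mulr2n.
  by case: ifP => _; rewrite ?mul0rn ?scale0r ?scaler0.
rewrite scaler_sumr; apply: eq_bigr => l lZ.
rewrite (pair_sym ij iZ jZ rel) // hc // [TT _ [set j; l] _ _]TT_C.
by rewrite scalerA mulrAC -expr2 sqrr_sign mul1r -scalerDl -mulr2n.
Qed.

Lemma hw_empty : O = set0 -> ~~ odd #|Z| ->
  exists u : 'I_n -> R, f = \sum_(i in Z) u i *: G4 R i (Z :\ i).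
Proof.
move=> O0 eZ; have rel := hw_coeff_relation; rewrite O0 in rel.
have [u [hu h0]] := empty_even rel eZ; exists u.
(* The summand of D = {i, l} belongs to [G4 i] and to [G4 l], so it receives u_i + u_l, while the
   alternating sum of the products of two p receives half the sum of all u_i. These are the values
   found in [empty_even]. *)
pose F D := if (D \subset Z) && (#|D| == 2%N) then TT R D D (Z :\: D) else 0.
have G4i i : i \in Z -> G4 R i (Z :\ i) = 2^-1 *: TT R set0 set0 Z + \sum_(D : {set 'I_n} | i \in D) F D.
  move=> iZ; rewrite G4E ?setD11 //; last by move: eZ; rewrite (cardsD1 i) iZ /= negbK.
  rewrite setD1K //; congr (_ + _); rewrite (@sum_through _ _ i (Z :\ i)) ?setD11 //.
    apply: eq_bigr => l; rewrite in_setD1 => /andP[li lZ].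
    by rewrite /F subUset !sub1set iZ lZ cards2 (eq_sym i l) li /= setDDl.
  move=> D iD; rewrite /F; case: ifP => [/andP[DZ /cards2P[x [y [xy Dxy]]]] _|]; last by rewrite eqxx.
  have [xD yD] : x \in D /\ y \in D by rewrite Dxy set21 set22.
  move: iD; rewrite {1}Dxy => /set2P[]e; rewrite e.
    by exists y => //; rewrite in_setD1 eq_sym xy (subsetP DZ).
  by exists x; rewrite 1?setUC // in_setD1 xy (subsetP DZ).
rewrite {1}(highest_expand lam2 f2 hf) -/Z -/O -/beta O0.
under [RHS]eq_bigr => i iZ do rewrite G4i // scalerDr scalerA.
rewrite big_split /= -scaler_suml -mulr_suml -h0.
have -> : (beta set0 *+ 2) / 2%:R = beta set0 by rewrite -[beta _ *+ 2]mulr_natr mulfK // pnatr_eq0.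
under [X in _ = _ + X]eq_bigr => i iZ do rewrite scaler_sumr.
rewrite (exchange_big_dep xpredT) //= (bigD1 set0) //= sdiff0 setD0; congr (_ + _).
rewrite [RHS](bigD1 set0) //= [X in _ = X + _]big1 ?add0r => [|i]; last by rewrite in_set0 andbF.
apply: eq_bigr => D D0; rewrite sdiff0 /F; case: ifP => [/andP[DZ /cards2P[x [y [xy Dxy]]]]|nD].
  have [xZ yZ] : x \in Z /\ y \in Z.
    by split; apply: (subsetP DZ); rewrite Dxy ?set21 ?set22.
  rewrite -scaler_suml; congr (_ *: _); rewrite {1}Dxy hu //.
  rewrite (eq_bigl (fun i => i \in D)) => [|i].
    by rewrite Dxy big_setU1 ?inE //= big_set1.
  by case: (boolP (i \in D)) => [iD|]; rewrite ?andbF // (subsetP DZ).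
rewrite [RHS]big1 => [|i _]; last by rewrite scaler0.
have [->|nz] := eqVneq (beta D) 0; first by rewrite scale0r.
have [DZ /orP[]] := empty_support rel nz; first by rewrite cards_eq0 (negPf D0).
by move=> D2; rewrite DZ D2 in nD.
Qed.

Lemma hw_classification : f = 0 \/ (O = set0 /\ ~~ odd #|Z|) \/
  exists i j, i != j /\ O = [set i; j].
Proof.
have rel := hw_coeff_relation.
have f0 : (forall D, beta D = 0) -> f = 0.
  move=> b0; rewrite (highest_expand lam2 f2 hf) big1 // => D _.
  by rewrite -/(beta) b0 scale0r.
have [c0|O0] := posnP #|O|.
  have O0 := cards0_eq c0; rewrite O0 in rel *; have [oZ|eZ] := boolP (odd #|Z|); last by right; left.
  by left; apply: f0 => D; apply: empty_odd rel oZ.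
have [/cards2P[i [j [ij Oij]]]|O2] := boolP (#|O| == 2%N); first by right; right; exists i, j.
left; apply: f0 => D; apply/eqP/negP => /negP nz; case: (rel) => /(_ D nz)[_ s1 s2] _ _.
have [O4 Oe] := support_gt4 s1 s2; have O4' : #|O| = 4.
  by move: O0 O2 O4 Oe; case: #|O| => [|[|[|[|[|]]]]].
by rewrite (relation4 D ZO rel O4') eqxx in nz.
Qed.

End Classification.

(** * The family of highest weight quadrics *)

Section Family.
Context (R : realType) (n : nat).
Local Notation PA := (ringPA R n).
Implicit Types (D K L M N Z O W B : {set 'I_n}) (i j k a b l x y z : 'I_n).

Lemma bc_linear D K D' K' : linear_for *%R (bc D K D' K' : PA -> R).
Proof. by move=> c f g; apply: bc_lin. Qed.

HB.instance Definition _ D K D' K' :=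
  GRing.isLinear.Build R PA R *%R (bc D K D' K' : PA -> R) (@bc_linear D K D' K').

Lemma bc0 D K D' K' : bc D K D' K' (0 : PA) = 0.
Proof. exact: linear0. Qed.

Lemma bcD D K D' K' (f g : PA) : bc D K D' K' (f + g) = bc D K D' K' f + bc D K D' K' g.
Proof. exact: linearD. Qed.

Lemma bcZ D K D' K' c (f : PA) : bc D K D' K' (c *: f) = c * bc D K D' K' f.
Proof. exact: linearZ. Qed.

Lemma bc_sum D K D' K' (I : Type) (r : seq I) (P : pred I) (F : I -> PA) :
  bc D K D' K' (\sum_(x <- r | P x) F x) = \sum_(x <- r | P x) bc D K D' K' (F x).
Proof. exact: linear_sum. Qed.

Lemma bc_TT D1 D2 K2 D D' M : is_unk D1 set0 -> is_unk D2 K2 ->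
  bc D1 set0 D2 K2 (TT R D D' M) =
  2^-1 * ([&& D1 == D, D2 == D' & K2 == M]%:R
    + (-1) ^+ #|M| * [&& D1 == D', D2 == D & K2 == M]%:R).
Proof.
move=> /is_unkP[v [<- v0]] /is_unkP[w [<- <-]]; rewrite -{1}v0 bc_unk.
exact: bcoef_TT.
Qed.

Lemma is_unk_pair a b K : a != b -> a \notin K -> b \notin K -> is_unk [set a; b] K.
Proof. by move=> ab aK bK; rewrite is_unk2 // aK. Qed.

Lemma bc_G4 i M a b : i \notin M -> odd #|M| -> a != b -> a \in i |: M -> b \in i |: M ->
  bc [set a; b] set0 [set a; b] ((i |: M) :\: [set a; b]) (G4 R i M) = ((i == a) || (i == b))%:R.
Proof.
move=> iM oM ab aN bN; rewrite G4E // bcD bcZ bc_sum.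
have u1 : is_unk [set a; b] set0 by rewrite is_unk_pair ?inE.
have u2 : is_unk [set a; b] ((i |: M) :\: [set a; b]).
  by rewrite is_unk_pair // in_setD ?set21 ?set22.
have n0 : ([set a; b] == set0) = false by apply/negbTE/set0Pn; exists a; rewrite set21.
rewrite bc_TT // n0 /= mulr0 addr0 !mulr0 add0r.
have e l : l \in M -> bc [set a; b] set0 [set a; b] ((i |: M) :\: [set a; b])
    (TT R [set i; l] [set i; l] (M :\ l)) = ([set a; b] == [set i; l])%:R.
  move=> lM; rewrite bc_TT //; have [E|] := eqVneq [set a; b] [set i; l]; last by rewrite mulr0 addr0 mulr0.
  have -> : (i |: M) :\: [set a; b] = M :\ l by rewrite E -setDDl setU1K.
  rewrite eqxx -signr_odd; have -> : odd #|M :\ l| = false.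
    by apply/negbTE; move: oM; rewrite (cardsD1 l) lM.
  by rewrite expr0 mul1r -natrD mulVf ?pnatr_eq0.
rewrite (eq_bigr _ e) -natr_sum; congr _%:R.
under eq_bigr => l _ do rewrite eq_set2 (eq_sym b l) (eq_sym a l) (eq_sym a i) (eq_sym b i).
have bM : i == a -> b \in M by move=> /eqP ia; move: bN; rewrite ia !inE eq_sym (negPf ab).
have aM : i == b -> a \in M by move=> /eqP ib; move: aN; rewrite ib !inE (negPf ab).
case: (boolP (i == a)) => ia.
  have ib : i == b = false by apply/negbTE; rewrite (eqP ia).
  rewrite (bigD1 b) ?bM //= ib eqxx /= big1 // => l /andP[_ /negPf ->].
  by rewrite andbF.
case: (boolP (i == b)) => ib /=; last by rewrite big1 // => l _; rewrite andbF.
by rewrite (bigD1 a) ?aM //= eqxx /= big1 // => l /andP[_ /negPf ->].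
Qed.

Lemma bc_G23 M a b l : a != b -> a \notin M -> b \notin M -> l \in M ->
  bc [set a; l] set0 [set b; l] (M :\ l) (G23 R M a b) = 2^-1.
Proof.
move=> ab aM bM lM.
have al : a != l by apply: contraNneq aM => ->.
have bl : b != l by apply: contraNneq bM => ->.
have u1 : is_unk [set a; l] set0 by rewrite is_unk_pair ?inE.
have u2 : is_unk [set b; l] (M :\ l).
  by rewrite is_unk_pair // in_setD1 ?eqxx // (negPf bM) andbF.
have n0 : ([set a; l] == set0) = false by apply/negbTE/set0Pn; exists a; rewrite set21.
rewrite /G23 bcD bc_sum.
have -> : bc [set a; l] set0 [set b; l] (M :\ l) (if odd #|M| then TT R set0 [set a; b] M else 0) = 0.
  case: ifP => _; last exact: bc0.
  rewrite bc_TT // n0 /= eq_set2 eqxx (eq_sym l b) (negPf bl) (negPf ab) /=.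
  by rewrite mulr0 addr0 mulr0.
rewrite add0r (bigD1 l) //= big1 ?addr0 => [|x /andP[xM xl]].
  by rewrite bc_TT // !eqxx eq_set2 (negPf ab) (negPf al) /= mulr0 addr0 mulr1.
rewrite bc_TT // !eq_set2 !eqxx (negPf ab) (eq_sym l x) (negPf xl) /=.
have -> : (a == x) = false by apply: contraNF aM => /eqP ->.
by rewrite /= mulr0 addr0 mulr0.
Qed.

(* (M, B) stands for the quadrics with indices in M and distinguished indices B:
   class (i) if B = M, class (ii) or (iii) if |B| = 2 < |M|, class (iv) if
   |B| = 1. *)
Definition fam_cond (p : {set 'I_n} * {set 'I_n}) : bool :=
  (p.2 \subset p.1) &&
  ((#|p.2| == 2%N) || [&& #|p.2| == 1%N, ~~ odd #|p.1| & (3 < #|p.1|)%N]).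

Definition fam := {p | fam_cond p}.
Implicit Types (t : fam).

Definition fam_set t : {set 'I_n} := (val t).1.
Definition fam_part t : {set 'I_n} := (val t).2.
(** The indices of weight one. If the two distinguished indices are all of [fam_set t], the quadric
    is that of class (i), which has weight zero at both. *)
Definition fam_one t : {set 'I_n} :=
  if (#|fam_part t| == 2%N) && (#|fam_set t| != 2%N) then fam_part t else set0.
Definition fam_zero t : {set 'I_n} := fam_set t :\: fam_one t.

(** A relation and not a function, since [fam_part t] is unordered and its two orderings may give
    opposite quadrics. *)
Inductive fam_spec t : PA -> Prop :=
| FamPair a b of a != b & fam_set t = [set a; b] & fam_part t = [set a; b] :
    fam_spec t (G4 R a [set b])
| FamTwo a b of a != b & fam_part t = [set a; b] & (2 < #|fam_set t|)%N :
    fam_spec t (G23 R (fam_set t :\: [set a; b]) a b)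
| FamOne i of fam_part t = [set i] & ~~ odd #|fam_set t| & (3 < #|fam_set t|)%N :
    fam_spec t (G4 R i (fam_set t :\ i)).

Lemma fam_part_sub t : fam_part t \subset fam_set t.
Proof. by have /andP[] := valP t. Qed.

Lemma fam_spec_ex t : exists f, fam_spec t f.
Proof.
have BM := fam_part_sub t.
have /andP[_] := valP t; rewrite -/(fam_set t) -/(fam_part t) => /orP[c2|/and3P[/cards1P[i Bi] eM M4]].
  have /cards2P[a [b [ab Bab]]] := c2; have := subset_leq_card BM; rewrite (eqP c2) leq_eqVlt.
  case/orP => [M2|M3]; last by exists (G23 R (fam_set t :\: [set a; b]) a b); apply: FamTwo.
  exists (G4 R a [set b]); apply: FamPair => //.
  by rewrite -Bab; apply/eqP; rewrite eq_sym eqEcard BM -(eqP M2) (eqP c2).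
by exists (G4 R i (fam_set t :\ i)); apply: FamOne.
Qed.

(** For two indices both choices of the distinguished one give the same quadric, which is why
    [fam_cond] lets singletons start at four indices. *)
Lemma G4_sym a b : a != b -> G4 R a [set b] = G4 R b [set a].
Proof.
move=> ab; have [ab1 ba1] : a \notin [set b] /\ b \notin [set a] by rewrite !inE [b == a]eq_sym ab.
rewrite (G4E R ab1) ?cards1 // (G4E R ba1) ?cards1 //.
by rewrite !big_set1 !setDv [ [set b; a] ]setUC.
Qed.

Lemma fam_spec_uniq t f g : fam_spec t f -> fam_spec t g -> f = g \/ f = - g.
Proof.
have two a b c d : a != b -> [set a; b] = [set c; d] -> (a = c /\ b = d) \/ (a = d /\ b = c).
  by move=> _ /eqP; rewrite eq_set2 => /orP[] /andP[/eqP -> /eqP ->]; [left|right].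
have s2 a b : a != b -> #|[set a; b]| = 2 by move=> ab; rewrite cards2 ab.
case=> [a b ab Mab Bab|a b ab Bab M3|i Bi eM M4]; case=> [c d cd Mcd Bcd|c d cd Bcd M3'|j Bj eM' M4'].
- rewrite Bab in Bcd; case: (two _ _ _ _ ab Bcd) => -[-> ->]; left => //.
  by apply: G4_sym; rewrite eq_sym.
- by move: M3'; rewrite Mab s2.
- by move: M4'; rewrite Mab s2.
- by move: M3; rewrite Mcd s2.
- rewrite Bab in Bcd; case: (two _ _ _ _ ab Bcd) => -[-> ->]; first by left.
  rewrite G23_sym [ [set d; c] ]setUC; case: ifP => _; rewrite ?scale1r ?scaleN1r; by [left|right].
- by have := s2 a b ab; rewrite -Bab Bj cards1.
- by move: M4; rewrite Mcd s2.
- by have := s2 c d cd; rewrite -Bcd Bi cards1.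
- by left; have /set1_inj -> : [set i] = [set j] by rewrite -Bi -Bj.
Qed.

Lemma fam_oneE t : fam_one t != set0 -> fam_one t = fam_part t.
Proof. by rewrite /fam_one; case: ifP; rewrite ?eqxx. Qed.

Definition fam_wt t : 'I_n -> nat := type_wt (fam_zero t) (fam_one t).

Lemma type_wt_le2 Z O k : (type_wt Z O k <= 2)%N.
Proof. by rewrite /type_wt; case: ifP => // _; case: ifP. Qed.

Lemma fam_spec_hw t f : fam_spec t f -> wt_vec (fam_wt t) f /\ minor_map f = 0.
Proof.
have BM := fam_part_sub t.
case=> [a b ab Mab Bab|a b ab Bab M3|i Bi eM M4]; rewrite /fam_wt /fam_zero /fam_one.
- rewrite Bab Mab cards2 ab /= setD0.
  have oM : odd #|[set b]| by rewrite cards1.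
  by split; [apply: G4_wt_vec|apply: minor_map_G4]; rewrite ?inE.
- rewrite Bab cards2 ab /= ifT; last by rewrite neq_ltn M3 orbT.
  have aM : a \notin fam_set t :\: [set a; b] by rewrite in_setD set21.
  have bM : b \notin fam_set t :\: [set a; b] by rewrite in_setD set22.
  by split; [apply: G23_wt_vec|apply: minor_map_G23].
rewrite Bi cards1 /= setD0; have iM : i \in fam_set t by rewrite (subsetP BM) // Bi set11.
have oM : odd #|fam_set t :\ i| by move: eM; rewrite (cardsD1 i) iM /= negbK.
split; last by apply: minor_map_G4; rewrite ?setD11.
by have := G4_wt_vec R (negbT (setD11 i (fam_set t))) oM; rewrite setD1K.
Qed.

Lemma fam_one_sub t : fam_one t \subset fam_set t.
Proof. by rewrite /fam_one; case: ifP => _; rewrite ?sub0set ?fam_part_sub. Qed.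

Lemma fam_setE t : fam_set t = fam_zero t :|: fam_one t.
Proof.
apply/setP => k; rewrite /fam_zero in_setU in_setD.
by case: (boolP (k \in fam_one t)) => [/(subsetP (fam_one_sub t)) ->|_]; rewrite ?orbF.
Qed.

Lemma type_wt_inj Z O Z' O' : [disjoint Z & O] -> [disjoint Z' & O'] ->
  type_wt Z O =1 type_wt Z' O' -> Z = Z' /\ O = O'.
Proof.
move=> dZ dZ' e; have ez k : (k \in Z) = (k \in Z').
  by have := e k; rewrite /type_wt; do 4?case: (_ \in _).
split; apply/setP => k //; have := e k; rewrite /type_wt ez.
case: (boolP (k \in Z')) => [kZ _|_]; last by do 2?case: (_ \in _).
rewrite (negPf (disjoint_setP _ _ dZ' _ kZ)); apply/negbTE.
by apply: (disjoint_setP _ _ dZ); rewrite ez.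
Qed.

Lemma fam_disjoint t : [disjoint fam_zero t & fam_one t].
Proof. by apply/disjoint_setP => k /setDP[]. Qed.

Lemma fam_wt_inj t t' : fam_wt t =1 fam_wt t' -> fam_set t = fam_set t' /\ fam_one t = fam_one t'.
Proof.
move=> e; have [ez eo] := type_wt_inj (fam_disjoint t) (fam_disjoint t') e.
by rewrite !fam_setE ez eo.
Qed.

Lemma fam_eq t t' : fam_set t = fam_set t' -> fam_part t = fam_part t' -> t = t'.
Proof. by move=> e e'; apply: val_inj; rewrite [LHS]surjective_pairing [RHS]surjective_pairing -!/(fam_set _) -!/(fam_part _) e e'. Qed.

Section Free.
Variable q : fam -> PA.
Hypothesis spec : forall t, fam_spec t (q t).

(** A weight determines [fam_set] and [fam_one], hence the quadric, except in class (iv), where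
    every index i of the set gives one. There the coefficient at {a, b} is the sum of the
    coefficients of the quadrics of a and b. *)
Lemma fam_free_wt w (c : fam -> R) :
  \sum_(t | [forall k, fam_wt t k == w k]) c t *: q t = 0 ->
  forall t, fam_wt t =1 w -> c t = 0.
Proof.
move=> c0 t tw; have BM := fam_part_sub t; have key D K D' K' : bc D K D' K' (\sum_(t' | [forall k, fam_wt t' k == w k]) c t' *: q t') = 0 by rewrite c0 bc0.
have same t' : [forall k, fam_wt t' k == w k] -> fam_set t' = fam_set t /\ fam_one t' = fam_one t.
  by move/forallP => t'w; apply: fam_wt_inj => k; rewrite tw (eqP (t'w k)).
have tW : [forall k, fam_wt t k == w k] by apply/forallP => k; rewrite tw.
have uniq_t : (forall t', fam_set t' = fam_set t -> fam_one t' = fam_one t -> t' = t) ->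
    (exists D K D' K', bc D K D' K' (q t) != 0) -> c t = 0.
  move=> ut [D [K [D' [K' nz]]]]; have := key D K D' K'; rewrite (bigD1 t) //= big1 => [|t' /andP[/same[e1 e2]]]; last first.
    by rewrite (ut t' e1 e2) eqxx.
  by rewrite addr0 bcZ => /eqP; rewrite mulf_eq0 (negPf nz) orbF => /eqP.
have qt := spec t; have part2 t' : fam_one t' != set0 -> fam_part t' = fam_one t' by move/fam_oneE.
have [Bo|Bo] := eqVneq (fam_one t) set0; last first.
  apply: uniq_t => [t' e1 e2|].
    by apply: fam_eq e1 _; rewrite !part2 ?e2.
  move: Bo; rewrite /fam_one; case: qt => [a b ab Mab Bab|a b ab Bab M3|i Bi eM M4].
  - by rewrite Mab cards2 ab eqxx andbF eqxx.
  - have [l lM] : exists l, l \in fam_set t :\: [set a; b].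
      apply/set0Pn; rewrite -card_gt0 cardsD -Bab (setIidPr BM) Bab cards2 ab.
      by rewrite subn_gt0.
    by exists [set a; l], set0, [set b; l], ((fam_set t :\: [set a; b]) :\ l);
       rewrite bc_G23 ?in_setD ?set21 ?set22 ?invr_eq0 ?pnatr_eq0 // -in_setD.
  by rewrite Bi cards1 eqxx.
case: qt uniq_t (Bo) => [a b ab Mab Bab|a b ab Bab M3|i Bi eM M4] uniq_t.
- move=> _; apply: uniq_t => [t' e1 e2|].
    apply: fam_eq => //; rewrite Bab -Mab -e1; apply/eqP; rewrite eqEcard fam_part_sub e1 Mab cards2 ab.
    have /andP[_] := valP t'; rewrite -/(fam_set t') -/(fam_part t') e1 Mab cards2 ab.
    by rewrite andbF orbF => /eqP ->.
  exists [set a; b], set0, [set a; b], ((a |: [set b]) :\: [set a; b]).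
  by rewrite bc_G4 ?inE ?eqxx ?cards1 ?orbT ?oner_eq0.
- rewrite /fam_one Bab cards2 ab ifT ?(gtn_eqF M3) //= => /setP/(_ a).
  by rewrite set21 inE.
move=> _; have iM : i \in fam_set t by rewrite (subsetP BM) // Bi set11.
have ex j : j \in fam_set t -> exists t', fam_set t' = fam_set t /\ fam_part t' = [set j].
  move=> jM; have cond : fam_cond (fam_set t, [set j]) by rewrite /fam_cond /= sub1set jM cards1 eM M4.
  by exists (Sub (fam_set t, [set j]) cond); rewrite /fam_set /fam_part SubK.
have wt1 t' j : fam_set t' = fam_set t -> fam_part t' = [set j] -> [forall k, fam_wt t' k == w k].
  move=> e1 e2; apply/forallP => k; rewrite -tw /fam_wt.
  have o' : fam_one t' = set0 by rewrite /fam_one e2 cards1.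
  by rewrite /fam_zero o' Bo e1.
have pair t1 t2 a b : fam_set t1 = fam_set t -> fam_set t2 = fam_set t ->
    fam_part t1 = [set a] -> fam_part t2 = [set b] -> a != b -> c t1 + c t2 = 0.
  move=> e1 e2 p1 p2 ab.
  have aM : a \in fam_set t by rewrite -e1 (subsetP (fam_part_sub t1)) // p1 set11.
  have bM : b \in fam_set t by rewrite -e2 (subsetP (fam_part_sub t2)) // p2 set11.
  have coef t' : [forall k, fam_wt t' k == w k] ->
      bc [set a; b] set0 [set a; b] (fam_set t :\: [set a; b]) (q t') = ((t' == t1) || (t' == t2))%:R.
    move=> t'w; have [e' o'] := same t' t'w; case: (spec t') => [x y xy Mxy _|x y xy Bxy M3|x Bx _ _].
    - by move: M4; rewrite -e' Mxy cards2 xy.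
    - have := Bo; rewrite -o' /fam_one Bxy cards2 xy ifT ?(gtn_eqF M3) //= => /setP/(_ x).
      by rewrite set21 inE.
    have xM : x \in fam_set t' by rewrite (subsetP (fam_part_sub t')) // Bx set11.
    rewrite -e' -{1}(setD1K xM) bc_G4 ?setD11 ?setD1K // ?e' //; last first.
      by move: eM; rewrite -e' (cardsD1 x) xM /= negbK.
    congr _%:R; congr (_ || _); apply/eqP/eqP => [E|E].
    + by apply: fam_eq; rewrite ?e' ?e1 // Bx p1 E.
    + by apply: set1_inj; rewrite -Bx E p1.
    + by apply: fam_eq; rewrite ?e' ?e2 // Bx p2 E.
    + by apply: set1_inj; rewrite -Bx E p2.
  have t12 : t2 != t1 by apply: contraNneq ab => E; apply/eqP/set1_inj; rewrite -p1 -p2 E.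
  have := key [set a; b] set0 [set a; b] (fam_set t :\: [set a; b]); rewrite bc_sum.
  rewrite (bigD1 t1) ?(wt1 _ _ e1 p1) //= (bigD1 t2) ?(wt1 _ _ e2 p2) //= big1 ?addr0; last first.
    by move=> t' /andP[/andP[t'w /negPf n1] /negPf n2]; rewrite bcZ coef // n1 n2 mulr0.
  by rewrite !bcZ !coef ?(wt1 _ _ e1 p1) ?(wt1 _ _ e2 p2) // !eqxx orbT !mulr1.
(* Three distinct indices suffice: if c_i + c_j, c_i + c_k and c_j + c_k all vanish, so does c_i. *)
have [j jM ij] : exists2 j, j \in fam_set t & i != j.
  have : (0 < #|fam_set t :\ i|)%N by move: M4; rewrite (cardsD1 i) iM; case: #|_|.
  by case/card_gt0P => j; rewrite !inE => /andP[ji jM]; exists j; rewrite // eq_sym.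
have [k kM /andP[ik jk]] : exists2 k, k \in fam_set t & (i != k) && (j != k).
  have : (0 < #|(fam_set t :\ i) :\ j|)%N.
    by move: M4; rewrite (cardsD1 i) iM (cardsD1 j (fam_set t :\ i)) !inE eq_sym ij jM; case: #|_|.
  case/card_gt0P => k; rewrite !inE => /and3P[kj ki kM]; exists k => //.
  by rewrite ![_ == k]eq_sym ki kj.
have [tj [ej pj]] := ex j jM; have [tk [ek pk]] := ex k kM.
have h1 := pair t tj i j erefl ej Bi pj ij.
have h2 := pair t tk i k erefl ek Bi pk ik.
have h3 := pair tj tk j k ej ek pj pk jk.
by lra.
Qed.

End Free.

End Family.

Lemma perm_of_uniq (T : finType) (s1 s2 : seq T) : uniq s1 -> uniq s2 ->
  size s1 = #|T| -> size s2 = #|T| -> exists s : {perm T}, map s s1 = s2.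
Proof.
case: s1 => [|x0 s1'] u1 u2 z1 z2.
  by exists 1%g; case: s2 u2 z2 => // x s2 _; rewrite -z1.
set s1 := x0 :: s1' in u1 z1 *.
have mem x : x \in s1.
  have e : #|s1| = #|T| by rewrite (card_uniqP u1) z1.
  by rewrite (subset_cardP e (subset_predT _)).
have inj : injective (fun x => nth x0 s2 (index x s1)).
  move=> x y /eqP; rewrite nth_uniq ?z2 -?z1 ?index_mem // => /eqP e.
  by rewrite -(nth_index x0 (mem x)) e nth_index.
exists (perm inj); apply: (@eq_from_nth _ x0); rewrite size_map ?z1 ?z2 // => i iz.
by rewrite (nth_map x0) ?z1 // permE index_uniq ?z1.
Qed.

Lemma perm_of_sets (T : finType) (A B : {set T}) (x y a b : T) : #|A| = #|B| ->
  x != y -> x \in A -> y \in A -> a != b -> a \in B -> b \in B ->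
  exists s : {perm T}, [/\ s @: A = B, s x = a & s y = b].
Proof.
move=> AB; pose sq (C : {set T}) c d := c :: d :: enum ((C :\ c) :\ d).
have sqP (C : {set T}) c d : c != d -> c \in C -> d \in C ->
    [/\ uniq (sq C c d ++ enum (~: C)), size (sq C c d) = #|C| & sq C c d =i C].
  move=> cd cC dC; have i : sq C c d =i C.
    move=> z; rewrite !inE mem_enum !inE; case: (eqVneq z c) => [->|_]; rewrite ?cC //=.
    by case: (eqVneq z d) => [->|_]; rewrite ?dC.
  have u : uniq (sq C c d) by rewrite /= !inE !mem_enum !inE !eqxx (negPf cd) /= ?andbF enum_uniq.
  split=> //; last by move/card_uniqP: u => <-; apply: eq_card; apply: i.
  rewrite cat_uniq u enum_uniq andbT; apply/hasPn => z; rewrite mem_enum inE => zC.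
  by rewrite [_ \in _]i.
move=> xy xA yA ab aB bB; have [uA zA iA] := sqP A x y xy xA yA; have [uB zB iB] := sqP B a b ab aB bB.
have [||s] := perm_of_uniq uA uB; try by rewrite size_cat ?zA ?zB -cardE cardsC.
rewrite map_cat => /eqP; rewrite eqseq_cat ?size_map ?zA ?zB // => /andP[/eqP e _].
have sA : s @: A = B.
  apply/eqP; rewrite eqEcard card_imset ?AB ?leqnn ?andbT; last exact: perm_inj.
  by apply/subsetP => _ /imsetP[z zinA ->]; rewrite -iB -e map_f // iA.
by exists s; split=> //; case: e.
Qed.

(** * The family and the listed quadrics *)

Section Listed.
Context (R : realType) (n : nat).
Local Notation PA := (ringPA R n).
Implicit Types (D K L M N Z O W B : {set 'I_n}) (i j k a b l x y z : 'I_n).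

Lemma card_seg m : (m <= n)%N -> #|seg n m| = m.
Proof.
have inj (mn : (m <= n)%N) : injective (widen_ord mn) by move=> x y [] /val_inj.
move=> mn; rewrite -[RHS]card_ord -(card_imset _ (inj mn)).
apply: eq_card => k; rewrite inE; apply/idP/imsetP => [km|[k' _ ->]]; last exact: (ltn_ord k').
by exists (Ordinal km) => //; apply: val_inj.
Qed.

Lemma quad1E i1 i2 : i1 != i2 -> quad1 R i1 i2 = G4 R i1 [set i2].
Proof.
move=> i12; rewrite /quad1 /G4 big_set1 setDv (alt_sum_split _ _ (set11 i2)) setDv.
rewrite /TT /alt_sum !(big_pred1 set0) => [|K|K|K]; rewrite /= ?subset0 //.
by rewrite cards0 expr0 !mul1r setD0 !setU0 !p_uvar a_uvar expr2 mulrC [p in _ - p]mulrC.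
Qed.

Lemma quad3E m i1 i2 : i1 = 0%N :> nat -> i2 = 1%N :> nat ->
  quad3 R m i1 i2 = \sum_(l in seg n m :\: [set i1; i2])
    TT R [set i1; l] [set i2; l] ((seg n m :\: [set i1; i2]) :\ l).
Proof.
move=> e1 e2; apply: eq_big => [j|j _].
  by rewrite !inE -!val_eqE /= e1 e2; case: (val j) => [|[|k]].
rewrite /TT /alt_sum setDDl; apply: eq_bigr => K _.
by rewrite !a_uvar setDDl.
Qed.

Lemma card_segD2 m i1 i2 : (2 <= m <= n)%N -> i1 = 0%N :> nat -> i2 = 1%N :> nat ->
  #|seg n m :\: [set i1; i2]| = (m - 2)%N /\ [set i1; i2] \subset seg n m.
Proof.
move=> /andP[m2 mn] e1 e2; have s12 : [set i1; i2] \subset seg n m.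
  by rewrite subUset !sub1set !inE e1 e2 (leq_trans _ m2).
by rewrite cardsD (setIidPr s12) card_seg // cards2 -val_eqE /= e1 e2.
Qed.

Lemma quad2E m i1 i2 : (2 <= m <= n)%N -> odd m -> i1 = 0%N :> nat -> i2 = 1%N :> nat ->
  quad2 R m i1 i2 = G23 R (seg n m :\: [set i1; i2]) i1 i2.
Proof.
move=> mn om e1 e2; have [cM _] := card_segD2 mn e1 e2.
rewrite /quad2 quad3E // /G23 cM oddB ?om /=; last by case/andP: mn.
congr (_ + _); rewrite /TT /alt_sum; apply: eq_bigr => L _.
by rewrite p_uvar a_uvar setDDl.
Qed.

Lemma quad3_G23 m i1 i2 : (2 <= m <= n)%N -> ~~ odd m -> i1 = 0%N :> nat -> i2 = 1%N :> nat ->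
  quad3 R m i1 i2 = G23 R (seg n m :\: [set i1; i2]) i1 i2.
Proof.
move=> mn em e1 e2; have [cM _] := card_segD2 mn e1 e2.
rewrite quad3E // /G23 cM oddB ?(negPf em) /= ?add0r //; by case/andP: mn.
Qed.

(** Passing to the complement preserves the summand because [#|M|] is even, and it exchanges the two
    possible comparisons of ranks; equal ranks are excluded as [L = M :\: L] would force M to be
    empty. *)
Lemma part_rep_sum (F : {set 'I_n} -> PA) M : M != set0 -> ~~ odd #|M| ->
  alt_sum F F M = 2%:R * \sum_(L | part_rep M L) (-1) ^+ #|L| * F L * F (M :\: L).
Proof.
move=> M0 eM; rewrite /alt_sum (bigID (fun L : {set 'I_n} => (enum_rank L <= enum_rank (M :\: L))%N)) /=.
rewrite [2%:R * _]mulr_natl mulr2n; congr (_ + _).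
have DD L : L \subset M -> M :\: (M :\: L) = L by move=> LM; rewrite setDDr setDv set0U (setIidPr LM).
rewrite (reindex_onto (fun L => M :\: L) (fun L => M :\: L)) => [|L /andP[LM _]] /=; last exact: DD.
apply: eq_big => [L|L /andP[/andP[_ _] /eqP LM]].
  rewrite subsetDl /= /part_rep; have [LM|nLM] := boolP (L \subset M); last first.
    by apply/negP => /andP[_ /eqP E]; case/negP: nLM; rewrite -E subsetDl.
  rewrite DD // eqxx andbT -ltnNge ltn_neqAle; apply: andb_idl => _.
  apply: contraNneq M0 => /val_inj/enum_rank_inj E; apply/eqP/setP => x; rewrite inE.
  by have := congr1 (fun A : {set 'I_n} => x \in A) E; move/subsetP/(_ x): LM; rewrite /= !inE; case: (x \in L); case: (x \in M) => // ->.
have LsM : L \subset M by rewrite -LM subsetDl.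
rewrite LM mulrAC; congr (_ * _ * _); rewrite -signr_odd -[RHS]signr_odd; congr (_ ^+ nat_of_bool _).
by move: eM; rewrite -(cardsID L M) (setIidPr LsM) oddD; case: (odd #|L|); case: (odd _).
Qed.

Lemma quad4E m i1 : (2 < m <= n)%N -> ~~ odd m -> i1 = 0%N :> nat ->
  quad4 R m i1 = G4 R i1 (seg n m :\ i1).
Proof.
move=> /andP[m2 mn] em e1; have iS : i1 \in seg n m by rewrite inE e1 (leq_trans _ m2).
have cS := card_seg mn.
rewrite G4E ?setD11 //; last by move: em; rewrite -{1}cS (cardsD1 i1) iS /= negbK.
have n2 : 2%:R != 0 :> R by rewrite pnatr_eq0.
rewrite setD1K // /TT part_rep_sum; first 1 last.
- by apply/set0Pn; exists i1.
- by rewrite cS.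
rewrite mulr_natl -scaler_nat scalerA mulVf // scale1r; congr (_ + _).
  by apply: eq_bigr => L _; rewrite !p_uvar.
rewrite mulr_sumr; apply: eq_big => [j|j /andP[j1 jm]].
  by rewrite !inE -val_eqE /= e1 lt0n.
have ji : j != i1 by rewrite -val_eqE /= e1 -lt0n.
have cD : #|seg n m :\ i1 :\ j| = (m - 2)%N.
  by rewrite setDDl cardsD (setIidPr _) ?cS ?cards2 1?eq_sym ?ji // subUset !sub1set iS inE.
rewrite part_rep_sum ?cD; first 1 last.
- by rewrite -card_gt0 cD subn_gt0.
- by rewrite oddB ?(negPf em) // ltnW.
rewrite setDDl; congr (_ * _); apply: eq_bigr => K _.
by rewrite !a_uvar.
Qed.

Lemma listed_fam_spec (f : PA) : listed_quadric f -> exists t : fam n, fam_spec t f.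
Proof.
have mk M B : fam_cond (M, B) -> exists t : fam n, fam_set t = M /\ fam_part t = B.
  by move=> c; exists (Sub (M, B) c); rewrite /fam_set /fam_part SubK.
case=> s [f0 [b ->]]; have inj := @perm_inj _ s.
have d12 (i1 i2 : 'I_n) : i1 = 0%N :> nat -> i2 = 1%N :> nat -> i1 != i2.
  by move=> e1 e2; rewrite -val_eqE /= e1 e2.
have two m (i1 i2 : 'I_n) : i1 = 0%N :> nat -> i2 = 1%N :> nat -> (2 < m <= n)%N ->
    exists t : fam n, fam_spec t (perm_act s (G23 R (seg n m :\: [set i1; i2]) i1 i2)).
  move=> e1 e2 /andP[m2 mn]; have i12 := d12 _ _ e1 e2.
  have [|_ s12] := card_segD2 _ e1 e2 (m := m); first by rewrite mn ltnW.
  have s12' : s @: [set i1; i2] = [set s i1; s i2] by rewrite imsetU1 imset_set1.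
  have ss : s i1 != s i2 by rewrite (inj_eq inj).
  have [|t [tM tB]] := mk (s @: seg n m) [set s i1; s i2].
    by rewrite /fam_cond /= -s12' imsetS // s12' cards2 ss.
  exists t; rewrite perm_act_G23 imset_permD s12' -tM; apply: FamTwo => //.
  by rewrite tM card_imset // card_seg.
case: b => [i1 i2 e1 e2|m i1 i2 e1 e2 /andP[m3 mn] om|m i1 i2 e1 e2 /andP[m4 mn] em|m i1 e1 /andP[m3 mn] em].
- have i12 := d12 _ _ e1 e2; rewrite quad1E // perm_act_G4 imset_set1.
  have ss : s i1 != s i2 by rewrite (inj_eq inj).
  have [|t [tM tB]] := mk [set s i1; s i2] [set s i1; s i2].
    by rewrite /fam_cond /= subxx cards2 ss.
  by exists t; apply: FamPair.
- by rewrite quad2E ?(ltnW m3) //; apply: two; rewrite ?m3.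
- by rewrite quad3_G23 ?(leq_trans _ m4) //; apply: two; rewrite ?(leq_trans _ m4).
rewrite quad4E ?(ltnW m3) // perm_act_G4 imset_permD imset_set1.
have cs : #|s @: seg n m| = m by rewrite card_imset // card_seg.
have [|t [tM tB]] := mk (s @: seg n m) [set s i1].
  rewrite /fam_cond /= sub1set cards1 cs em m3 orbT andbT imset_f // inE e1.
  exact: leq_trans m3.
by exists t; rewrite -tM; apply: FamOne; rewrite // tM cs.
Qed.

Lemma fam_spec_listed (t : fam n) (f : PA) : fam_spec t f -> listed_quadric f.
Proof.
have BM := fam_part_sub t; have card2 a b M : a != b -> a \in M -> b \in M ->
    (2 <= #|M|)%N /\ (#|M| <= n)%N.
  move=> ab aM bM; split; last by rewrite -[X in (_ <= X)%N]card_ord max_card.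
  have : [set a; b] \subset M by rewrite subUset !sub1set aM.
  by move/subset_leq_card; rewrite cards2 ab.
have pts a b M : a != b -> a \in M -> b \in M -> exists (s : 'S_n) i1 i2,
    [/\ s @: seg n #|M| = M, s i1 = a, s i2 = b, i1 = 0%N :> nat & i2 = 1%N :> nat].
  move=> ab aM bM; have [M2 Mn] := card2 a b M ab aM bM.
  pose i1 := Ordinal (leq_trans (ltnW M2) Mn : (0 < n)%N).
  pose i2 := Ordinal (leq_trans M2 Mn : (1 < n)%N).
  have [||||s [sM s1 s2]] := @perm_of_sets _ (seg n #|M|) M i1 i2 a b _ _ _ _ ab aM bM; rewrite ?inE //=.
  - exact: card_seg.
  - exact: ltnW.
  by exists s, i1, i2.
case=> [a b ab Mab Bab|a b ab Bab M3|i Bi eM M4].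
- have [s [i1 [i2 [_ <- <- e1 e2]]]] := pts a b [set a; b] ab (set21 a b) (set22 a b).
  exists s, (quad1 R i1 i2); split; first exact: Class1.
  by rewrite quad1E ?perm_act_G4 ?imset_set1 // -val_eqE /= e1 e2.
- have [aM bM] : a \in fam_set t /\ b \in fam_set t by rewrite !(subsetP BM) // Bab ?set21 ?set22.
  have [M2 Mn] := card2 _ _ _ ab aM bM.
  have [s [i1 [i2 [sM <- <- e1 e2]]]] := pts _ _ _ ab aM bM.
  have -> : G23 R (fam_set t :\: [set s i1; s i2]) (s i1) (s i2)
      = perm_act s (G23 R (seg n #|fam_set t| :\: [set i1; i2]) i1 i2).
    by rewrite perm_act_G23 imset_permD sM imsetU1 imset_set1.
  have [oM|eM] := boolP (odd #|fam_set t|).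
    exists s, (quad2 R #|fam_set t| i1 i2); split; first by apply: Class2; rewrite ?M3.
    by rewrite quad2E ?M2.
  exists s, (quad3 R #|fam_set t| i1 i2); split; last by rewrite quad3_G23 ?M2.
  by apply: Class3; rewrite // Mn andbT; case: #|_| M3 eM => [|[|[|[|]]]].
have iM : i \in fam_set t by rewrite (subsetP BM) // Bi set11.
have [j jM ij] : exists2 j, j \in fam_set t & i != j.
  have : (0 < #|fam_set t :\ i|)%N by move: M4; rewrite (cardsD1 i) iM; case: #|_|.
  by case/card_gt0P => j; rewrite !inE => /andP[ji jM]; exists j; rewrite // eq_sym.
have [M2 Mn] := card2 _ _ _ ij iM jM.
have [s [i1 [i2 [sM <- _ e1 _]]]] := pts _ _ _ ij iM jM.
exists s, (quad4 R #|fam_set t| i1); split; first by apply: Class4; rewrite ?M4.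
by rewrite quad4E ?(ltnW M4) // perm_act_G4 imset_permD sM imset_set1.
Qed.

End Listed.

(** * The dimension *)

Section Count.
Variable n : nat.
Implicit Types (M B Z O : {set 'I_n}).

Lemma prod_type_wt Z O : [disjoint Z & O] ->
  (\prod_k (type_wt Z O k).+1 = 2 ^ #|O| * 3 ^ (n - #|Z :|: O|))%N.
Proof.
move=> ZO; rewrite (bigID (fun k => k \in O)) /=; congr (_ * _)%N.
  rewrite -prod_nat_const; apply: eq_bigr => k kO; rewrite /type_wt kO.
  by rewrite ifN //; apply/negP => /(disjoint_setP _ _ ZO); rewrite kO.
have <- : #|~: (Z :|: O)| = (n - #|Z :|: O|)%N by have := cardsC (Z :|: O); rewrite card_ord; lia.
rewrite -prod_nat_const big_mkcond [RHS]big_mkcond; apply: eq_bigr => k _ /=.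
rewrite /type_wt !inE; case: (k \in O); rewrite ?orbT ?orbF //.
by case: (k \in Z).
Qed.

(** The contribution of one set with m elements: outside it every index contributes a factor 3, each
    of the 'C(m, 2) distinguished pairs a factor 4 from its two indices of weight one, or 1 in class
    (i), and class (iv) adds m modules. *)
Definition fam_dim (m : nat) : nat :=
  (3 ^ (n - m) * ('C(m, 2) * (if m == 2 then 1 else 4) + (if ~~ odd m && (3 < m) then m else 0)))%N.

Lemma prod_fam_wt (t : fam n) : (\prod_k (fam_wt t k).+1 =
  3 ^ (n - #|fam_set t|) * (if (#|fam_part t| == 2) && (#|fam_set t| != 2) then 4 else 1))%N.
Proof.
rewrite prod_type_wt ?fam_disjoint // -fam_setE mulnC /fam_one.
by case: ifP => [/andP[/eqP -> _]|_]; rewrite ?cards0.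
Qed.

Lemma card_parts M k : #|[set B : {set 'I_n} | (B \subset M) && (#|B| == k)]| = 'C(#|M|, k).
Proof. by rewrite cards_draws. Qed.

Lemma sum_fam_wt : (\sum_(t : fam n) \prod_k (fam_wt t k).+1 =
  \sum_(0 <= m < n.+1) 'C(n, m) * fam_dim m)%N.
Proof.
pose F M B := (3 ^ (n - #|M|) * (if (#|B| == 2) && (#|M| != 2) then 4 else 1))%N.
rewrite (eq_bigr (fun t : fam n => F (val t).1 (val t).2)) => [|t _]; last exact: prod_fam_wt.
have -> : (\sum_(t : fam n) F (val t).1 (val t).2 = \sum_(p | fam_cond p) F p.1 p.2)%N.
  rewrite [RHS](reindex_omap (val : fam n -> _) insub) => [|p cp]; last by rewrite insubT.
  by apply: eq_bigl => t; rewrite valK (valP t) eqxx.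
rewrite (eq_bigl (fun p : {set 'I_n} * {set 'I_n} => xpredT p.1 && fam_cond (p.1, p.2))) => [|[M B]] //.
rewrite -(pair_big_dep xpredT (fun M B => fam_cond (M, B)) F) /=.
have inner M : (\sum_(B | fam_cond (M, B)) F M B = fam_dim #|M|)%N.
  rewrite -big_distrr /= /fam_dim; congr (_ * _)%N.
  rewrite (bigID (fun B : {set 'I_n} => #|B| == 2)) /=; congr (_ + _)%N.
    rewrite -card_parts -sum_nat_const; apply: eq_big => [B|B /andP[_ ->]].
      by rewrite inE /fam_cond /=; case: (#|B| == 2); rewrite ?andbF ?andbT.
    by case: eqP.
  case: ifP => c; last first.
    by rewrite big1 // => B; rewrite /fam_cond /= c !andbF orbF => /andP[/andP[_ ->]].
  rewrite -[in RHS](bin1 #|M|) -card_parts -sum1_card; apply: eq_big => [B|B /andP[_ /negPf ->]] //.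
  rewrite inE /fam_cond /= c andbT.
  by case: (eqVneq #|B| 2) => [->|]; rewrite ?andbF ?andbT.
under eq_bigr => M _ do rewrite inner.
rewrite big_mkord (partition_big (fun M : {set 'I_n} => inord #|M| : 'I_n.+1) xpredT) //=.
have cM M : (#|M| < n.+1)%N by rewrite ltnS -[X in (_ <= X)%N]card_ord max_card.
apply: eq_bigr => m _; rewrite (eq_bigr (fun=> fam_dim m)) => [|M /eqP <-]; last by rewrite inordK.
have := card_draws 'I_n m; rewrite card_ord => <-.
rewrite -sum_nat_const; apply: eq_bigl => M; rewrite inE -val_eqE /= inordK //.
Qed.

Lemma sum_even_from4 (F : nat -> nat) N :
  (\sum_(0 <= m < N.+1) (if ~~ odd m && (3 < m) then F m else 0) =
   \sum_(2 <= k < (N./2).+1) F (2 * k))%N.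
Proof.
elim: N => [|N IH]; first by rewrite big_nat1 big_geq.
rewrite big_nat_recr //= IH uphalf_half.
have [oN|eN] := boolP (odd N); last by rewrite add0n addn0.
rewrite add1n /=; have NE := odd_double_half N; rewrite oN -mul2n add1n in NE.
have [N3|N3] := ltnP 2 N.
  have h : (2 <= (N./2).+1)%N by lia.
  by rewrite [RHS]big_nat_recr //= mulnS add2n NE ifT ?addn0 //; lia.
have -> : N = 1%N by lia.
by rewrite !big_geq.
Qed.

Lemma fam_dim_sum : (\sum_(0 <= m < n.+1) 'C(n, m) * fam_dim m =
  3 ^ (n - 2) * 'C(n, 2)
  + 4 * (\sum_(3 <= m < n.+1) 3 ^ (n - m) * 'C(n, m) * 'C(m, 2))
  + \sum_(2 <= k < (n./2).+1) 2 * k * 3 ^ (n - 2 * k) * 'C(n, 2 * k))%N.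
Proof.
rewrite -(sum_even_from4 (fun m => m * 3 ^ (n - m) * 'C(n, m))%N).
pose G m := ('C(n, m) * (3 ^ (n - m) * ('C(m, 2) * (if m == 2 then 1 else 4))))%N.
rewrite (eq_bigr (fun m => G m + (if ~~ odd m && (3 < m) then m * 3 ^ (n - m) * 'C(n, m) else 0)))%N; last first.
  move=> m _; rewrite /fam_dim /G mulnDr mulnDr; congr (_ + _)%N.
  by case: ifP => _; rewrite ?muln0 //; ring.
rewrite big_split /=; congr (_ + _)%N.
have G0 m : (n < m)%N -> G m = 0%N by move=> nm; rewrite /G bin_small.
have [n2|n2] := leqP 2 n.
  have g0 : G 0%N = 0%N by rewrite /G (@bin_small 0) ?muln0.
  have g1 : G 1%N = 0%N by rewrite /G (@bin_small 1) ?muln0.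
  have g2 : G 2 = (3 ^ (n - 2) * 'C(n, 2))%N by rewrite /G binn !muln1 mulnC.
  rewrite big_ltn // big_ltn 1?ltnW // big_ltn // g0 g1 g2 !add0n; congr (_ + _)%N.
  rewrite big_distrr /=; apply: eq_big_nat => m /andP[m3 _]; rewrite /G ifN ?gtn_eqF //.
  by ring.
(* For n < 2 everything vanishes; the binomial coefficient 'C(n, 2) = 0 absorbs the truncated
   exponent n - 2. *)
rewrite [in RHS]big_geq ?(leqW n2) // bin_small // !muln0.
rewrite big_nat_cond big1 // => m /andP[/andP[_ mn] _].
by rewrite /G (@bin_small m) ?mul0n ?muln0 // (leq_ltn_trans _ n2).
Qed.

End Count.

(** * The degree-two part of the ideal *)

Section Assembly.
Context (R : realType) (n : nat).
Local Notation PA := (ringPA R n).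
Local Notation Q := (quadric R n).
Implicit Types (q : Q) (t : fam n).

(** The kernel is an ideal that contains the generators of [J]; conversely a quadric in the kernel
    is homogeneous and hence itself a generator. *)
Lemma J_quadric q : J (val q) <-> minor_map (val q) = 0.
Proof.
split=> [[m [c [g [gJ ->]]]]|q0].
  rewrite /minor_map subst_sum big1 // => i _; rewrite substM -/(minor_map _) -/(minor_map (g i)).
  by have [_ ->] := gJ i; rewrite mulr0.
exists 1%N, (fun=> 1), (fun=> val q); rewrite big_ord1 mul1r; split=> // _.
by split=> //; exists 2; apply: dhomog_is_dhomog.
Qed.

Lemma val_lin c (u v : Q) : val (c *: u + v) = c *: val u + val v.
Proof. by []. Qed.

Lemma val_sumZ (I : Type) (r : seq I) (P : pred I) (c : I -> R) (F : I -> Q) :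
  val (\sum_(i <- r | P i) c i *: F i) = \sum_(i <- r | P i) c i *: val (F i).
Proof. by elim/big_rec2: _ => // i x y _ <-. Qed.

Lemma minor_map_lin c (u v : Q) : minor_map (val u) = 0 -> minor_map (val v) = 0 ->
  minor_map (val (c *: u + v)) = 0.
Proof.
by move=> u0 v0; rewrite val_lin /minor_map substD substZ -/(minor_map (val u)) u0 -/(minor_map (val v)) v0 scaler0 addr0.
Qed.

Variable q : fam n -> Q.
Hypothesis q_spec : forall t, fam_spec t (val (q t)).

Definition fam_weight t : {ffun 'I_n -> 'I_3} := [ffun k => inord (fam_wt t k)].

Lemma fam_weightE t k : fam_weight t k = fam_wt t k :> nat.
Proof. by rewrite ffunE inordK // ltnS type_wt_le2. Qed.

Lemma fam_highest t : highest (@rq R n) (@lq R n) (fam_weight t) (q t).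
Proof.
move=> k; rewrite fam_weightE; apply/poly_stringE.
by have [[_ h _] _] := fam_spec_hw (q_spec t); apply: h.
Qed.

Lemma fam_free lam0 (c : fam n -> R) :
  \sum_(t | fam_weight t == lam0) c t *: q t = 0 -> forall t, fam_weight t = lam0 -> c t = 0.
Proof.
move=> c0 t tl; apply: (fam_free_wt (q := fun t => val (q t)) q_spec (w := fun k => lam0 k)).
  rewrite -[RHS](congr1 val c0) val_sumZ; apply: eq_bigl => t'.
  apply/forallP/eqP => [h|<- k]; last by rewrite fam_weightE.
  by apply/ffunP => k; apply: val_inj; rewrite /= fam_weightE; apply/eqP.
by move=> k; rewrite -tl fam_weightE.
Qed.

Let J2 : {vspace Q} := (\sum_t lie_span (@lq R n) (q t))%VS.

Lemma fam_stable t : lie_stable (@rq R n) (@lq R n) (lie_span (@lq R n) (q t)).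
Proof. exact: (lie_span_stable (@lq_comm R n) (@rq_lq_comm R n) (fam_highest t)). Qed.

Lemma J2_stable : lie_stable (@rq R n) (@lq R n) J2.
Proof.
move=> k v /memv_sumP[vs vsV ->]; rewrite !linear_sum; split; apply: memv_sumr => t _;
  by have [] := fam_stable k (vsV t isT).
Qed.

Lemma lie_span_kernel t v : v \in lie_span (@lq R n) (q t) -> minor_map (val v) = 0.
Proof.
move=> vV; rewrite (coord_span vV); elim/big_rec: _ => [|i x _ x0].
  by rewrite /minor_map /subst rmorph0.
apply: minor_map_lin => //; set w := _`_i.
have : w \in codom (fun b => lower (@lq R n) b (q t)) by apply: mem_nth; rewrite size_tuple.
case/codomP => b ->; rewrite /lower.
elim: (enum _) => /= [|k s]; first by have [_] := fam_spec_hw (q_spec t).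
move: (lower_on _ s b (q t)) => u u0; elim: (nat_of_ord (b k)) => //= m IH.
by rewrite val_lq; apply: minor_map_lowering => //; apply: dhomog_is_dhomog.
Qed.

Lemma fam_spec_memv t (f : PA) : fam_spec t f -> forall u : Q, val u = f -> u \in J2.
Proof.
move=> sf u uf; have qJ : q t \in J2 by apply: (subvP (sumv_sup t isT (subvv _))); apply: mem_lie_span.
have [e|e] := fam_spec_uniq sf (q_spec t).
  by have -> : u = q t by apply: val_inj; rewrite uf.
by have -> : u = - q t by [apply: val_inj; rewrite uf e]; rewrite memvN.
Qed.

Lemma highest_kernel lam (u : Q) : minor_map (val u) = 0 ->
  highest (@rq R n) (@lq R n) lam u -> u \in J2.
Proof.
move=> u0 hu; pose w k : nat := lam k.
have w2 k : (w k <= 2)%N by rewrite -ltnS ltn_ord.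
have u2 : val u \is 2.-homog by apply: dhomog_is_dhomog.
have hs k : poly_string k (w k) (val u) by apply/poly_stringE/hu.
have mem t c f : fam_spec t f -> exists2 u' : Q, val u' = c *: f & u' \in J2.
  move=> sf; have [[f2 _ _] _] := fam_spec_hw sf.
  by exists (c *: DHomog f2) => //; apply/memvZ/(fam_spec_memv sf).
have mk M B : fam_cond (M, B) -> exists t, fam_set t = M /\ fam_part t = B.
  by move=> c; exists (Sub (M, B) c); rewrite /fam_set /fam_part SubK.
pose Z := [set k | w k == 0%N]; pose O := [set k | w k == 1%N].
case: (hw_classification w2 u2 hs u0) => [e|[[O0 eZ]|[i [j [ij Oij]]]]].
- by have -> : u = 0 by [apply: val_inj]; rewrite mem0v.
- have [c fE] := hw_empty w2 u2 hs u0 O0 eZ; rewrite -/Z in eZ fE.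
  have part i : i \in Z -> exists2 u' : Q, val u' = c i *: G4 R i (Z :\ i) & u' \in J2.
    (* Two indices give class (i), whose distinguished part is all of Z. Otherwise Z is nonempty of
       even cardinality different from 2, so it has at least four elements. *)
    move=> iZ; have [/cards2P[a [b [ab Zab]]]|Z2] := boolP (#|Z| == 2%N).
      have [|t [tM tB]] := mk Z Z; first by rewrite /fam_cond /= subxx Zab cards2 ab.
      have [x Zi ix] : exists2 x, Z = [set i; x] & i != x.
        move: iZ; rewrite Zab => /set2P[]->; first by exists b.
        by exists a; rewrite 1?setUC 1?eq_sym.
      have -> : Z :\ i = [set x] by rewrite Zi setU1K ?inE.
      by apply: (mem t); apply: FamPair; rewrite // ?tM ?tB.
    have Z4 : (3 < #|Z|)%N.
      move: eZ Z2; have : (0 < #|Z|)%N by apply/card_gt0P; exists i.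
      by case: #|Z| => [|[|[|[|]]]].
    have [|t [tM tB]] := mk Z [set i].
      by rewrite /fam_cond /= sub1set iZ cards1 eZ Z4.
    by apply: (mem t); rewrite -tM; apply: FamOne; rewrite // tM.
  have [v vE] : exists v : 'I_n -> Q, forall i, i \in Z -> val (v i) = c i *: G4 R i (Z :\ i) /\ v i \in J2.
    suff: forall i, exists x : Q, i \in Z -> val x = c i *: G4 R i (Z :\ i) /\ x \in J2.
      by move/fin_all_exists => [v h]; exists v.
    move=> i; have [iZ|] := boolP (i \in Z); last by exists 0.
    by have [x] := part i iZ; exists x.
  have -> : u = \sum_(i in Z) v i.
    apply: val_inj; rewrite {}fE; rewrite (eq_bigr (fun i => val (v i))) => [|i /vE[->]//].
    by elim/big_rec2: _ => // i x y _ ->.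
  by apply: memv_suml => i /vE[].
have [c fE] := hw_pair w2 u2 hs u0 ij Oij; rewrite -/Z in fE.
(* With Z empty [G23] is an empty sum; this is why the family asks for more than two indices in that
   case. *)
have [Z0|Zn0] := eqVneq Z set0.
  have -> : u = 0; last exact: mem0v.
  by apply: val_inj; rewrite fE Z0 /G23 cards0 big_set0 addr0 scaler0.
have iZ : i \notin Z by have := set21 i j; rewrite -Oij !inE => /eqP ->.
have jZ : j \notin Z by have := set22 i j; rewrite -Oij !inE => /eqP ->.
have [|t [tM tB]] := mk ([set i; j] :|: Z) [set i; j].
  by rewrite /fam_cond /= subsetUl cards2 ij.
have ZE : fam_set t :\: [set i; j] = Z.
  rewrite tM setDUl setDv set0U; apply/setDidPl; exact: disjoint_pair.
have sp : fam_spec t (G23 R Z i j).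
  rewrite -ZE; apply: FamTwo => //.
  have -> : #|fam_set t| = (#|Z| + 2)%N.
    by rewrite -(cardsID [set i; j] (fam_set t)) ZE tM (setIidPr (subsetUl _ _)) cards2 ij addnC.
  by rewrite addn2 !ltnS card_gt0.
by have [u' /= uE u'J] := mem t c _ sp; have -> : u = u' by [apply: val_inj; rewrite fE].
Qed.

(** Lowering preserves the kernel, which gives one inclusion. The other one is [highest_generate]
    for the kernel and the sum of the generated modules, so that only highest weight vectors have to
    be examined. *)
Lemma J2E (u : Q) : u \in J2 <-> J (val u).
Proof.
split=> [/memv_sumP[vs vsV ->]|/J_quadric].
  apply/J_quadric; elim/big_rec: _ => [|t x _ x0]; first by rewrite /minor_map /subst rmorph0.
  by rewrite -[vs t]scale1r; apply: minor_map_lin => //; apply: (lie_span_kernel (vsV t isT)).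
move: u; apply: (highest_generate (@rq_comm R n) (@lq_comm R n) (@rq_lq_comm R n) (@hw_part_quad R n)).
- exact: minor_map_lin.
- by move=> k v v0; rewrite val_rq; apply: minor_map_raising => //; apply: dhomog_is_dhomog.
- by move=> k v v0; rewrite val_lq; apply: minor_map_lowering => //; apply: dhomog_is_dhomog.
- by move=> k v /(J2_stable k)[].
- exact: highest_kernel.
Qed.

Lemma fam_module t : generated_by (q t) (lie_span (@lq R n) (q t)) /\
  irreducible_module (lie_span (@lq R n) (q t)).
Proof.
have sub := lie_submodule (fam_stable (t := t)); split.
  split=> [//||U /submodule_lie Us qU]; first exact: mem_lie_span.
  exact: lie_span_sub Us qU.
split=> [//|V0|U /submodule_lie Us UV].
  have := mem_lie_span (@lq R n) (q t); rewrite V0 memv0.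
  by rewrite (negPf (highest_neq0 fam_free t)).
exact: (lie_span_irreducible (@rq_comm R n) (@lq_comm R n) (@rq_lq_comm R n)
  (@hw_part_quad R n) (fam_highest t) Us UV).
Qed.

Lemma listed_highest (f : PA) : listed_quadric f -> highest_weight_vector f.
Proof.
move=> /listed_fam_spec[t sf]; have [[_ hs tor] _] := fam_spec_hw sf.
split; last by move=> k; have [] := hs k.
split; last by exists (fun k => Posz (fam_wt t k)) => s s0; rewrite tor.
move=> f0; have /eqP := highest_neq0 fam_free t; apply.
by apply: val_inj; case: (fam_spec_uniq (q_spec t) sf) => ->; rewrite f0 ?oppr0.
Qed.

(** Distinct members of the family are linearly independent by [highest_free], also across weights,
    so no quadric is proportional to two of them. *)
Lemma listed_unique (f : PA) : listed_quadric f ->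
  exists! t, f = val (q t) \/ f = - val (q t).
Proof.
move=> /listed_fam_spec[t sf]; exists t; split; first exact: fam_spec_uniq sf (q_spec t).
move=> t' ft'; apply/eqP/negP => /negP tt'.
have [e e0] : exists2 e : R, e != 0 & e *: q t = q t'.
  have m1 : -1 != 0 :> R by rewrite oppr_eq0 oner_eq0.
  have [e1|e1] := fam_spec_uniq sf (q_spec t); case: ft' => e2.
  - by exists 1; rewrite ?oner_eq0 // scale1r; apply: val_inj; rewrite -e1 -e2.
  - by exists (-1) => //; rewrite scaleN1r; apply: val_inj; rewrite /= -e1 e2 opprK.
  - by exists (-1) => //; rewrite scaleN1r; apply: val_inj; rewrite /= -e1 e2.
  - by exists 1; rewrite ?oner_eq0 // scale1r; apply: val_inj; apply: oppr_inj; rewrite -e1 -e2.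
move=> eq; case/negP: e0; apply/eqP.
have := highest_free (@lq_comm R n) (@rq_lq_comm R n) fam_highest fam_free
  (c := fun x => if x == t then e else if x == t' then -1 else 0).
have t't : (t' == t) = false by rewrite eq_sym; apply/negbTE.
rewrite (bigD1 t) //= eqxx (bigD1 t') ?t't //= eqxx big1 => [|x /andP[/negPf -> /negPf ->]]; last by rewrite scale0r.
by rewrite addr0 scaleN1r eq subrr => /(_ erefl t); rewrite eqxx.
Qed.

Lemma directv_J2 : directv (\sum_t lie_span (@lq R n) (q t)).
Proof. exact: (directv_sum_lie_span (@lq_comm R n) (@rq_lq_comm R n) fam_highest fam_free). Qed.

Lemma dim_J2 : \dim J2 = (3 ^ (n - 2) * 'C(n, 2)
  + 4 * (\sum_(3 <= m < n.+1) 3 ^ (n - m) * 'C(n, m) * 'C(m, 2))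
  + \sum_(2 <= k < (n./2).+1) 2 * k * 3 ^ (n - 2 * k) * 'C(n, 2 * k))%N.
Proof.
rewrite (dim_sum_lie_span (@lq_comm R n) (@rq_lq_comm R n) fam_highest fam_free).
rewrite -fam_dim_sum -sum_fam_wt; apply: eq_bigr => t _; apply: eq_bigr => k _.
by rewrite fam_weightE.
Qed.

End Assembly.

Theorem theorem6p5 (R : realType) (n : nat) :
  exists J2 : {vspace quadric R n},
    [/\ forall q : quadric R n, q \in J2 <-> J (val q),
        submodule J2,
        \dim J2 =
          (3 ^ (n - 2) * 'C(n, 2)
           + 4 * (\sum_(3 <= m < n.+1) 3 ^ (n - m) * 'C(n, m) * 'C(m, 2))
           + \sum_(2 <= k < (n./2).+1)
               2 * k * 3 ^ (n - 2 * k) * 'C(n, 2 * k))%N,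
        forall f : ringPA R n, listed_quadric f -> highest_weight_vector f
      & exists (N : nat) (q : 'I_N -> quadric R n)
               (V : 'I_N -> {vspace quadric R n}),
          [/\ forall t, listed_quadric (val (q t)),
              forall f : ringPA R n, listed_quadric f ->
                exists! t, f = val (q t) \/ f = - val (q t),
              forall t, generated_by (q t) (V t)
                        /\ irreducible_module (V t),
              J2 = (\sum_(t < N) V t)%VS
            & directv (\sum_(t < N) V t)%VS]].
Proof.
have ex (t : fam n) : exists q : quadric R n, fam_spec t (val q).
  have [f sf] := fam_spec_ex R t.
  by have [[f2 _ _] _] := fam_spec_hw sf; exists (DHomog f2).
have [q q_spec] := fin_all_exists ex.
exists (\sum_t lie_span (@lq R n) (q t))%VS; split.
- exact: J2E.
- by apply: lie_submodule; apply: J2_stable.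
- exact: dim_J2.
- exact: (listed_highest q_spec).
exists #|{: fam n}|, (fun i => q (enum_val i)), (fun i => lie_span (@lq R n) (q (enum_val i))).
split.
- by move=> i; apply: fam_spec_listed (q_spec _).
- move=> f /(listed_unique q_spec)[t [ft tu]]; exists (enum_rank t); split; first by rewrite enum_rankK.
  by move=> i /tu ->; rewrite enum_valK.
- by move=> i; apply: fam_module.
- by rewrite [RHS](reindex enum_rank) /=; [under [RHS]eq_bigr do rewrite enum_rankK|exists enum_val => ? _; rewrite ?enum_rankK ?enum_valK].
apply/directv_sumP => i _; have /directv_sumP/(_ (enum_val i) isT) := directv_J2 q_spec.
rewrite (reindex (fun j : 'I_#|{: fam n}| => enum_val j)) /=; last first.
  by exists enum_rank => ? _; rewrite ?enum_rankK ?enum_valK.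
by under eq_bigl do rewrite (inj_eq enum_val_inj).
Qed.
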